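(* Let $(E,C)$ be an adaptable separated graph, let $S(E,C)$ be the inverse semigroup associated to $(E,C)$, let $K$ be a field with involution and let $\mathcal S_K(E,C)$ be the $*$-algebra over $K$ associated to $(E,C)$. Let $A_K(\mathcal G_{tight}(S(E,C)))$ be the Steinberg algebra of the tight groupoid $\mathcal G_{tight}(S(E,C))$. There is a $*$-isomorphism $$\mathcal S_K(E,C)\cong A_K(\mathcal G_{tight}(S(E,C)))$$ sending $\iota(s)\in\mathcal S_K(E,C)$ to $1_{\Theta(s,D_{s^*s})}$ for each $s\in S(E,C)$.
   Context: **Adaptable separated graphs.** $\mathbb N=\{1,2,\dots\}$. For a directed graph $E=(E^0,E^1,s,r)$, paths are $e_1\cdots e_n$ with $r(e_i)=s(e_{i+1})$; vertices are paths of length $0$. A separated graph $(E,C)$ is a directed graph $E$ with $C=\bigsqcup_{v\in E^0}C_v$, where $C_v$ is a partition of $s^{-1}(v)$ into nonempty subsets ($C_v=\emptyset$ if $v$ is a sink). It is finitely separated if all sets in $C$ are finite. Put $v\le w$ if there is a path from $w$ to $v$; let $(I,\le)$ be the antisymmetrization of $(E^0,\le)$, whose elements are the transitive components. A finitely separated graph $(E,C)$ is adaptable if $I$ is finite and there are a partition $I=I_{free}\sqcup I_{reg}$ and subgraphs $(E_p)_{p\in I}$, with $E_p^0$ the vertex set of the component $p$, such that: (1) $E^0=\bigsqcup_p E_p^0$; $E_p$ is a transitive (any two vertices joined by a directed path) row-finite graph if $p\in I_{reg}$; $E_p^0=\{v^p\}$ if $p\in I_{free}$. (2) For $p\in I_{reg}$,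 $w\in E_p^0$: $|C_w|=1$, $|s_{E_p}^{-1}(w)|\ge 2$, and every edge with source $w$ lies in $E_p$ or has range in $E_q^0$ with $q<p$. (3) For $p\in I_{free}$: $s^{-1}(v^p)=\emptyset$ iff $p$ is minimal in $I$ (then put $k(p)=0$). If $p$ is not minimal, $C_{v^p}=\{X_1^{(p)},\dots,X_{k(p)}^{(p)}\}$ is finite with $X_i^{(p)}=\{\alpha(p,i),\beta(p,i,1),\dots,\beta(p,i,g(p,i))\}$, $g(p,i)\ge1$, $\alpha(p,i)$ a loop at $v^p$, $r(\beta(p,i,t))\in E_q^0$ with $q<p$; and $E_p^1=\{\alpha(p,1),\dots,\alpha(p,k(p))\}$. **The inverse semigroup $S(E,C)$.** It is the $*$-semigroup with $0$ ($*$-semigroup: $s^{**}=s$, $(st)^*=t^*s^*$) generated by $E^0\cup E^1\cup\{(t_i^v)^{\pm1}: i\in\mathbb N,v\in E^0\}$ with relations: (R1) $vw=\delta_{v,w}v$, $v^*=v$ for $v,w\in E^0$; (R2) $e=s(e)e=er(e)$ for $e\in E^1$, and $e^*f=\delta_{e,f}r(e)$ for $e,f$ in the same set $X\in C$; (R3) for $p\in I_{free}$, $i\ne j$: $\alpha(p,i)\alpha(p,j)=\alpha(p,j)\alpha(p,i)$, $\alpha(p,i)\alpha(p,j)^*=\alpha(p,j)^*\alpha(p,i)$; (R4) for $p\in I_{free}$: $\beta(p,i,s)^*\beta(p,j,t)=0$ if $(i,s)\neq(j,t)$; (R5) for each $v$ the elements $(t_i^v)^{\pm1}$ commute mutually,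 $vt_i^v=t_i^v=t_i^vv$, $t_i^v(t_i^v)^{-1}=v=(t_i^v)^{-1}t_i^v$, $(t_i^v)^*=(t_i^v)^{-1}$; (R6) $t_i^{s(e)}e=e\,t_i^{r(e)}$ if $s(e)\in E_p^0$, $p\in I_{reg}$; (R7) for $p\in I_{free}$: $(t_i^{v^p})^{\pm1}\beta(p,j,s)=\beta(p,j,s)(t^{r(\beta(p,j,s))}_{i+k(p)-1})^{\pm1}$; (R8) for $p\in I_{free}$, $i\ne j$: $\alpha(p,i)\beta(p,j,s)=\beta(p,j,s)t^{r(\beta(p,j,s))}_{\sigma_j^p(i)}$ and $\alpha(p,i)^*\beta(p,j,s)=\beta(p,j,s)(t^{r(\beta(p,j,s))}_{\sigma_j^p(i)})^{-1}$, where $\sigma_j^p$ is the increasing bijection $\{1,\dots,k(p)\}\setminus\{j\}\to\{1,\dots,k(p)-1\}$; (R9) for $p\in I_{free}$: $t_i^{v^p}$ commutes with $\alpha(p,j)$ and $\alpha(p,j)^*$. $S(E,C)$ is an inverse semigroup; $\mathcal E$ is its semilattice of idempotents ($e\le f$ iff $ef=e$). **The algebra.** $\mathcal S_K(E,C)$ is the (not necessarily unital) $*$-algebra over $K$ with the same generators as $S(E,C)$ and defining relations (R1)–(R9) together with (R10) $v=\sum_{e\in X}ee^*$ for all $v\in E^0$, $X\in C_v$. $\iota\colon S(E,C)\to\mathcal S_K(E,C)$ is the canonical map, the identity on generators. **Tight groupoid.** A filter on $\mathcal E$ is a nonempty $\eta\subseteq\mathcal E$ with $0\notin\eta$, closed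 under products and upward closed. Filters are topologized as a subspace of $\{0,1\}^{\mathcal E}$. A finite cover of $\mathcal F_e=\{f\in\mathcal E:f\le e\}$ is a finite $Z\subseteq\mathcal F_e$ such that every $0\ne f\in\mathcal F_e$ has $fz\neq0$ for some $z\in Z$. A filter $\eta$ is tight if $e\in\eta$ implies $Z\cap\eta\ne\emptyset$ for every finite cover $Z$ of $\mathcal F_e$; $\widehat{\mathcal E}_{tight}$ is the space of tight filters. For $e\in\mathcal E$ let $D_e=\{\eta\in\widehat{\mathcal E}_{tight}: e\in\eta\}$; $s\in S(E,C)$ acts by $\alpha_s\colon D_{s^*s}\to D_{ss^*}$, $\alpha_s(\eta)=\{f\in\mathcal E: s^*fs\in\eta\}$. $\mathcal G_{tight}(S(E,C))$ is the groupoid of germs $[s,x]$, $x\in D_{s^*s}$, where $[s,x]=[s',y]$ iff $x=y$ and $sf=s'f$ for some $f\in\mathcal E$ with $f\in x$; source $x$, range $\alpha_s(x)$, $[s,\alpha_t(x)][t,x]=[st,x]$, $[s,x]^{-1}=[s^*,\alpha_s(x)]$. Its topology is generated by $\Theta(s,U)=\{[s,x]:x\in U\}$, $U\subseteq D_{s^*s}$ open. It is an ample Hausdorff groupoid. **Steinberg algebra.** For an ample Hausdorff groupoid $\mathcal G$, $A_K(\mathcal G)$ is the $*$-algebra of locally constant compactly supported functions $\mathcal G\to K$ with convolution $(fg)(\gamma)=\sum_{\gamma_1\gamma_2=\gamma}f(\gamma_1)g(\gamma_2)$ and involution $f^*(\gamma)=f(\gamma^{-1})^*$; $1_B$ is the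 characteristic function of $B$. *)

(* Defs.v *)
From HB Require Import structures.
From mathcomp Require Import all_boot all_order all_algebra.
From mathcomp Require Import all_classical all_reals.
From mathcomp Require Import topology numfun.

Set Implicit Arguments.
Unset Strict Implicit.
Unset Printing Implicit Defensive.

Import GRing.Theory.

Local Open Scope classical_set_scope.
Local Open Scope ring_scope.
Local Open Scope quotient_scope.

Local Notation "x *g y" := ((x * y)%g)
  (at level 40, left associativity, only parsing).

(* Every type is a [choiceType] classically (as [{classic T}]); the graph may
   be infinite. [blocks v] is the partition C_v. *)
Record sep_graph := SepGraph {
  vertex : choiceType;
  edge : choiceType;
  src : edge -> vertex;
  rng : edge -> vertex;
  blocks : vertex -> set (set edge);
  blocksP : forall v, partition (blocks v) id [set e | src e = v]
}.

Section Components.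
Variable E : sep_graph.

Definition finitely_separated := forall v X, @blocks E v X -> finite_set X.

Fixpoint gpath (F : set (edge E)) v (es : seq (edge E)) w : Prop :=
  if es is e :: es' then [/\ F e, src e = v & gpath F (rng e) es' w]
  else v = w.

Definition vle v w := exists es, gpath setT w es v.

Definition vclass v : set (vertex E) := [set w | vle v w /\ vle w v].

(* The antisymmetrization I, as the type of equivalence classes. *)
Definition component : Type := range vclass.

Definition verts (p : component) : set (vertex E) := set_val p.

Definition cle (p q : component) :=
  exists v w, [/\ verts p v, verts q w & vle v w].

Definition clt (p q : component) := cle p q /\ p <> q.

Definition cminimal (p : component) := forall q, ~ clt q p.

End Components.

(* I_reg is the complement of [Ifree]. Indices are 0-based: [alpha p i] is
   alpha(p,i+1) and [beta p i t] is beta(p,i+1,t+1). The values of [vfree],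
   [nblocks], [alpha], [nbeta] and [beta] at regular components are irrelevant:
   they are never used. *)
Record adaptable (E : sep_graph) := Adaptable {
  Ifree : set (component E);
  subedge : component E -> set (edge E);
  vfree : component E -> vertex E;
  nblocks : component E -> nat;
  alpha : forall p, 'I_(nblocks p) -> edge E;
  nbeta : forall p, 'I_(nblocks p) -> nat;
  beta : forall p (i : 'I_(nblocks p)), 'I_(nbeta i) -> edge E;

  adaptable_fsep : finitely_separated E;
  adaptable_finite : finite_set [set: component E];

  subedgeP : forall p e, subedge p e -> verts p (src e) /\ verts p (rng e);
  reg_transitive : forall p, ~ Ifree p -> forall v w, verts p v -> verts p w ->
    exists es, gpath (subedge p) v es w;
  reg_row_finite : forall p, ~ Ifree p -> forall w, verts p w ->
    finite_set [set e | subedge p e /\ src e = w];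
  vertsP_free : forall p, Ifree p -> verts p = [set vfree p];

  reg_one_block : forall p, ~ Ifree p -> forall w, verts p w ->
    exists X, blocks w = [set X];
  reg_two_edges : forall p, ~ Ifree p -> forall w, verts p w ->
    exists e f, [/\ e <> f, subedge p e /\ src e = w & subedge p f /\ src f = w];
  reg_edges : forall p, ~ Ifree p -> forall e, verts p (src e) ->
    subedge p e \/ exists2 q, clt q p & verts q (rng e);

  free_sink : forall p, Ifree p ->
    [set e | src e = vfree p] = set0 <-> cminimal p;
  free_minimal : forall p, Ifree p -> cminimal p -> nblocks p = 0%N;
  free_blocks : forall p, Ifree p -> ~ cminimal p ->
    let X (i : 'I_(nblocks p)) := [set alpha i] `|` range (@beta p i) in
    blocks (vfree p) = range X /\ injective X;
  free_alpha : forall p, Ifree p -> forall i : 'I_(nblocks p),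
    src (alpha i) = vfree p /\ rng (alpha i) = vfree p;
  free_nbeta : forall p, Ifree p -> forall i : 'I_(nblocks p), (0 < nbeta i)%N;
  free_beta_inj : forall p, Ifree p -> forall i : 'I_(nblocks p),
    injective (@beta p i);
  free_beta : forall p, Ifree p -> forall (i : 'I_(nblocks p)) t,
    exists2 q, clt q p & verts q (rng (beta (i := i) t));
  free_edges : forall p, Ifree p -> subedge p = range (@alpha p)
}.

HB.mixin Record Semigroup_isStar0 S & Semigroup S := {
  szero : S;
  star : S -> S;
  mul0s : forall x : S, szero *g x = szero;
  muls0 : forall x : S, x *g szero = szero;
  starK : involutive star;
  starM : forall x y : S, star (x *g y) = star y *g star x
}.

#[short(type="starSemigroup0Type")]
HB.structure Definition StarSemigroup0 :=
  {S of Semigroup_isStar0 S & Semigroup S}.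

(* [GT b i v] is t_(i+1)^v if [b] is true and (t_(i+1)^v)^-1 otherwise. *)
Inductive generator (E : sep_graph) :=
| GV of vertex E
| GE of edge E
| GT of bool & nat & vertex E.

Inductive sterm (E : sep_graph) :=
| SZero
| SGen of generator E
| SMul of sterm E & sterm E
| SStar of sterm E.

Arguments SZero {E}.

HB.instance Definition _ (E : sep_graph) := gen_eqMixin (sterm E).
HB.instance Definition _ (E : sep_graph) := gen_choiceMixin (sterm E).

Section Semigroup.
Variables (E : sep_graph) (A : adaptable E).

Local Notation V v := (SGen (GV v)).
Local Notation "'e_ f" := (SGen (GE f)) (at level 8, f at level 2).
Local Notation T b i v := (SGen (GT b i v)).
Local Notation "x ** y" := (SMul x y) (at level 40, left associativity).
Local Notation "x ^*" := (SStar x).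
Local Notation al i := (@alpha E A _ i).
Local Notation be t := (@beta E A _ _ t).

(* Shifting to 0-based indices leaves the expression i+k(p)-1 in R7 unchanged,
   and the bijection sigma_j of R8 becomes [unbump j], which maps i to i if i < j and to
   i-1 if i > j. *)
Inductive srel : sterm E -> sterm E -> Prop :=
| R1_idem v : srel (V v ** V v) (V v)
| R1_orth v w : v <> w -> srel (V v ** V w) SZero
| R1_star v : srel (V v)^* (V v)
| R2_src e : srel ('e_e) (V (src e) ** 'e_e)
| R2_rng e : srel ('e_e) ('e_e ** V (rng e))
| R2_same v X e : blocks v X -> X e -> srel (('e_e)^* ** 'e_e) (V (rng e))
| R2_diff v X e f : blocks v X -> X e -> X f -> e <> f ->
    srel (('e_e)^* ** 'e_f) SZero
| R3_comm p (i j : 'I_(nblocks A p)) : Ifree A p -> i != j ->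
    srel ('e_(al i) ** 'e_(al j)) ('e_(al j) ** 'e_(al i))
| R3_star p (i j : 'I_(nblocks A p)) : Ifree A p -> i != j ->
    srel ('e_(al i) ** ('e_(al j))^*) (('e_(al j))^* ** 'e_(al i))
| R4 p (i j : 'I_(nblocks A p)) (s : 'I_(nbeta i)) (t : 'I_(nbeta j)) :
    Ifree A p -> Tagged (fun i => 'I_(nbeta i)) s != Tagged _ t ->
    srel (('e_(be s))^* ** 'e_(be t)) SZero
| R5_comm v b c i j : srel (T b i v ** T c j v) (T c j v ** T b i v)
| R5_left v i : srel (V v ** T true i v) (T true i v)
| R5_right v i : srel (T true i v ** V v) (T true i v)
| R5_mulV v i : srel (T true i v ** T false i v) (V v)
| R5_Vmul v i : srel (T false i v ** T true i v) (V v)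
| R5_star v i : srel (T true i v)^* (T false i v)
| R6 p e i : ~ Ifree A p -> verts p (src e) ->
    srel (T true i (src e) ** 'e_e) ('e_e ** T true i (rng e))
| R7 p (j : 'I_(nblocks A p)) (s : 'I_(nbeta j)) b i : Ifree A p ->
    srel (T b i (vfree A p) ** 'e_(be s))
         ('e_(be s) ** T b (i + nblocks A p - 1) (rng (be s)))
| R8 p (i j : 'I_(nblocks A p)) (s : 'I_(nbeta j)) : Ifree A p -> i != j ->
    srel ('e_(al i) ** 'e_(be s)) ('e_(be s) ** T true (unbump j i) (rng (be s)))
| R8_star p (i j : 'I_(nblocks A p)) (s : 'I_(nbeta j)) :
    Ifree A p -> i != j ->
    srel (('e_(al i))^* ** 'e_(be s))
         ('e_(be s) ** T false (unbump j i) (rng (be s)))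
| R9 p (j : 'I_(nblocks A p)) i : Ifree A p ->
    srel (T true i (vfree A p) ** 'e_(al j)) ('e_(al j) ** T true i (vfree A p))
| R9_star p (j : 'I_(nblocks A p)) i : Ifree A p ->
    srel (T true i (vfree A p) ** ('e_(al j))^*)
         (('e_(al j))^* ** T true i (vfree A p)).

Inductive scong : sterm E -> sterm E -> Prop :=
| scong_refl x : scong x x
| scong_sym x y : scong x y -> scong y x
| scong_trans y x z : scong x y -> scong y z -> scong x z
| scong_mul x x' y y' : scong x x' -> scong y y' -> scong (x ** y) (x' ** y')
| scong_star x x' : scong x x' -> scong x^* x'^*
| scong_mulA x y z : scong (x ** (y ** z)) (x ** y ** z)
| scong_mul0s x : scong (SZero ** x) SZero
| scong_muls0 x : scong (x ** SZero) SZero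
| scong_starK x : scong x^*^* x
| scong_starM x y : scong (x ** y)^* (y^* ** x^*)
| scong_rel x y : srel x y -> scong x y.

Definition scongb (x y : sterm E) : bool := `[< scong x y >].

Lemma scongb_refl : reflexive scongb.
Proof. by move=> x; apply/asboolP/scong_refl. Qed.

Lemma scongb_sym : symmetric scongb.
Proof. by move=> x y; apply/asboolP/asboolP; exact: scong_sym. Qed.

Lemma scongb_trans : transitive scongb.
Proof. by move=> y x z /asboolP xy /asboolP yz; apply/asboolP/(scong_trans xy). Qed.

Canonical scong_equiv := EquivRel scongb scongb_refl scongb_sym scongb_trans.

Definition graph_semigroup := {eq_quot scong_equiv}.

HB.instance Definition _ := Choice.on graph_semigroup.
HB.instance Definition _ := EqQuotient.on graph_semigroup.

Local Notation S := graph_semigroup.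

Lemma graph_semigroupP x y : \pi_S x = \pi_S y <-> scong x y.
Proof. by split=> [/eqmodP/asboolP|xy]; last exact/eqmodP/asboolP. Qed.

Lemma scong_repr x : scong (repr (\pi_S x)) x.
Proof. by apply/graph_semigroupP; rewrite reprK. Qed.

Definition gs_zero : S := \pi_S SZero.
Definition gs_mul : S -> S -> S := lift_op2 S (@SMul E).
Definition gs_star : S -> S := lift_op1 S (@SStar E).

Lemma gs_mulE x y : gs_mul (\pi_S x) (\pi_S y) = \pi_S (x ** y).
Proof. by rewrite /gs_mul; unlock; apply/graph_semigroupP/scong_mul; exact: scong_repr. Qed.

Lemma gs_starE x : gs_star (\pi_S x) = \pi_S x^*.
Proof. by rewrite /gs_star; unlock; apply/graph_semigroupP/scong_star/scong_repr. Qed.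

Lemma gs_mulA : associative gs_mul.
Proof.
elim/quotW=> x; elim/quotW=> y; elim/quotW=> z; rewrite !gs_mulE.
exact/graph_semigroupP/scong_mulA.
Qed.

HB.instance Definition _ := isSemigroup.Build S gs_mulA.

Lemma gs_mul0s (x : S) : gs_mul gs_zero x = gs_zero.
Proof.
elim/quotW: x => x; rewrite gs_mulE; exact/graph_semigroupP/scong_mul0s.
Qed.

Lemma gs_muls0 (x : S) : gs_mul x gs_zero = gs_zero.
Proof.
elim/quotW: x => x; rewrite gs_mulE; exact/graph_semigroupP/scong_muls0.
Qed.

Lemma gs_starK : involutive gs_star.
Proof.
by elim/quotW=> x; rewrite !gs_starE; exact/graph_semigroupP/scong_starK.
Qed.

Lemma gs_starM (x y : S) : gs_star (gs_mul x y) = gs_mul (gs_star y) (gs_star x).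
Proof.
elim/quotW: x => x; elim/quotW: y => y.
rewrite !(gs_mulE, gs_starE).
exact/graph_semigroupP/scong_starM.
Qed.

HB.instance Definition _ :=
  Semigroup_isStar0.Build S gs_mul0s gs_muls0 gs_starK gs_starM.

End Semigroup.

(* [bar] is the involution of the field [K]; algebras need not be unital. *)
HB.mixin Record Lmodule_isStarAlgebra (K : fieldType) (bar : {rmorphism K -> K})
    B & GRing.Lmodule K B := {
  amul : B -> B -> B;
  astar : B -> B;
  amulA : associative amul;
  amulDl : left_distributive amul +%R;
  amulDr : right_distributive amul +%R;
  amulZl : forall k (x y : B), amul (k *: x) y = k *: amul x y;
  amulZr : forall k (x y : B), amul x (k *: y) = k *: amul x y;
  astarK : involutive astar;
  astarM : forall x y : B, astar (amul x y) = amul (astar y) (astar x);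
  astarD : forall x y : B, astar (x + y) = astar x + astar y;
  astarZ : forall k (x : B), astar (k *: x) = bar k *: astar x
}.

#[short(type="starAlgType")]
HB.structure Definition StarAlgebra (K : fieldType) (bar : {rmorphism K -> K}) :=
  {B of Lmodule_isStarAlgebra K bar B & GRing.Lmodule K B}.

Inductive aterm (K : fieldType) (E : sep_graph) :=
| AZero
| AGen of generator E
| AAdd of aterm K E & aterm K E
| AOpp of aterm K E
| AScale of K & aterm K E
| AMul of aterm K E & aterm K E
| AStar of aterm K E.

Arguments AZero {K E}.
Arguments AGen {K E}.

HB.instance Definition _ (K : fieldType) (E : sep_graph) :=
  gen_eqMixin (aterm K E).
HB.instance Definition _ (K : fieldType) (E : sep_graph) :=
  gen_choiceMixin (aterm K E).

Section Algebra.
Variables (K : fieldType) (bar : {rmorphism K -> K}).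
Variables (E : sep_graph) (A : adaptable E).

Implicit Types x y z : aterm K E.

Fixpoint of_sterm (u : sterm E) : aterm K E :=
  match u with
  | SZero => AZero
  | SGen g => AGen g
  | SMul u1 u2 => AMul (of_sterm u1) (of_sterm u2)
  | SStar u1 => AStar (of_sterm u1)
  end.

Inductive acong : aterm K E -> aterm K E -> Prop :=
| acong_refl x : acong x x
| acong_sym x y : acong x y -> acong y x
| acong_trans y x z : acong x y -> acong y z -> acong x z
| acong_add x x' y y' : acong x x' -> acong y y' ->
    acong (AAdd x y) (AAdd x' y')
| acong_opp x x' : acong x x' -> acong (AOpp x) (AOpp x')
| acong_scale k x x' : acong x x' -> acong (AScale k x) (AScale k x')
| acong_mul x x' y y' : acong x x' -> acong y y' ->
    acong (AMul x y) (AMul x' y')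
| acong_star x x' : acong x x' -> acong (AStar x) (AStar x')
| acong_addA x y z : acong (AAdd x (AAdd y z)) (AAdd (AAdd x y) z)
| acong_addC x y : acong (AAdd x y) (AAdd y x)
| acong_add0 x : acong (AAdd AZero x) x
| acong_addN x : acong (AAdd (AOpp x) x) AZero
| acong_scaleA k l x : acong (AScale k (AScale l x)) (AScale (k * l) x)
| acong_scale1 x : acong (AScale 1 x) x
| acong_scaleDr k x y :
    acong (AScale k (AAdd x y)) (AAdd (AScale k x) (AScale k y))
| acong_scaleDl k l x :
    acong (AScale (k + l) x) (AAdd (AScale k x) (AScale l x))
| acong_mulA x y z : acong (AMul x (AMul y z)) (AMul (AMul x y) z)
| acong_mulDl x y z : acong (AMul (AAdd x y) z) (AAdd (AMul x z) (AMul y z))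
| acong_mulDr x y z : acong (AMul x (AAdd y z)) (AAdd (AMul x y) (AMul x z))
| acong_mulZl k x y : acong (AMul (AScale k x) y) (AScale k (AMul x y))
| acong_mulZr k x y : acong (AMul x (AScale k y)) (AScale k (AMul x y))
| acong_starK x : acong (AStar (AStar x)) x
| acong_starM x y : acong (AStar (AMul x y)) (AMul (AStar y) (AStar x))
| acong_starD x y : acong (AStar (AAdd x y)) (AAdd (AStar x) (AStar y))
| acong_starZ k x : acong (AStar (AScale k x)) (AScale (bar k) (AStar x))
| acong_rel u w : srel A u w -> acong (of_sterm u) (of_sterm w)
| R10 v X (es : seq (edge E)) : blocks v X -> uniq es -> [set` es] = X ->
    acong (AGen (GV v))
      (\big[@AAdd K E/AZero]_(e <- es) AMul (AGen (GE e)) (AStar (AGen (GE e)))).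

Definition acongb (x y : aterm K E) : bool := `[< acong x y >].

Lemma acongb_refl : reflexive acongb.
Proof. by move=> x; apply/asboolP/acong_refl. Qed.

Lemma acongb_sym : symmetric acongb.
Proof. by move=> x y; apply/asboolP/asboolP; exact: acong_sym. Qed.

Lemma acongb_trans : transitive acongb.
Proof. by move=> y x z /asboolP xy /asboolP yz; apply/asboolP/(acong_trans xy). Qed.

Canonical acong_equiv := EquivRel acongb acongb_refl acongb_sym acongb_trans.

Definition graph_alg := {eq_quot acong_equiv}.

HB.instance Definition _ := Choice.on graph_alg.
HB.instance Definition _ := EqQuotient.on graph_alg.

Local Notation B := graph_alg.

Lemma graph_algP x y : \pi_B x = \pi_B y <-> acong x y.
Proof. by split=> [/eqmodP/asboolP|xy]; last exact/eqmodP/asboolP. Qed.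

Lemma acong_repr x : acong (repr (\pi_B x)) x.
Proof. by apply/graph_algP; rewrite reprK. Qed.

Definition ga_zero : B := \pi_B AZero.
Definition ga_add : B -> B -> B := lift_op2 B (@AAdd K E).
Definition ga_opp : B -> B := lift_op1 B (@AOpp K E).
Definition ga_scale k : B -> B := lift_op1 B (@AScale K E k).
Definition ga_mul : B -> B -> B := lift_op2 B (@AMul K E).
Definition ga_star : B -> B := lift_op1 B (@AStar K E).

Lemma ga_addE x y : ga_add (\pi_B x) (\pi_B y) = \pi_B (AAdd x y).
Proof. by rewrite /ga_add; unlock; apply/graph_algP/acong_add; exact: acong_repr. Qed.

Lemma ga_oppE x : ga_opp (\pi_B x) = \pi_B (AOpp x).
Proof. by rewrite /ga_opp; unlock; apply/graph_algP/acong_opp/acong_repr. Qed.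

Lemma ga_scaleE k x : ga_scale k (\pi_B x) = \pi_B (AScale k x).
Proof. by rewrite /ga_scale; unlock; apply/graph_algP/acong_scale/acong_repr. Qed.

Lemma ga_mulE x y : ga_mul (\pi_B x) (\pi_B y) = \pi_B (AMul x y).
Proof. by rewrite /ga_mul; unlock; apply/graph_algP/acong_mul; exact: acong_repr. Qed.

Lemma ga_starE x : ga_star (\pi_B x) = \pi_B (AStar x).
Proof. by rewrite /ga_star; unlock; apply/graph_algP/acong_star/acong_repr. Qed.

Let gaE := (ga_addE, ga_oppE, ga_scaleE, ga_mulE, ga_starE).

Lemma ga_addA : associative ga_add.
Proof.
elim/quotW=> x; elim/quotW=> y; elim/quotW=> z; rewrite !gaE.
exact/graph_algP/acong_addA.
Qed.

Lemma ga_addC : commutative ga_add.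
Proof.
by elim/quotW=> x; elim/quotW=> y; rewrite !gaE; apply/graph_algP/acong_addC.
Qed.

Lemma ga_add0 : left_id ga_zero ga_add.
Proof. by elim/quotW=> x; rewrite gaE; apply/graph_algP/acong_add0. Qed.

Lemma ga_addN : left_inverse ga_zero ga_opp ga_add.
Proof. by elim/quotW=> x; rewrite !gaE; apply/graph_algP/acong_addN. Qed.

HB.instance Definition _ :=
  GRing.isZmodule.Build B ga_addA ga_addC ga_add0 ga_addN.

Lemma ga_scaleA k l (x : B) : ga_scale k (ga_scale l x) = ga_scale (k * l) x.
Proof. by elim/quotW: x => x; rewrite !gaE; apply/graph_algP/acong_scaleA. Qed.

Lemma ga_scale1 : left_id 1 ga_scale.
Proof. by elim/quotW=> x; rewrite gaE; apply/graph_algP/acong_scale1. Qed.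

Lemma ga_scaleDr : right_distributive ga_scale ga_add.
Proof.
move=> k; elim/quotW=> x; elim/quotW=> y.
by rewrite !gaE; apply/graph_algP/acong_scaleDr.
Qed.

Lemma ga_scaleDl (x : B) : {morph ga_scale^~ x : k l / k + l >-> ga_add k l}.
Proof.
move=> k l; elim/quotW: x => x.
by rewrite !gaE; apply/graph_algP/acong_scaleDl.
Qed.

HB.instance Definition _ := GRing.Zmodule_isLmodule.Build K B
  ga_scaleA ga_scale1 ga_scaleDr ga_scaleDl.

Lemma ga_mulA : associative ga_mul.
Proof.
elim/quotW=> x; elim/quotW=> y; elim/quotW=> z; rewrite !gaE.
exact/graph_algP/acong_mulA.
Qed.

Lemma ga_mulDl : left_distributive ga_mul ga_add.
Proof.
elim/quotW=> x; elim/quotW=> y; elim/quotW=> z.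
by rewrite !gaE; apply/graph_algP/acong_mulDl.
Qed.

Lemma ga_mulDr : right_distributive ga_mul ga_add.
Proof.
elim/quotW=> x; elim/quotW=> y; elim/quotW=> z.
by rewrite !gaE; apply/graph_algP/acong_mulDr.
Qed.

Lemma ga_mulZl k (x y : B) : ga_mul (ga_scale k x) y = ga_scale k (ga_mul x y).
Proof.
elim/quotW: x => x; elim/quotW: y => y.
by rewrite !gaE; apply/graph_algP/acong_mulZl.
Qed.

Lemma ga_mulZr k (x y : B) : ga_mul x (ga_scale k y) = ga_scale k (ga_mul x y).
Proof.
elim/quotW: x => x; elim/quotW: y => y.
by rewrite !gaE; apply/graph_algP/acong_mulZr.
Qed.

Lemma ga_starK : involutive ga_star.
Proof. by elim/quotW=> x; rewrite !gaE; apply/graph_algP/acong_starK. Qed.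

Lemma ga_starM (x y : B) : ga_star (ga_mul x y) = ga_mul (ga_star y) (ga_star x).
Proof.
elim/quotW: x => x; elim/quotW: y => y.
by rewrite !gaE; apply/graph_algP/acong_starM.
Qed.

Lemma ga_starD (x y : B) : ga_star (ga_add x y) = ga_add (ga_star x) (ga_star y).
Proof.
elim/quotW: x => x; elim/quotW: y => y.
by rewrite !gaE; apply/graph_algP/acong_starD.
Qed.

Lemma ga_starZ k (x : B) : ga_star (ga_scale k x) = ga_scale (bar k) (ga_star x).
Proof.
elim/quotW: x => x.
by rewrite !gaE; apply/graph_algP/acong_starZ.
Qed.

HB.instance Definition _ := Lmodule_isStarAlgebra.Build K bar B
  ga_mulA ga_mulDl ga_mulDr ga_mulZl ga_mulZr ga_starK ga_starM ga_starD ga_starZ.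

Definition graph_iota (s : graph_semigroup A) : B := \pi_B (of_sterm (repr s)).

Lemma acong_of_sterm u w : scong A u w -> acong (of_sterm u) (of_sterm w).
Proof.
elim=> {u w} /=.
- by move=> *; exact: acong_refl.
- by move=> x y _; exact: acong_sym.
- by move=> y x z _ xy _; exact: acong_trans.
- by move=> x x' y y' _ xx' _; exact: acong_mul.
- by move=> x x' _; exact: acong_star.
- by move=> *; exact: acong_mulA.
- move=> x; apply/graph_algP; rewrite -ga_mulE.
  have -> : \pi_B AZero = 0 :> B by [].
  by rewrite -(scale0r 0) [LHS]amulZl !scale0r.
- move=> x; apply/graph_algP; rewrite -ga_mulE.
  have -> : \pi_B AZero = 0 :> B by [].
  by rewrite -(scale0r 0) [LHS]amulZr !scale0r.
- by move=> *; exact: acong_starK.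
- by move=> *; exact: acong_starM.
- by move=> *; exact: acong_rel.
Qed.

Lemma graph_iotaE u : graph_iota (\pi_(graph_semigroup A) u) = \pi_B (of_sterm u).
Proof. by apply/graph_algP/acong_of_sterm/scong_repr. Qed.

End Algebra.

(* All the notions below are meant for *-semigroups that are inverse semigroups,
   for which they are the usual ones; they are set up so that the definitions
   themselves do not depend on a proof of this. *)

Section TightGroupoid.
Variable S : starSemigroup0Type.

Definition idem : set S := [set e | e *g e = e].

Definition is_filter (eta : set S) :=
  [/\ eta `<=` idem, eta !=set0, ~ eta szero,
      forall e f, eta e -> eta f -> eta (e *g f) &
      forall e f, eta e -> idem f -> e *g f = e -> eta f].

Definition below (e : S) : set S := [set f | idem f /\ f *g e = f].

Definition finite_cover (e : S) (Z : set S) :=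
  [/\ finite_set Z, Z `<=` below e &
      forall f, below e f -> f <> szero -> exists2 z, Z z & f *g z <> szero].

Definition tight_filters : set (set S) :=
  [set eta | is_filter eta /\
    forall e Z, eta e -> finite_cover e Z -> Z `&` eta !=set0].

Definition filter_char (eta : tight_filters) :
  prod_topology (fun _ : idem => bool) := fun e => `[< set_val eta (set_val e) >].

(* The topology induced by {0,1}^idem. *)
Definition tight_spectrum : Type := initial_topology filter_char.
HB.instance Definition _ := Topological.on tight_spectrum.

Implicit Types (s t : S) (x y : tight_spectrum).

Definition dom_at (e : S) : set tight_spectrum := [set x | set_val x e].

(* [acts s x y]: y = alpha_s(x). *)
Definition acts s x y :=
  set_val y = [set f | idem f /\ set_val x (star s *g f *g s)].

Definition germ_class s x : set (S * tight_spectrum) :=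
  [set h | [/\ dom_at (star h.1 *g h.1) h.2, x = h.2 &
     exists2 f, idem f /\ set_val x f & s *g f = h.1 *g f]].

(* A germ is an equivalence class of pairs (s, x) with x in D_(s^* s). *)
Definition germ : Type :=
  [set c | exists s x, dom_at (star s *g s) x /\ c = germ_class s x].

HB.instance Definition _ := Choice.on germ.

(* [is_germ g s x]: x is in D_(s^* s) and g = [s, x]. *)
Definition is_germ (g : germ) s x :=
  dom_at (star s *g s) x /\ set_val g = germ_class s x.

Definition Theta s (U : set tight_spectrum) : set germ :=
  [set g | exists2 x, U x & is_germ g s x].

Definition Thetas : set (set germ) :=
  [set W | exists s U,
    [/\ open U, U `<=` dom_at (star s *g s) & W = Theta s U]].

HB.instance Definition _ := isSubBaseTopological.Build germ Thetas id.

(* [germ_mul (g1, g2) g]: g1 and g2 are composable and g = g1 g2. *)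
Definition germ_mul (g12 : germ * germ) (g : germ) :=
  exists s t x y, [/\ acts t x y, is_germ g12.1 s y, is_germ g12.2 t x &
                      is_germ g (s *g t) x].

(* The inverse of [s, x] is [s^*, alpha_s(x)]. *)
Definition germ_inv (g : germ) : germ :=
  xget g [set g' | exists s x y,
    [/\ acts s x y, is_germ g s x & is_germ g' (star s) y]].

Section Steinberg.
Variables (K : fieldType) (bar : {rmorphism K -> K}).

Definition locally_constant (f : germ -> K) :=
  forall g : germ, \forall h \near g, f h = f g.

Definition steinberg : set (germ -> K) :=
  [set f | locally_constant f /\ compact [set g | f g != 0]].

(* On [steinberg] the sum has finitely many nonzero terms. *)
Definition convolution (f1 f2 : germ -> K) (g : germ) : K :=
  \sum_(g12 \in [set g12 | germ_mul g12 g]) f1 g12.1 * f2 g12.2.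

Definition steinberg_star (f : germ -> K) (g : germ) : K := bar (f (germ_inv g)).

(* Since [phi] maps onto [steinberg], the multiplicativity clauses entail that
   [steinberg] is closed under [convolution] and [steinberg_star]. *)
Definition star_isomorphism (B : starAlgType bar) (phi : B -> germ -> K) :=
  [/\ forall k (a b : B) g, phi (k *: a + b) g = k * phi a g + phi b g,
      forall a b : B, phi (amul a b) = convolution (phi a) (phi b),
      forall a : B, phi (astar a) = steinberg_star (phi a) &
      set_bij [set: B] steinberg phi].

End Steinberg.

End TightGroupoid.

(* Main.v *)
Require Import Defs.
From HB Require Import structures.
From mathcomp Require Import all_boot all_order all_algebra.
From mathcomp Require Import all_classical all_reals.
From mathcomp Require Import finmap topology numfun.

Set Implicit Arguments.
Unset Strict Implicit.
Unset Printing Implicit Defensive.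

Import GRing.Theory.

(** An action of S(E,C) by partial bijections on pairs (finite path, group
    element) detects the fixed points of normal forms [U * star V]: if such an
    element fixes a point, then [U = V]. Hence S(E,C) is an inverse semigroup, it
    is E-unitary away from 0 (so that its tight groupoid is Hausdorff), and its
    nonzero idempotents are the [U * star U]. By induction on [U], the relations
    R10 write each vertex as a sum of idempotents which lie below [U * star U] or
    are orthogonal to it; these sums are also covers, so tight filters are
    ultrafilters and the sets [bisection s] form a basis of compact open
    bisections, which gives surjectivity. For injectivity, multiply a linear
    combination in the kernel by an idempotent deciding the domains of all its
    terms: what remains is supported on pairwise disjoint bisections, so that
    all coefficients cancel, and R10 recovers the whole element from these pieces. *)

(** * Coordinates at the vertices of an adaptable separated graph *)

(** The alphas at a free vertex are edges and yet commute, so plain paths do not describe products.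
    The remedy is to number the alphas and the [t]s at a vertex as one sequence of commuting
    coordinates. An edge that is not an alpha then merely renumbers coordinates, so that R6, R7 and
    R8 become a single rule; the one exception is the coordinate of its own block, which a beta
    stops and turns into the exponent of the loop preceding that beta. End points carry integers in
    all coordinates, those of the alphas included, so that alphas are invertible there.

    This action is not a model of R10: a path of length 0 at a regular vertex lies in the range of
    no edge. It is applied to S(E,C) only, where R10 is absent, and such a point is prolonged by one
    edge when covers are tested.

    In the algebra the obstacle is the missing unit: the step from multiples of a kernel element by
    idempotents back to the element itself uses that it lies in a sum of left ideals generated by
    commuting idempotents. *)

Section GraphFacts.
Local Open Scope classical_set_scope.
Variables (E : sep_graph) (A : adaptable E).
Implicit Types (v w : vertex E) (e f : edge E) (p q : component E).

Lemma gpath_cat F v es w es' u : @gpath E F v es w -> gpath F w es' u ->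
  gpath F v (es ++ es') u.
Proof.
elim: es v => [|e es IH] v /=; first by move->.
by case=> Fe se es_w w_u; split=> //; exact: IH es_w w_u.
Qed.

Lemma vle_refl v : vle v v.
Proof. by exists [::]. Qed.

Lemma vle_trans v w u : vle v w -> vle w u -> vle v u.
Proof. by move=> [es vw] [es' wu]; exists (es' ++ es); exact: gpath_cat wu vw. Qed.

Fact component_of_subproof v : vclass v \in range (@vclass E).
Proof. by apply/mem_set; exists v. Qed.

Definition component_of v : component E := SigSub (component_of_subproof v).

Lemma verts_component_of v : verts (component_of v) v.
Proof. by split; exact: vle_refl. Qed.

Lemma vertsP p v : verts p v -> p = component_of v.
Proof.
move=> pv; apply: val_inj => /=.
have [u _ up] := set_valP p.
move: pv; rewrite /verts /set_val /= /eqincl -up => -[uv vu].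
apply/seteqP; split=> x [xu ux]; split.
- exact: vle_trans vu xu.
- exact: vle_trans ux uv.
- exact: vle_trans uv xu.
- exact: vle_trans ux vu.
Qed.

Lemma component_free p v : Ifree A p -> verts p v -> v = vfree A p.
Proof. by move=> fp; rewrite (vertsP_free fp) => ->. Qed.

Lemma verts_vfree p : Ifree A p -> verts p (vfree A p).
Proof. by move=> fp; rewrite (vertsP_free fp). Qed.

Lemma vfree_inj p q : Ifree A p -> Ifree A q -> vfree A p = vfree A q -> p = q.
Proof.
move=> fp fq pq; have := verts_vfree fp; rewrite pq => /vertsP ->.
by rewrite -(vertsP (verts_vfree fq)).
Qed.

Lemma clt_verts p q v : clt p q -> verts p v -> ~ verts q v.
Proof. by move=> [_ pq] /vertsP pv /vertsP qv; apply: pq; rewrite pv. Qed.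

(* The number of blocks at a free vertex, and 0 at a regular one: the first
   [rank v] coordinates at [v] belong to the [alpha]'s, the others to the [t]'s. *)
Definition rank v :=
  if `[< Ifree A (component_of v) >] then nblocks A (component_of v) else 0.

Lemma rank_free p : Ifree A p -> rank (vfree A p) = nblocks A p.
Proof.
move=> fp; rewrite /rank -(vertsP (verts_vfree fp)).
by case: asboolP.
Qed.

Lemma rank_reg p v : ~ Ifree A p -> verts p v -> rank v = 0.
Proof. by move=> rp /vertsP pv; rewrite /rank -pv; case: asboolP. Qed.

(** Block indices are recorded as plain numbers: the source of an edge already determines the
    component, and this avoids transports between the types ['I_(nblocks A p)]. *)
Definition is_alpha e (n : nat) :=
  exists p (i : 'I_(nblocks A p)), [/\ Ifree A p, e = alpha i & n = i].

Definition is_beta e (n : nat) := exists p (i : 'I_(nblocks A p)) (t : 'I_(nbeta i)),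
  [/\ Ifree A p, e = beta t & n = i].

Lemma free_nminimal p (i : 'I_(nblocks A p)) : Ifree A p -> ~ cminimal p.
Proof. by move=> fp pmin; move: i; rewrite (free_minimal fp pmin) => -[]. Qed.

Let X p (i : 'I_(nblocks A p)) := [set alpha i] `|` range (@beta E A p i).

Lemma free_block p (i : 'I_(nblocks A p)) : Ifree A p ->
  blocks (vfree A p) (X i).
Proof.
by move=> fp; have [-> _] := free_blocks fp (free_nminimal i fp); exists i.
Qed.

(** At a minimal component the vertex emits no edge while blocks are nonempty, so that case is
    void. *)
Lemma free_block_inv p Y : Ifree A p -> blocks (vfree A p) Y ->
  exists i : 'I_(nblocks A p), Y = X i.
Proof.
move=> fp; have [pmin|pmin] := pselect (cminimal p).
  have := blocksP (vfree A p); have /(free_sink fp) pmin' := pmin.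
  case; rewrite pmin' => cov _ nonempty bY.
  by have [e Ye] := nonempty _ bY; have : set0 e by rewrite -cov; exists Y.
by have [-> _] := free_blocks fp pmin; case=> i _ <-; exists i.
Qed.

Lemma block_src v Y e : blocks v Y -> Y e -> src e = v.
Proof.
move=> bY Ye; have [cov _ _] := blocksP v.
by have : [set e | src e = v] e by rewrite -cov; exists Y.
Qed.

Lemma block_nonempty v Y : blocks v Y -> Y !=set0.
Proof. by have [_ _ /(_ Y)] := blocksP v. Qed.

Lemma src_beta p (i : 'I_(nblocks A p)) (t : 'I_(nbeta i)) : Ifree A p ->
  src (beta t) = vfree A p.
Proof. by move=> fp; apply: block_src (free_block i fp) _; right; exists t. Qed.

Lemma free_block_eq p (i j : 'I_(nblocks A p)) e : Ifree A p ->
  X i e -> X j e -> i = j.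
Proof.
move=> fp ie je; have [_ Xinj] := free_blocks fp (free_nminimal i fp).
have [_ triv _] := blocksP (vfree A p); apply: Xinj.
by apply: triv; [exact: free_block|exact: free_block|exists e].
Qed.

Lemma is_alpha_inj e m n : is_alpha e m -> is_alpha e n -> m = n.
Proof.
move=> [p [i [fp ei ->]]] [q [j [fq ej ->]]].
have pq : p = q.
  apply: vfree_inj => //.
  by have [<- _] := free_alpha fp i; have [<- _] := free_alpha fq j; rewrite -ei -ej.
case: _ / pq j ej {fq} => j ej; congr val.
by apply: (free_block_eq fp (e := e)); [left|left].
Qed.

Lemma is_beta_inj e m n : is_beta e m -> is_beta e n -> m = n.
Proof.
move=> [p [i [s [fp ei ->]]]] [q [j [t [fq ej ->]]]].
have pq : p = q.
  by apply: vfree_inj => //; rewrite -(src_beta s) // -(src_beta t) // -ei -ej.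
case: _ / pq j t ej {fq} => j t ej; congr val.
by apply: (free_block_eq fp (e := e)); right; [exists s|exists t].
Qed.

(** An alpha is a loop, whereas a beta ends in a strictly smaller component. *)
Lemma alpha_not_beta e m n : is_alpha e m -> ~ is_beta e n.
Proof.
move=> [p [i [fp ei _]]] [q [j [t [fq ej _]]]].
have [sa ra] := free_alpha fp i.
have pq : p = q by apply: vfree_inj => //; rewrite -sa -(src_beta t) // -ei -ej.
case: _ / pq j t ej {fq} => j t ej.
have [r rp rt] := free_beta fp t.
by apply: (clt_verts rp rt); rewrite -ej ei ra; exact: verts_vfree.
Qed.

Definition pick_index (P : nat -> Prop) : option nat :=
  if pselect (exists n, P n) is left h then Some (projT1 (cid h)) else None.

Lemma pick_indexP P n : (forall m n, P m -> P n -> m = n) ->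
  pick_index P = Some n <-> P n.
Proof.
move=> Puniq; rewrite /pick_index; case: pselect => [h|h].
  split=> [[<-]|Pn]; first exact: projT2 (cid h).
  by congr Some; apply: Puniq Pn; exact: projT2 (cid h).
by split=> // Pn; case: h; exists n.
Qed.

Definition aidx e := pick_index (is_alpha e).
Definition bidx e := pick_index (is_beta e).

Lemma aidxP e n : aidx e = Some n <-> is_alpha e n.
Proof. by apply: pick_indexP => ? ?; exact: is_alpha_inj. Qed.

Lemma bidxP e n : bidx e = Some n <-> is_beta e n.
Proof. by apply: pick_indexP => ? ?; exact: is_beta_inj. Qed.

Lemma aidx_alpha p (i : 'I_(nblocks A p)) : Ifree A p ->
  aidx (alpha i) = Some (val i).
Proof. by move=> fp; apply/aidxP; exists p, i. Qed.

Lemma bidx_beta p (i : 'I_(nblocks A p)) (t : 'I_(nbeta i)) : Ifree A p ->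
  bidx (beta t) = Some (val i).
Proof. by move=> fp; apply/bidxP; exists p, i, t. Qed.

Lemma bidx_aidx e n : bidx e = Some n -> aidx e = None.
Proof.
move/bidxP=> be; case ae: (aidx e) => [m|//].
by have /aidxP/alpha_not_beta/(_ be) := ae.
Qed.

Lemma aidx_beta p (i : 'I_(nblocks A p)) (t : 'I_(nbeta i)) : Ifree A p ->
  aidx (beta t) = None.
Proof. by move=> fp; exact: bidx_aidx (bidx_beta t fp). Qed.

Lemma aidx_rank e n : aidx e = Some n -> n < rank (src e) /\ rng e = src e.
Proof.
move/aidxP=> [p [i [fp -> ->]]]; have [-> ->] := free_alpha fp i.
by rewrite rank_free.
Qed.

Lemma bidx_rank e n : bidx e = Some n -> n < rank (src e).
Proof. by move/bidxP=> [p [i [t [fp -> ->]]]]; rewrite src_beta // rank_free. Qed.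

(** Every edge lies in a block of its source, and at a free vertex a block consists of one alpha and
    its betas. *)
Lemma edge_cases e :
  [\/ exists n, aidx e = Some n, exists n, bidx e = Some n |
      exists p, [/\ ~ Ifree A p, verts p (src e), aidx e = None & bidx e = None]].
Proof.
have pe := verts_component_of (src e); move: (component_of _) pe => p pe.
have [fp|rp] := pselect (Ifree A p); last first.
  constructor 3; exists p; split=> //.
    case ae: (aidx e) => [n|//]; have /aidxP [q [i [fq ei _]]] := ae.
    case: rp; rewrite (vertsP pe) ei; have [-> _] := free_alpha fq i.
    by rewrite -(vertsP (verts_vfree fq)).
  case be: (bidx e) => [n|//]; have /bidxP [q [i [t [fq ei _]]]] := be.
  by case: rp; rewrite (vertsP pe) ei src_beta // -(vertsP (verts_vfree fq)).
have se := component_free fp pe.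
have [cov _ _] := blocksP (src e).
have : [set e' | src e' = src e] e by [].
rewrite -cov => -[Y]; rewrite {1}se => /(free_block_inv fp) [i ->] [->|[t _ <-]].
  by constructor 1; exists i; exact: aidx_alpha.
by constructor 2; exists i; exact: bidx_beta.
Qed.

Lemma reg_edge e : aidx e = None -> bidx e = None ->
  exists p, ~ Ifree A p /\ verts p (src e).
Proof. by case: (edge_cases e) => [[n ->]|[n ->]|[p [? ? _ _]]] // _ _; exists p. Qed.

Lemma exists_alpha v n : n < rank v -> exists e, src e = v /\ aidx e = Some n.
Proof.
rewrite /rank; case: asboolP => // fp lt_n.
exists (alpha (Ordinal lt_n)); rewrite aidx_alpha //.
have [-> _] := free_alpha fp (Ordinal lt_n); split=> //.
by rewrite -(component_free fp (verts_component_of v)).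
Qed.

Lemma aidx_inj e f n : src e = src f -> aidx e = Some n -> aidx f = Some n -> e = f.
Proof.
move=> ef /aidxP [p [i [fp ei ni]]] /aidxP [q [j [fq fj nj]]].
have pq : p = q.
  apply: vfree_inj => //.
  by have [<- _] := free_alpha fp i; have [<- _] := free_alpha fq j; rewrite -ei -fj.
case: _ / pq j fj nj {fq} => j fj nj.
by rewrite ei fj; congr alpha; apply: val_inj; rewrite /= -ni -nj.
Qed.

(** A free vertex of rank 0 has no block at all, so the block [Y] forces [v] to be regular, where
    there is only one. *)
Lemma blocks_rank0 v Y : rank v = 0 -> blocks v Y ->
  Y = [set e | src e = v] /\ (exists p, ~ Ifree A p /\ verts p v).
Proof.
have pv := verts_component_of v; move: (component_of _) pv => p pv rv bY.
have [fp|rp] := pselect (Ifree A p); last first.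
  split; last by exists p.
  have [cov _ _] := blocksP v; have [Z bZ] := reg_one_block rp pv.
  rewrite -cov; move: bY; rewrite bZ => ->.
  by apply/seteqP; split=> [e Ze|e [_ ->]] //; exists Z.
move: rv bY; rewrite (component_free fp pv) rank_free // => np.
by move/(free_block_inv fp) => [i _]; move: i; rewrite np => -[].
Qed.

Lemma blocks_rank v Y : 0 < rank v -> blocks v Y -> exists2 n, n < rank v &
  Y = [set e | src e = v /\ (aidx e = Some n \/ bidx e = Some n)].
Proof.
have pv := verts_component_of v; move: (component_of _) pv => p pv rv bY.
have [fp|rp] := pselect (Ifree A p); last by move: rv; rewrite (rank_reg rp pv).
have vp := component_free fp pv; rewrite vp in bY *.
have [i ->] := free_block_inv fp bY; exists (val i); first by rewrite rank_free ?ltn_ord.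
apply/seteqP; split=> [e [->|[t _ <-]]|e [se []]] /=.
- by rewrite aidx_alpha //; have [-> _] := free_alpha fp i; split=> //; left.
- by rewrite bidx_beta // src_beta //; split=> //; right.
- have [sa _] := free_alpha fp i.
  move=> ae; left; apply: aidx_inj ae _; last exact: aidx_alpha.
  by rewrite se sa.
- move/bidxP=> [q [j [t [fq ej ij]]]]; right.
  have pq : p = q by apply: vfree_inj => //; rewrite -se ej src_beta.
  case: _ / pq j t ej ij {fq} => j t ej ij.
  have {ij} ij : i = j by exact: val_inj.
  by case: _ / ij t ej => t ->; exists t.
Qed.

End GraphFacts.

(** * A representation of S(E,C) by partial bijections *)

(* [Step l e x] stands for the path alpha(p,j)^l e followed by [x] if [e] is
   some beta(p,j,t); [l] is 0 if the source of [e] is regular. *)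
Inductive gpoint (E : sep_graph) :=
| Base of vertex E & (nat -> int)
| Step of nat & edge E & gpoint E.

Section Representation.
Local Open Scope classical_set_scope.
Local Open Scope quotient_scope.
Variables (E : sep_graph) (A : adaptable E).
Implicit Types (v w : vertex E) (e f : edge E) (p q : component E).
Implicit Types (x y z : gpoint E) (b c : bool) (m n : nat).

Fixpoint start x := match x with Base w _ => w | Step _ e _ => src e end.

(* The coordinate [m] at the source of [e] becomes the coordinate [pass e r m]
   at its range [r], as in R6, R7 and R8. *)
Definition pass e v m := rank A v + (if bidx A e is Some j then unbump j m else m).

(** Past the first segment every coordinate is one of the [t]s (see [leq_pass]), so a coordinate is
    either the exponent of that segment or an integer at the end point. Lowering an exponent 0
    returns a default value; [can] marks the points where lowering can be undone. *)
Fixpoint act b m x := match x with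
  | Base w g => Base w (fun n => (g n + (if n == m then (-1) ^+ ~~ b else 0))%R)
  | Step l e y => if bidx A e == Some m then Step (if b then l.+1 else l.-1) e y
                  else Step l e (act b (pass e (start y) m) y)
  end.

Fixpoint can m x := match x with
  | Base _ _ => true
  | Step l e y => if bidx A e == Some m then 0 < l else can (pass e (start y) m) y
  end.

(** Reads off how often a coordinate was raised; this recovers the multiset of a monomial from its
    action. *)
Fixpoint gcoord m x : int := match x with
  | Base _ g => g m
  | Step l e y => if bidx A e == Some m then Posz l else gcoord (pass e (start y) m) y
  end.

Lemma start_act b m x : start (act b m x) = start x.
Proof. by case: x => //= l e y; case: ifP. Qed.

(** [unbump j] is injective away from [j], and the coordinate [j] itself is stopped by [e]. *)
Lemma pass_inj e v m n : bidx A e != Some m -> bidx A e != Some n ->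
  pass e v m = pass e v n -> m = n.
Proof.
rewrite /pass; case: (bidx A e) => [j|] jm jn /addnI //.
have inC k : Some j != Some k -> k \in predC1 j.
  by move=> jk; rewrite inE; apply: contra jk => /eqP ->.
by move/(congr1 (bump j)); rewrite !unbumpK ?inC.
Qed.

Lemma pass_neq e v m n : bidx A e != Some m -> bidx A e != Some n -> m != n ->
  pass e v m != pass e v n.
Proof. by move=> em en; apply: contra => /eqP /(pass_inj em en) ->. Qed.

Lemma leq_pass e v m : rank A v <= pass e v m.
Proof. exact: leq_addr. Qed.

Lemma bidx_ge e m : rank A (src e) <= m -> bidx A e == Some m = false.
Proof. by move=> le_m; apply/eqP => /bidx_rank; rewrite ltnNge le_m. Qed.

Lemma act_comm b c m n x : m != n -> act b m (act c n x) = act c n (act b m x).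
Proof.
elim: x m n => [w g|l e y IH] m n mn /=.
  by congr Base; apply/funext => k; rewrite addrAC.
have Some_neq (k k' : nat) : k != k' -> (Some k == Some k') = false.
  by move=> kk'; apply/eqP => -[/eqP]; apply/negP.
have nm : n != m by rewrite eq_sym.
have [em|em] := eqVneq (bidx A e) (Some m); have [en|en] := eqVneq (bidx A e) (Some n);
  rewrite /= ?em ?en ?eqxx ?(negbTE em) ?(negbTE en) ?Some_neq ?start_act //.
- by move: mn; move: em; rewrite en => -[->]; rewrite eqxx.
- by rewrite IH // pass_neq.
Qed.

Lemma act_commb b m n x : act b m (act b n x) = act b n (act b m x).
Proof. by have [->//|/act_comm ->] := eqVneq m n. Qed.

Lemma can_act b m n x : m != n -> can m (act b n x) = can m x.
Proof.
elim: x m n => [//|l e y IH] m n mn /=.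
case: eqP => [en|/eqP en] /=; case: eqP => [em|/eqP em] //.
  by move: mn; move: em; rewrite en => -[->]; rewrite eqxx.
by rewrite start_act IH // pass_neq.
Qed.

Lemma can_act_true m x : can m (act true m x).
Proof.
elim: x m => [//|l e y IH] m /=.
by case: ifP => /= ->; rewrite ?start_act.
Qed.

Lemma act_falseK m x : act false m (act true m x) = x.
Proof.
elim: x m => [w g|l e y IH] m /=.
  by congr Base; apply/funext => k; case: eqP; rewrite ?addr0 // addrK.
by case: ifP => /= ->; rewrite // start_act IH.
Qed.

Lemma act_trueK m x : can m x -> act true m (act false m x) = x.
Proof.
elim: x m => [w g|l e y IH] m /=.
  by move=> _; congr Base; apply/funext => k; case: eqP; rewrite ?addr0 // subrK.
case: ifP => /= -> cx; first by rewrite prednK.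
by rewrite start_act IH.
Qed.

(** The coordinates of the [t]s are never stopped and end at an integer, which is why the [t]s act
    invertibly. *)
Lemma can_ge m x : rank A (start x) <= m -> can m x.
Proof.
elim: x m => [//|l e y IH] m /= /bidx_ge ->.
exact/IH/leq_pass.
Qed.

Lemma gcoord_act m n x : gcoord m (act true n x) = (gcoord m x + Posz (m == n))%R.
Proof.
elim: x m n => [w g|l e y IH] m n /=; first by case: eqP.
case: eqP => [en|/eqP en] /=; case: eqP => [em|/eqP em] //.
- by move: em; rewrite en => -[->]; rewrite eqxx -addn1 PoszD.
- by rewrite en eq_sym in em; rewrite (negbTE (_ : m != n)) ?addr0 //; apply: contra em => /eqP ->.
- by rewrite em eq_sym in en; rewrite (negbTE (_ : m != n)) ?addr0 //; apply: contra en => /eqP ->.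
- rewrite start_act IH; congr (_ + Posz _)%R; congr nat_of_bool.
  by apply/eqP/eqP => [/(pass_inj em en)|->].
Qed.

(** An alpha leaves no step in the path but acts through its coordinate, so that commuting alphas
    have a single encoding. *)
Definition enter e x := if aidx A e is Some n then act true n x else Step 0 e x.

Definition grel (g : generator E) x y := match g with
  | GV v => start x = v /\ y = x
  | GE e => start x = rng e /\ y = enter e x
  | GT b i v => start x = v /\ y = act b (rank A v + i) x
  end.

(** With relations instead of partial functions the star is the converse relation, and the axioms of
    a star semigroup with zero become immediate. *)
Fixpoint rho (u : sterm E) : gpoint E -> gpoint E -> Prop := match u with
  | SZero => fun _ _ => False
  | SGen g => grel g
  | SMul u1 u2 => fun x y => exists z, rho u2 x z /\ rho u1 z y
  | SStar u1 => fun x y => rho u1 y x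
  end.

Lemma start_enter e x : start x = rng e -> start (enter e x) = src e.
Proof.
rewrite /enter; case ae: aidx => [n|] // xe.
by rewrite start_act xe; case: (aidx_rank ae).
Qed.

Lemma enter_inj e x y : enter e x = enter e y -> x = y.
Proof.
rewrite /enter; case: aidx => [n|] => [|[]//].
by move/(congr1 (act false n)); rewrite !act_falseK.
Qed.

Lemma enter_step e : aidx A e = None -> enter e = Step 0 e.
Proof. by rewrite /enter => ->. Qed.

Lemma enter_can e n x : aidx A e = Some n -> can n x -> enter e (act false n x) = x.
Proof. by rewrite /enter => -> /act_trueK. Qed.

Lemma enter_alpha e n : aidx A e = Some n -> enter e = act true n.
Proof. by rewrite /enter => ->. Qed.

(** At a free vertex, coordinate [n] can be lowered at every point entered by the alpha of block
    [n], whereas a point entered by a beta of that block starts with exponent 0. *)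
Lemma enter_disj v Y e f x y : blocks v Y -> Y e -> Y f ->
  enter e x = enter f y -> e = f.
Proof.
move=> bY Ye Yf; have se := block_src bY Ye; have sf := block_src bY Yf.
have alpha_beta e' f' n x' y' : aidx A e' = Some n -> bidx A f' = Some n ->
    enter e' x' <> enter f' y'.
  move=> ae bf; rewrite (enter_alpha ae) (enter_step (bidx_aidx bf)).
  by move=> xy; have := can_act_true n x'; rewrite xy /= bf eqxx.
have step_inj : aidx A e = None -> aidx A f = None -> enter e x = enter f y -> e = f.
  by move=> ae af; rewrite !enter_step // => -[].
have [rv|rv] := posnP (rank A v).
  have none e' : src e' = v -> aidx A e' = None.
    by move=> se'; case ae: aidx => [n|//]; have [] := aidx_rank ae; rewrite se' rv.
  by apply: step_inj; exact: none.
have [n _ YE] := blocks_rank rv bY; move: Ye Yf; rewrite YE => -[_ de] [_ df].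
case: de df => [ae|be] [af|bf].
- by move=> _; apply: aidx_inj ae af; rewrite se sf.
- by move/(alpha_beta _ _ _ _ _ ae bf).
- by move/esym/(alpha_beta _ _ _ _ _ af be).
- by apply: step_inj; [exact: bidx_aidx be|exact: bidx_aidx bf].
Qed.

Lemma beta_neq p (i j : 'I_(nblocks A p)) (s : 'I_(nbeta i)) (t : 'I_(nbeta j)) :
  Ifree A p -> Tagged (fun i => 'I_(nbeta i)) s != Tagged _ t -> beta s <> beta t.
Proof.
move=> fp st st'; have := bidx_beta s fp; rewrite st' bidx_beta // => -[].
move/val_inj => ij; case: _ / ij s st st' => s st /(free_beta_inj fp) st'.
by move: st; rewrite st' eqxx.
Qed.

Lemma ge_neq r m i : m < r -> r + i != m.
Proof. by move=> lt_m; rewrite neq_ltn (leq_trans lt_m) ?leq_addr ?orbT. Qed.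

Lemma pass_beta p (j : 'I_(nblocks A p)) (t : 'I_(nbeta j)) v m : Ifree A p ->
  pass (beta t) v m = rank A v + unbump j m.
Proof. by move=> fp; rewrite /pass bidx_beta. Qed.

Lemma act_beta p (j : 'I_(nblocks A p)) (t : 'I_(nbeta j)) b m l x : Ifree A p ->
  m != j -> act b m (Step l (beta t) x) =
            Step l (beta t) (act b (rank A (start x) + unbump j m) x).
Proof.
move=> fp mj; rewrite /= bidx_beta // (negbTE (_ : Some _ != Some m)).
  by rewrite pass_beta.
by apply: contra mj => /eqP [->].
Qed.

(** In coordinates the index shift of R7 is [unbump j] again, which merges R7 with R8. *)
Lemma unbump_ge j r i : j < r -> unbump j (r + i) = i + r - 1.
Proof. by move=> jr; rewrite /unbump (leq_trans jr) ?leq_addr //= addnC. Qed.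

Lemma rho_srel (u w : sterm E) : srel A u w -> rho u = rho w.
Proof.
move=> uw; apply/funext => x; apply/funext => y; apply/propext; case: uw => {u w}.
- move=> v /=; split=> [[z [[xv ->] [_ ->]]] //|[xv ->]]; by exists x.
- by move=> v w vw /=; split=> // -[z [[xv ->] [xw _]]]; case: vw; rewrite -xv.
- by move=> v /=; split=> -[xv ->].
- move=> e /=; split=> [[xe ->]|[z [[xe ->] [_ ->]]] //].
  by exists (enter e x); rewrite start_enter.
- by move=> e /=; split=> [[xe ->]|[z [[xe ->] [_ ->]]] //]; exists x.
- move=> v X e bX Xe /=; split=> [[z [[xe ->] [ye]]]|[xe ->]].
    by move/enter_inj.
  by exists (enter e x).
- move=> v X e f bX Xe Xf ef /=; split=> // -[z [[xf ->] [ye]]].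
  by move/esym/(enter_disj bX Xe Xf)/ef.
- move=> p i j fp ij /=.
  have [si ri] := free_alpha fp i; have [sj rj] := free_alpha fp j.
  rewrite ri rj !(enter_alpha (aidx_alpha _ fp)).
  split=> -[z [[xv ->] [_ ->]]].
    by exists (act true i x); rewrite start_act; split=> //; split=> //; exact: act_commb.
  by exists (act true j x); rewrite start_act; split=> //; split=> //; exact: act_commb.
- move=> p i j fp ij /=.
  have [si ri] := free_alpha fp i; have [sj rj] := free_alpha fp j.
  rewrite ri rj !(enter_alpha (aidx_alpha _ fp)).
  split=> [[z [[zv xz] [_ yz]]]|[z [[xv zx] [yv zy]]]].
    exists (act true i x); rewrite xz yz !start_act; split=> //; split=> //.
    exact: act_commb.
  (* Here [j] has to be lowered before [i] is raised; this is possible because raising [i] does not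
     affect whether [j] can be lowered. *)
  have cjx : can j x.
    by rewrite -(can_act true x (_ : (j : nat) != i)) ?(eq_sym (j : nat)) // -zx zy can_act_true.
  exists (act false j x); rewrite start_act act_trueK //; split=> //; split=> //.
  by rewrite act_comm // -zx zy act_falseK.
- move=> p i j s t fp st /=; split=> // -[z [[xt ->] [ys]]].
  rewrite !enter_step ?(aidx_beta _ fp) // => -[+ _].
  by move/esym/(beta_neq fp st).
- move=> v b c i j /=; split=> -[z [[xv ->] [_ ->]]].
    exists (act b (rank A v + i) x); rewrite start_act; split=> //; split=> //.
    (* For equal indices and opposite signs both composites are the identity, as [t] coordinates can
       always be lowered. *)
    have [->|ij] := eqVneq i j; last by rewrite act_comm // eqn_add2l.
    case: b c => -[] //; rewrite act_falseK act_trueK //.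
      by apply: can_ge; rewrite xv leq_addr.
    by apply: can_ge; rewrite xv leq_addr.
  exists (act c (rank A v + j) x); rewrite start_act; split=> //; split=> //.
  have [->|ij] := eqVneq i j; last by apply/esym; rewrite act_comm // eqn_add2l.
  case: b c => -[] //; rewrite act_falseK act_trueK //.
    by apply: can_ge; rewrite xv leq_addr.
  by apply: can_ge; rewrite xv leq_addr.
- move=> v i /=; split=> [[z [[xv ->] [_ ->]]] //|[xv ->]].
  by exists (act true (rank A v + i) x); rewrite start_act.
- by move=> v i /=; split=> [[z [[xv ->] [_ ->]]] //|[xv ->]]; exists x.
- move=> v i /=; split=> [[z [[xv ->] [_ ->]]] //|[xv ->]].
    by rewrite act_trueK //; apply: can_ge; rewrite xv leq_addr.
  exists (act false (rank A v + i) x); rewrite start_act act_trueK //.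
  by apply: can_ge; rewrite xv leq_addr.
- move=> v i /=; split=> [[z [[xv ->] [_ ->]]] //|[xv ->]].
    by rewrite act_falseK.
  by exists (act true (rank A v + i) x); rewrite start_act act_falseK.
- move=> v i /=; split=> [[yv ->]|[xv ->]]; rewrite start_act.
    by rewrite act_falseK.
  by rewrite act_trueK //; apply: can_ge; rewrite xv leq_addr.
- move=> p e i rp pe /=; have re := rank_reg rp pe.
  have [ae be] : aidx A e = None /\ bidx A e = None.
    split.
      by case ae: aidx => [n|//]; have [] := aidx_rank ae; rewrite re.
    by case be: bidx => [n|//]; have := bidx_rank be; rewrite re.
  rewrite !enter_step // re.
  split=> -[z [[xv ->] [_ ->]]].
    exists (act true (rank A (rng e) + i) x); rewrite start_act.
    by rewrite /= be /pass be xv.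
  by exists (Step 0 e x); rewrite //= be /pass be xv.
- move=> p j s b i fp /=; rewrite rank_free //.
  have ji : nblocks A p + i != j by rewrite ge_neq.
  rewrite enter_step ?(aidx_beta _ fp) //.
  split=> -[z [[xv ->] [_ ->]]].
    rewrite act_beta // unbump_ge // xv.
    by eexists; split; [by split|]; rewrite start_act.
  by eexists; split; [by split|]; rewrite act_beta // unbump_ge // xv /= src_beta.
- move=> p i j s fp ij /=; have [si ri] := free_alpha fp i.
  rewrite ri (enter_alpha (aidx_alpha _ fp)) enter_step ?(aidx_beta _ fp) //.
  split=> -[z [[xv ->] [_ ->]]].
    rewrite act_beta // xv.
    by eexists; split; [by split|]; rewrite start_act.
  exists (Step 0 (beta s) x); split=> //.
  by rewrite act_beta // xv /= src_beta.
- move=> p i j s fp ij /=; have [si ri] := free_alpha fp i.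
  rewrite ri (enter_alpha (aidx_alpha _ fp)).
  split=> -[z [[xv zx]]].
    move=> [yv zy]; exists (act false (rank A (rng (beta s)) + unbump j i) x).
    rewrite start_act; split=> //; split=> //.
    rewrite -[y](act_falseK i) -zy zx !enter_step ?(aidx_beta _ fp) //.
    by rewrite act_beta // xv.
  rewrite {z}zx start_act => -[_ ->].
  exists (enter (beta s) x); split=> //.
  rewrite start_enter ?start_act // src_beta //; split=> //.
  rewrite !enter_step ?(aidx_beta _ fp) // act_beta // start_act xv act_trueK //.
  by apply: can_ge; rewrite xv leq_addr.
- move=> p j i fp /=; have [sj rj] := free_alpha fp j.
  rewrite rj rank_free //.
  have ij : nblocks A p + i != j by rewrite ge_neq.
  split=> -[z [[xv ->] [_ ->]]].
    exists (act true (nblocks A p + i) x); rewrite start_act.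
    by split=> //; split=> //; rewrite !(enter_alpha (aidx_alpha _ fp)) act_comm.
  exists (enter (alpha j) x); rewrite start_enter ?rj //.
  split=> //; split=> //; rewrite !(enter_alpha (aidx_alpha _ fp)).
  exact/esym/act_comm.
- move=> p j i fp /=; have [sj rj] := free_alpha fp j.
  rewrite rj rank_free // !(enter_alpha (aidx_alpha _ fp)).
  have ij : nblocks A p + i != j by rewrite ge_neq.
  split=> [[z [[zv xz] [_ yz]]]|[z [[xv zx] [yv zy]]]].
    exists (act true (nblocks A p + i) x); rewrite xz yz !start_act.
    by split=> //; split=> //; rewrite act_comm.
  have cjx : can j x.
    by rewrite -(can_act true x (_ : (j : nat) != nblocks A p + i)) 1?eq_sym // -zx zy can_act_true.
  exists (act false j x); rewrite start_act act_trueK //; split=> //; split=> //.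
  by rewrite act_comm // -zx zy act_falseK.
Qed.

Lemma rho_scong (u w : sterm E) : scong A u w -> rho u = rho w.
Proof.
elim=> {u w} //=.
- by move=> y x z _ -> _ ->.
- by move=> x x' y y' _ -> _ ->.
- by move=> x x' _ ->.
- move=> u v w; apply/funext => x; apply/funext => y; apply/propext; split.
    by move=> [z [[t [xt tz]] zy]]; exists t; split=> //; exists z.
  by move=> [z [xz [t [zt ty]]]]; exists t; split=> //; exists z.
- by move=> u; apply/funext => x; apply/funext => y; apply/propext; split=> // -[z []].
- by move=> u; apply/funext => x; apply/funext => y; apply/propext; split=> // -[z []].
- move=> u v; apply/funext => x; apply/funext => y; apply/propext.
  by split=> -[z [? ?]]; exists z.
- exact: rho_srel.
Qed.

(** Proved jointly with [rho_inj], since the star exchanges the two properties. *)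
Lemma rho_func u x y z : rho u x y -> rho u x z -> y = z
with rho_inj u x y z : rho u x z -> rho u y z -> x = y.
Proof.
- case: u => [|g|u w|u] //=.
  + by case: g => [v|e|b i v] /= [_ ->] [_ ->].
  + move=> [t [xt ty]] [t' [xt' t'z]].
    by move: t'z; rewrite -(rho_func w _ _ _ xt xt'); exact: rho_func.
  + exact: rho_inj.
- case: u => [|g|u w|u] //=.
  + case: g => [v|e|b i v] /= [sx zx] [sy zy].
    * by rewrite -zx.
    * by apply: (@enter_inj e); rewrite -zx.
    * have cxy t : start t = v -> can (rank A v + i) t.
        by move=> st; apply: can_ge; rewrite st leq_addr.
      move: zy; rewrite zx => /(congr1 (act (~~ b) (rank A v + i))).
      by case: (b); rewrite /= ?act_falseK ?act_trueK ?cxy.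
  + move=> [t [xt tz]] [t' [yt' t'z]].
    by move: xt; rewrite (rho_inj u _ _ _ tz t'z) => /rho_inj; apply.
  + exact: rho_func.
Qed.

End Representation.

(** * Relations in S(E,C) *)

Section StarSemigroup.
Local Open Scope classical_set_scope.
Local Open Scope quotient_scope.
Local Open Scope group_scope.
Variable S : starSemigroup0Type.
Implicit Types s t e f : S.

Definition inverse_law := (forall s, s * star s * s = s) /\
  (forall e f, idem e -> idem f -> e * f = f * e).

(** Also called 0-E-unitary or E*-unitary: only idempotents lie above a nonzero idempotent. *)
Definition e_unitary := forall s f, idem f -> f <> szero -> s * f = f -> idem s.

(* Equivalently, all tight filters are ultrafilters. *)
Definition decisive := forall (x : tight_spectrum S) z,
  idem z -> exists2 f, set_val x f & f * z = f \/ f * z = szero.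

Lemma star_szero : star szero = szero :> S.
Proof. by rewrite -{1}(mul0s (star szero)) starM starK mul0s. Qed.

Lemma star_commute s t : commute s t -> commute (star s) (star t).
Proof. by rewrite /commute => st; rewrite -!starM st. Qed.

End StarSemigroup.

Section Relations.
Local Open Scope classical_set_scope.
Local Open Scope quotient_scope.
Local Open Scope group_scope.
Variables (E : sep_graph) (A : adaptable E).
Implicit Types (v w : vertex E) (e f : edge E) (p q : component E).
Implicit Types (x y z : gpoint E) (m n : nat).

Local Notation S := (graph_semigroup A).
Implicit Types s t : S.

Lemma piM (u w : sterm E) : \pi_S (SMul u w) = (\pi_S u * \pi_S w :> S)%g.
Proof. exact: esym (gs_mulE A u w). Qed.

Lemma pi_star (u : sterm E) : \pi_S (SStar u) = star (\pi_S u : S).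
Proof. exact: esym (gs_starE A u). Qed.

Lemma pi_zero : \pi_S SZero = szero :> S.
Proof. by []. Qed.

Definition srho (s : S) := rho A (repr s).

Lemma srho_pi (u : sterm E) : srho (\pi_S u) = rho A u.
Proof. exact/rho_scong/scong_repr. Qed.

Lemma srhoM s t x y : srho (s * t) x y <-> exists z, srho t x z /\ srho s z y.
Proof.
by elim/quotW: s => u; elim/quotW: t => w; rewrite -piM !srho_pi.
Qed.

Lemma srho_star s x y : srho (star s) x y <-> srho s y x.
Proof. by elim/quotW: s => u; rewrite -pi_star !srho_pi. Qed.

Lemma srho_zero x y : ~ srho szero x y.
Proof. by rewrite -pi_zero srho_pi. Qed.

Lemma srho_func s x y z : srho s x y -> srho s x z -> y = z.
Proof. exact: rho_func. Qed.

Lemma srho_inj s x y z : srho s x z -> srho s y z -> x = y.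
Proof. exact: rho_inj. Qed.

Lemma srho_idem s x y : s * s = s -> srho s x y -> x = y /\ srho s y y.
Proof.
move=> ss xy; have : srho (s * s) x y by rewrite ss.
rewrite srhoM => -[z [xz zy]].
have yz := srho_func xy xz; rewrite -yz in zy.
by split=> //; exact: srho_inj xy zy.
Qed.

Definition vx v : S := \pi_S (SGen (GV v)).
Definition ed e : S := \pi_S (SGen (GE e)).
Definition tt b i v : S := \pi_S (SGen (GT b i v)).

Lemma pi_rel (u w : sterm E) : srel A u w -> \pi_S u = \pi_S w :> S.
Proof. by move=> uw; apply/graph_semigroupP/scong_rel. Qed.

Lemma vx_idem v : vx v * vx v = vx v.
Proof. by rewrite -piM; exact/pi_rel/R1_idem. Qed.

Lemma vx_orth v w : v <> w -> vx v * vx w = szero.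
Proof. by move=> vw; rewrite -piM -pi_zero; exact/pi_rel/R1_orth. Qed.

Lemma vx_star v : star (vx v) = vx v.
Proof. by rewrite -pi_star; exact/pi_rel/R1_star. Qed.

Lemma vx_ed e : vx (src e) * ed e = ed e.
Proof. by rewrite -piM; exact/esym/pi_rel/R2_src. Qed.

Lemma ed_vx e : ed e * vx (rng e) = ed e.
Proof. by rewrite -piM; exact/esym/pi_rel/R2_rng. Qed.

Lemma exists_block e : exists2 X, blocks (src e) X & X e.
Proof.
have [cov _ _] := blocksP (src e).
by have : [set f | src f = src e] e by []; rewrite -cov => -[X bX Xe]; exists X.
Qed.

Lemma ed_star_ed e : star (ed e) * ed e = vx (rng e).
Proof.
have [X bX Xe] := exists_block e.
by rewrite -pi_star -piM; exact/pi_rel/(R2_same _ bX Xe).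
Qed.

Lemma ed_orth v X e f : blocks v X -> X e -> X f -> e <> f ->
  star (ed e) * ed f = szero.
Proof.
move=> bX Xe Xf ef; rewrite -pi_star -piM -pi_zero.
exact/pi_rel/(R2_diff _ bX Xe Xf ef).
Qed.

Lemma ttC b c i j v : commute (tt b i v) (tt c j v).
Proof. by rewrite /commute -!piM; exact/pi_rel/R5_comm. Qed.

Lemma tt_star i v : star (tt true i v) = tt false i v.
Proof. by rewrite -pi_star; exact/pi_rel/R5_star. Qed.

Lemma ttV i v : tt true i v * tt false i v = vx v.
Proof. by rewrite -piM; exact/pi_rel/R5_mulV. Qed.

Lemma Vtt i v : tt false i v * tt true i v = vx v.
Proof. by rewrite -piM; exact/pi_rel/R5_Vmul. Qed.

Lemma vx_tt b i v : vx v * tt b i v = tt b i v.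
Proof.
have vt : vx v * tt true i v = tt true i v by rewrite -piM; exact/pi_rel/R5_left.
have tv : tt true i v * vx v = tt true i v by rewrite -piM; exact/pi_rel/R5_right.
by case: b => //; rewrite -tt_star -{1}vx_star -starM tv.
Qed.

Lemma tt_vx b i v : tt b i v * vx v = tt b i v.
Proof.
have tv : tt true i v * vx v = tt true i v by rewrite -piM; exact/pi_rel/R5_right.
case: b => //.
by rewrite -tt_star -{1}vx_star -starM vx_tt.
Qed.

(* The partial isometry raising the coordinate [m] at [v]. *)
Definition cg v m : S :=
  if pselect (exists e, src e = v /\ aidx A e = Some m) is left h
  then ed (projT1 (cid h)) else tt true (m - rank A v) v.

Lemma cg_alpha e m : aidx A e = Some m -> cg (src e) m = ed e.
Proof.
rewrite /cg => ae; case: pselect => [h|[]]; last by exists e.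
by case: (cid h) => f /= [sf af]; congr ed; exact: aidx_inj sf af ae.
Qed.

Lemma cg_tt v i : cg v (rank A v + i) = tt true i v.
Proof.
rewrite /cg; case: pselect => [h|_]; last by rewrite addKn.
exfalso; case: h => e [ev ae].
by have [] := aidx_rank ae; rewrite ev ltnNge leq_addr.
Qed.

Variant cg_spec v m : S -> Prop :=
| CgAlpha p (i : 'I_(nblocks A p)) of Ifree A p & v = vfree A p & m = i :
    cg_spec v m (ed (alpha i))
| CgT i of m = rank A v + i : cg_spec v m (tt true i v).

Lemma cgP v m : cg_spec v m (cg v m).
Proof.
have [lt_m|/subnKC m_eq] := ltnP m (rank A v); last first.
  by rewrite -m_eq cg_tt; exact: CgT.
have [e [<- ae]] := exists_alpha lt_m; rewrite cg_alpha //.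
have /aidxP [p [i [fp -> ->]]] := ae; have [-> _] := free_alpha fp i.
exact: CgAlpha.
Qed.

Lemma vx_cg v m : vx v * cg v m = cg v m.
Proof.
case: cgP => [p i fp -> _|i _]; last exact: vx_tt.
by have [<- _] := free_alpha fp i; exact: vx_ed.
Qed.

Lemma cg_vx v m : cg v m * vx v = cg v m.
Proof.
case: cgP => [p i fp -> _|i _]; last exact: tt_vx.
by have [_ <-] := free_alpha fp i; exact: ed_vx.
Qed.

Lemma cg_star_cg v m : star (cg v m) * cg v m = vx v.
Proof.
case: cgP => [p i fp -> _|i _]; last by rewrite tt_star Vtt.
by rewrite ed_star_ed; have [_ ->] := free_alpha fp i.
Qed.

Lemma ttA_comm p (j : 'I_(nblocks A p)) b i : Ifree A p ->
  commute (tt b i (vfree A p)) (ed (alpha j)).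
Proof.
move=> fp; case: b; first by rewrite /commute -!piM; exact/pi_rel/R9.
rewrite -tt_star -[ed _]starK; apply: star_commute.
by rewrite /commute -pi_star -!piM; exact/pi_rel/R9_star.
Qed.

Lemma cgC v m n : commute (cg v m) (cg v n).
Proof.
case: (cgP v m) => [p i fp vp mi|i mi]; case: (cgP v n) => [q j fq vq nj|j nj].
- have pq : p = q by apply: (vfree_inj fp fq); rewrite -vp -vq.
  case: _ / pq j fq vq nj => j _ _ _.
  have [->|ij] := eqVneq i j; first exact: commute_refl.
  by rewrite /commute -!piM; exact/pi_rel/R3_comm.
- by rewrite vp; exact/commute_sym/ttA_comm.
- by rewrite vq; exact/ttA_comm.
- exact: ttC.
Qed.

Lemma cg_starC v m n : m != n -> commute (star (cg v m)) (cg v n).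
Proof.
case: (cgP v m) => [p i fp vp mi|i mi]; case: (cgP v n) => [q j fq vq nj|j nj] mn.
- have pq : p = q by apply: (vfree_inj fp fq); rewrite -vp -vq.
  case: _ / pq j fq vq nj => j _ _ nj.
  apply/commute_sym; rewrite /commute -!pi_star -!piM; apply/pi_rel/R3_star => //.
  by rewrite eq_sym; apply: contra mn => /eqP ij; rewrite mi nj ij.
- apply/commute_sym; rewrite /commute -!pi_star -!piM vp.
  exact/pi_rel/R9_star.
- by rewrite tt_star vq; exact/ttA_comm.
- by rewrite tt_star; exact: ttC.
Qed.

(** The common form of R6, R7 and R8. R6 is given for positive powers of [t] only; its second half
    results from inverting the [t]s on both sides. *)
Lemma cg_pass_ed e m : aidx A e = None -> bidx A e != Some m ->
  cg (src e) m * ed e = ed e * cg (rng e) (pass A e (rng e) m) /\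
  star (cg (src e) m) * ed e = ed e * star (cg (rng e) (pass A e (rng e) m)).
Proof.
move=> ae bem; rewrite /pass cg_tt tt_star.
case be: (bidx A e) bem => [j|] bem; last first.
  have [p [rp pe]] := reg_edge ae be; have re := rank_reg rp pe.
  rewrite -[m]add0n -[X in cg _ (X + m)]re cg_tt add0n tt_star.
  have te : tt true m (src e) * ed e = ed e * tt true m (rng e).
    by rewrite -!piM; apply/pi_rel/R6; eassumption.
  split=> //; rewrite -[in LHS]ed_vx -(ttV m) !mulgA -[_ * ed e * _]mulgA -te.
  by rewrite !mulgA Vtt vx_ed.
have /bidxP [p [j' [t [fp ee jj]]]] := be; subst j e.
case: cgP => [q i fq vq mi|i mi].
  have pq : p = q by apply: (vfree_inj fp fq); rewrite -vq src_beta.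
  case: _ / pq i fq vq mi => i _ _ mi; subst m.
  have ij : i != j' by apply: contra bem => /eqP ->.
  by split; [|rewrite -pi_star]; rewrite -!piM; apply/pi_rel; [exact: R8|exact: R8_star].
have ri : rank A (src (beta t)) = nblocks A p by rewrite src_beta // rank_free.
rewrite mi ri unbump_ge ?ltn_ord // tt_star src_beta //.
by split; rewrite -!piM; apply/pi_rel/R7.
Qed.

(** The alpha of coordinate [j] and the beta [e] are distinct edges of one block, so R2 applies. *)
Lemma cg_star_ed e j : bidx A e = Some j -> star (cg (src e) j) * ed e = szero.
Proof.
move=> be; have [a [sa aa]] := exists_alpha (bidx_rank be); rewrite -sa cg_alpha //.
have /bidxP [p [j' [t [fp ee jj]]]] := be; subst j e.
have /aidxP [q [i [fq ea ia]]] := aa.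
have pq : p = q.
  apply: (vfree_inj fp fq); have [<- _] := free_alpha fq i.
  by rewrite -ea sa src_beta.
case: _ / pq i ea ia {fq} => i ea ia.
case: _ / (ord_inj ia) ea => ea; subst a; apply: (ed_orth (free_block j' fp)).
- by left.
- by right; exists t.
- by move=> at_; move: aa; rewrite at_ aidx_beta.
Qed.

(** Different sources are settled by R1, betas at one free vertex by R4 even across blocks, and
    edges at a regular vertex by R2, since they form a single block. *)
Lemma ed_ed e f : aidx A e = None -> aidx A f = None -> e <> f ->
  star (ed e) * ed f = szero.
Proof.
move=> ae af ef; have [sef|sef] := pselect (src e = src f); last first.
  rewrite -(vx_ed e) -(vx_ed f) starM vx_star -mulgA (mulgA (vx (src e))).
  by rewrite vx_orth // mul0s muls0.
have [[n]|[j be]|[p [rp pe _ _]]] := edge_cases A e; first by rewrite ae.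
  have [[n]|[j' bf]|[p [rp pf _ _]]] := edge_cases A f; first by rewrite af.
    have /bidxP [p [i [s [fp ee _]]]] := be; have /bidxP [q [i' [t [fq ef' _]]]] := bf.
    have pq : p = q by apply: (vfree_inj fp fq); rewrite -(src_beta s) // -(src_beta t) // -ee -ef'.
    case: _ / pq i' t ef' {fq} => i' t ef'; subst e f.
    rewrite -pi_star -piM -pi_zero; apply/pi_rel/R4 => //.
    apply/eqP => st; apply: ef.
    pose F (u : {i : 'I_(nblocks A p) & 'I_(nbeta i)}) := beta (tagged u).
    exact: (congr1 F st).
  by have := bidx_rank be; rewrite sef (rank_reg rp pf).
have [X bX Xe] := exists_block e.
have re := rank_reg rp pe; have [XE _] := blocks_rank0 re bX.
by apply: (ed_orth bX Xe) => //; rewrite XE /= sef.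
Qed.

End Relations.

(** * Normal forms in S(E,C) *)

Section NormalFormTheory.
Local Open Scope classical_set_scope.
Local Open Scope quotient_scope.
Local Open Scope group_scope.
Variables (E : sep_graph) (A : adaptable E).
Implicit Types (v w : vertex E) (e f : edge E) (p q : component E).
Implicit Types (x y z : gpoint E) (m n l : nat).
Local Notation S := (graph_semigroup A).
Implicit Types s t : S.
Local Notation vx := (vx A).
Local Notation ed := (ed A).
Local Notation cg := (cg A).
Implicit Types (g h : seq (nat * edge E)) (M N : seq nat).

Lemma vx_star_cg v m : vx v * star (cg v m) = star (cg v m).
Proof. by rewrite -{1}vx_star -starM cg_vx. Qed.

Lemma star_cg_vx v m : star (cg v m) * vx v = star (cg v m).
Proof. by rewrite -{1}vx_star -starM vx_cg. Qed.

Lemma vx_star_ed e : vx (rng e) * star (ed e) = star (ed e).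
Proof. by rewrite -{1}vx_star -starM ed_vx. Qed.

Lemma star_ed_vx e : star (ed e) * vx (src e) = star (ed e).
Proof. by rewrite -{1}vx_star -starM vx_ed. Qed.

(** For a beta this is the alpha of its block. The vertex is a filler: in the other case [valid]
    forces the exponent to be 0. *)
Definition loop e : S := if bidx A e is Some j then cg (src e) j else vx (src e).
(** Segments and monomials are applied to a factor [s] because [S] has no unit; [pos] closes the
    product with a vertex as local unit. *)
Definition seg l e s : S := iter l ( *%g (loop e)) (ed e * s).
Definition mon w M s : S := foldr (fun m => *%g (cg w m)) s M.
Definition pos g M w : S := foldr (fun le => seg le.1 le.2) (mon w M (vx w)) g.

Definition pstart g w := if g is (_, e) :: _ then src e else w.

Fixpoint valid g w : Prop := if g is (l, e) :: g' then
  [/\ aidx A e = None, bidx A e = None -> l = 0, rng e = pstart g' w & valid g' w]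
  else True.

Lemma vx_loop e : vx (src e) * loop e = loop e.
Proof. by rewrite /loop; case: bidx => [j|]; rewrite ?vx_cg ?vx_idem. Qed.

Lemma star_loop_loop e : star (loop e) * loop e = vx (src e).
Proof. by rewrite /loop; case: bidx => [j|]; rewrite ?cg_star_cg ?vx_star ?vx_idem. Qed.

Lemma vx_seg l e s : vx (src e) * seg l e s = seg l e s.
Proof. by case: l => [|l]; rewrite /seg /= mulgA ?vx_ed ?vx_loop. Qed.

Lemma vx_mon w M s : vx w * s = s -> vx w * mon w M s = mon w M s.
Proof. by case: M => //= m M _; rewrite mulgA vx_cg. Qed.

Lemma vx_pos g M w : vx (pstart g w) * pos g M w = pos g M w.
Proof.
case: g => [|[l e] g]; last exact: vx_seg.
exact/vx_mon/vx_idem.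
Qed.

Lemma segM l e s t : seg l e (s * t) = seg l e s * t.
Proof. by rewrite /seg mulgA; elim: l => //= l ->; rewrite mulgA. Qed.

Lemma monM w M s t : mon w M (s * t) = mon w M s * t.
Proof. by rewrite /mon; elim: M => //= m M ->; rewrite mulgA. Qed.

Lemma seg_zero l e : seg l e szero = szero.
Proof. by rewrite -(mul0s szero) segM !muls0. Qed.

Lemma mon_zero w M : mon w M szero = szero.
Proof. by rewrite -(mul0s szero) monM !muls0. Qed.

Lemma posE g M w t :
  foldr (fun le => seg le.1 le.2) (mon w M (vx w) * t) g = pos g M w * t.
Proof. by rewrite /pos; elim: g => //= -[l e] g ->; rewrite segM. Qed.

Lemma pos_vx g M w : pos g M w * vx w = pos g M w.
Proof. by rewrite -posE -monM vx_idem. Qed.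

Lemma star_seg_seg l e s t : star (seg l e s) * seg l e t = star s * vx (rng e) * t.
Proof.
rewrite /seg; elim: l => [|l IH] /=.
  by rewrite starM -mulgA [_ * (ed e * t)]mulgA ed_star_ed mulgA.
rewrite starM -mulgA [_ * (loop e * _)]mulgA star_loop_loop -[iter _ _ (_ * t)]/(seg l e t).
by rewrite vx_seg.
Qed.

Lemma star_mon_mon w M s t : vx w * t = t ->
  star (mon w M s) * mon w M t = star s * t.
Proof.
move=> wt; elim: M => //= m M IH.
by rewrite starM -mulgA [_ * (_ * mon _ _ _)]mulgA cg_star_cg vx_mon.
Qed.

Lemma star_pos_pos g M w : valid g w -> star (pos g M w) * pos g M w = vx w.
Proof.
elim: g => [_|[l e] g IH /= [_ _ re vg]].
  by rewrite star_mon_mon ?vx_star ?vx_idem.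
rewrite star_seg_seg re -mulgA.
by rewrite vx_pos IH.
Qed.

Lemma mon_comm w M m s : cg w m * mon w M s = mon w M (cg w m * s).
Proof. by elim: M => //= n M IH; rewrite -IH !mulgA (cgC A w m n). Qed.

Lemma mon_cat w M N s : mon w (M ++ N) s = mon w M (mon w N s).
Proof. by rewrite /mon foldr_cat. Qed.

Lemma mon_perm w M N s : perm_eq M N -> mon w M s = mon w N s.
Proof.
elim: M N => [|m M IH] N; first by rewrite perm_sym => /perm_nilP ->.
move=> mMN; have mN : m \in N by rewrite -(perm_mem mMN) mem_head.
case/path.splitPr: N / mN mMN => N1 N2 mMN.
rewrite mon_cat /= -mon_comm -mon_cat (IH (N1 ++ N2)) //.
by rewrite -(perm_cons m) (perm_trans mMN) // perm_catC /= perm_cons perm_catC.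
Qed.

Lemma pos_cg g M w m : pos g M w * cg w m = pos g (m :: M) w.
Proof. by rewrite -posE -monM vx_cg -[in LHS]cg_vx -mon_comm. Qed.

Lemma iter_comm l s t u : commute s t -> s * iter l ( *%g t) u = iter l ( *%g t) (s * u).
Proof. by move=> st; elim: l => //= l <-; rewrite !mulgA st. Qed.

Lemma cg_seg e m l s : aidx A e = None -> bidx A e != Some m ->
  cg (src e) m * seg l e s = seg l e (cg (rng e) (pass A e (rng e) m) * s).
Proof.
move=> ae em; rewrite /seg iter_comm; last first.
  rewrite /loop; case: bidx => [j|]; first exact: cgC.
  by rewrite /commute cg_vx vx_cg.
by rewrite !mulgA; have [-> _] := cg_pass_ed ae em.
Qed.

Lemma star_cg_seg e m l s : aidx A e = None -> bidx A e != Some m ->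
  star (cg (src e) m) * seg l e s = seg l e (star (cg (rng e) (pass A e (rng e) m)) * s).
Proof.
move=> ae em; rewrite /seg iter_comm; last first.
  rewrite /loop; case: bidx em => [j|] em.
    by apply: cg_starC; apply: contra em => /eqP ->.
  by rewrite /commute star_cg_vx vx_star_cg.
by rewrite !mulgA; have [_ ->] := cg_pass_ed ae em.
Qed.

Lemma cg_pos g M w m : valid g w -> exists g' M', [/\ valid g' w,
  pstart g' w = pstart g w & cg (pstart g w) m * pos g M w = pos g' M' w].
Proof.
elim: g m => [|[l e] g IH] m /=; first by exists [::], (m :: M).
move=> [ae be re vg]; have [em|em] := eqVneq (bidx A e) (Some m).
  exists ((l.+1, e) :: g), M; rewrite /= em in be *; split=> //.
  by rewrite /seg /= /loop em.
have [g' [M' [vg' sg' eg']]] := IH (pass A e (rng e) m) vg.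
exists ((l, e) :: g'), M'; rewrite /= sg'; split=> //.
by rewrite cg_seg // -eg' -re.
Qed.

(** Either the lowering is stopped at exponent 0 and gives 0, or it cancels against a positive
    exponent or a factor of the monomial, or it crosses the whole product and is left for the
    starred half of the normal form. *)
Lemma star_cg_pos g M w m : valid g w -> let s := star (cg (pstart g w) m) * pos g M w in
  [\/ s = szero,
      exists g' M', [/\ valid g' w, pstart g' w = pstart g w & s = pos g' M' w] |
      exists g' M' m', [/\ valid g' w, pstart g' w = pstart g w &
                           s = pos g' M' w * star (cg w m')]].
Proof.
elim: g m => [|[l e] g IH] m /=.
  move=> _; have [|] := boolP (m \in M); last first.
    move=> mM; constructor 3; exists [::], M, m; split=> //=.
    elim: M mM => [|n M IH] /=; first by rewrite /pos /= vx_star_cg star_cg_vx.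
    rewrite inE negb_or => /andP [mn /IH mM].
    by rewrite mulgA (cg_starC _ _ mn) -mulgA mM mulgA.
  move=> /perm_to_rem mM; constructor 2; exists [::], (rem m M); split=> //.
  by rewrite /pos /= (mon_perm _ _ mM) /= mulgA cg_star_cg vx_mon ?vx_idem.
move=> [ae be re vg]; have [em|em] := eqVneq (bidx A e) (Some m).
  case: l be => [_|l be].
    constructor 1; rewrite /seg /= mulgA.
    by rewrite (cg_star_ed em) mul0s.
  constructor 2; exists ((l, e) :: g), M; split=> //=; first by rewrite em.
  by rewrite {1}/seg /= {1}/loop em mulgA cg_star_cg vx_seg.
rewrite star_cg_seg //.
have [] := IH (pass A e (rng e) m) vg; rewrite -re.
- by move=> s0; constructor 1; rewrite s0 seg_zero.
- move=> [g' [M' [vg' sg' eg']]]; constructor 2; exists ((l, e) :: g'), M'.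
  by rewrite eg' /= sg'.
- move=> [g' [M' [m' [vg' sg' eg']]]]; constructor 3; exists ((l, e) :: g'), M', m'.
  by rewrite eg' segM /= sg'.
Qed.

Lemma star_ed_cg e m : aidx A e = None ->
  star (ed e) * cg (src e) m = szero \/
  star (ed e) * cg (src e) m = cg (rng e) (pass A e (rng e) m) * star (ed e).
Proof.
move=> ae; have [em|em] := eqVneq (bidx A e) (Some m).
  by left; rewrite -[LHS]starK starM starK (cg_star_ed em) star_szero.
right; rewrite -[LHS]starK starM starK; have [_ ->] := cg_pass_ed ae em.
by rewrite starM starK.
Qed.

Lemma star_ed_mon e M s : aidx A e = None ->
  star (ed e) * mon (src e) M s = szero \/
  exists M', star (ed e) * mon (src e) M s = mon (rng e) M' (star (ed e) * s).
Proof.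
move=> ae; elim: M => [|m M IH] /=; first by right; exists [::].
rewrite mulgA; have [->|->] := star_ed_cg m ae; first by left; rewrite mul0s.
rewrite -mulgA; case: IH => [->|[M' ->]]; first by left; rewrite muls0.
by right; exists (pass A e (rng e) m :: M').
Qed.

Lemma mon_ed e M s : aidx A e = None -> exists l M',
  (bidx A e = None -> l = 0) /\ mon (src e) M (ed e * s) = seg l e (mon (rng e) M' s).
Proof.
move=> ae; elim: M => [|m M [l [M' [lb IH]]]] /=; first by exists 0, [::].
have [em|em] := eqVneq (bidx A e) (Some m).
  by exists l.+1, M'; rewrite em IH /seg /= /loop em.
by exists l, (pass A e (rng e) m :: M'); rewrite IH cg_seg.
Qed.

Lemma pos_ed g M e : aidx A e = None -> valid g (src e) -> exists g' M',
  valid g' (rng e) /\ pos g M (src e) * ed e = pos g' M' (rng e).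
Proof.
move=> ae vg; have [l [M' [lb MM']]] := mon_ed M (vx (rng e)) ae.
exists (rcons g (l, e)), M'; split.
  elim: g vg => [|[k f] g IH] //= [af bf rf /IH vg]; split=> //.
  by rewrite rf; case: (g).
rewrite -posE -monM vx_ed -[in LHS]ed_vx MM' /pos.
by elim: g {vg} => //= -[k f] g ->.
Qed.

Lemma mul_vx_neq v w s t : t * vx v = t -> v <> w -> vx w * s = s -> t * s = szero.
Proof. by move=> <- vw <-; rewrite -mulgA (mulgA (vx v)) vx_orth // mul0s muls0. Qed.

(** If the path is empty, [star (ed e)] either is killed by the monomial or crosses it to the right
    end. Otherwise it meets the first segment: an equal edge with exponent 0 cancels, and everything
    else vanishes. *)
Lemma star_ed_pos e g M w : aidx A e = None -> valid g w ->
  let s := star (ed e) * pos g M w in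
  [\/ s = szero, exists g' M', valid g' w /\ s = pos g' M' w |
      w = src e /\ exists M', s = pos [::] M' (rng e) * star (ed e)].
Proof.
move=> ae vg /=; have [we|we] := pselect (pstart g w = src e); last first.
  by constructor 1; apply: mul_vx_neq (star_ed_vx e) _ (vx_pos g M w); exact/nesym.
case: g vg we => [_ /= we|[l f] g /= [af bf rf vg] fe].
  subst w; have [s0|[M' s0]] := star_ed_mon M (vx (src e)) ae.
    by constructor 1.
  constructor 3; split=> //; exists M'; rewrite [LHS]s0 star_ed_vx /pos /=.
  by rewrite -monM vx_star_ed.
have ef0 : e <> f -> star (ed e) * (ed f * pos g M w) = szero.
  by move=> ef; rewrite mulgA ed_ed // mul0s.
case: l bf => [_|l]; rewrite /seg /=.
  have [ef|/ef0] := pselect (e = f); last by constructor 1.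
  subst f; constructor 2; exists g, M; split=> //.
  by rewrite mulgA ed_star_ed rf vx_pos.
rewrite {1}/loop; case bf: (bidx A f) => [j|] lb; last by have := lb erefl.
(* The power of [loop f] is read as a monomial at [src e]. Crossing it brings the star of [e] up
   against [ed f], which gives 0 if [e <> f]; for [e = f] the very first loop gives 0. *)
constructor 1; have := star_ed_mon (nseq l.+1 j) (ed f * pos g M w) ae.
have -> : mon (src e) (nseq l.+1 j) (ed f * pos g M w) = cg (src f) j *
    iter l ( *%g (loop f)) (ed f * pos g M w).
  by rewrite /loop bf -fe -iterS /mon; elim: (l.+1) => //= k ->.
case=> // -[M' MM']; have [ef|/ef0 ef] := pselect (e = f).
  subst f; rewrite mulgA -[star _ * _]starK starM starK.
  by rewrite cg_star_ed // star_szero mul0s.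
by rewrite MM' ef mon_zero.
Qed.

Definition NF s := s = szero \/ exists g M h N w,
  [/\ valid g w, valid h w & s = pos g M w * star (pos h N w)].

Lemma NF0 : NF szero. Proof. by left. Qed.

Lemma NF_star s : NF s -> NF (star s).
Proof.
case=> [->|[g [M [h [N [w [vg vh ->]]]]]]]; first by left; exact: star_szero.
by right; exists h, N, g, M, w; rewrite starM starK.
Qed.

Lemma NF_vx v s : NF s -> NF (vx v * s).
Proof.
case=> [->|[g [M [h [N [w [vg vh ->]]]]]]]; first by rewrite muls0; exact: NF0.
rewrite mulgA; have [<-|gv] := pselect (pstart g w = v).
  by rewrite vx_pos; right; exists g, M, h, N, w.
by rewrite (mul_vx_neq (vx_idem A v) (nesym gv)) ?vx_pos // mul0s; exact: NF0.
Qed.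

Lemma NF_cg v m s : NF s -> NF (cg v m * s).
Proof.
case=> [->|[g [M [h [N [w [vg vh ->]]]]]]]; first by rewrite muls0; exact: NF0.
rewrite mulgA; have [<-|gv] := pselect (pstart g w = v).
  have [g' [M' [vg' _ ->]]] := cg_pos M m vg.
  by right; exists g', M', h, N, w.
by rewrite (mul_vx_neq (cg_vx A v m) (nesym gv)) ?vx_pos // mul0s; exact: NF0.
Qed.

Lemma NF_star_cg v m s : NF s -> NF (star (cg v m) * s).
Proof.
case=> [->|[g [M [h [N [w [vg vh ->]]]]]]]; first by rewrite muls0; exact: NF0.
rewrite mulgA; have [<-|gv] := pselect (pstart g w = v).
  have [->|[g' [M' [vg' _ ->]]]|[g' [M' [m' [vg' _ ->]]]]] := star_cg_pos M m vg.
  - by rewrite mul0s; exact: NF0.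
  - by right; exists g', M', h, N, w.
  - right; exists g', M', h, (m' :: N), w; split=> //.
    by rewrite -pos_cg starM mulgA.
by rewrite (mul_vx_neq (star_cg_vx v m) (nesym gv)) ?vx_pos // mul0s; exact: NF0.
Qed.

Lemma NF_ed e s : NF s -> NF (ed e * s).
Proof.
case ae: (aidx A e) => [n|]; first by rewrite -(cg_alpha ae); exact: NF_cg.
case=> [->|[g [M [h [N [w [vg vh ->]]]]]]]; first by rewrite muls0; exact: NF0.
rewrite mulgA; have [gv|gv] := pselect (pstart g w = rng e).
  by right; exists ((0, e) :: g), M, h, N, w.
by rewrite (mul_vx_neq (ed_vx A e) (nesym gv)) ?vx_pos // mul0s; exact: NF0.
Qed.

Lemma NF_star_ed e s : NF s -> NF (star (ed e) * s).
Proof.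
case ae: (aidx A e) => [n|]; first by rewrite -(cg_alpha ae); exact: NF_star_cg.
case=> [->|[g [M [h [N [w [vg vh ->]]]]]]]; first by rewrite muls0; exact: NF0.
rewrite mulgA; have [->|[g' [M' [vg' ->]]]|[we [M' ->]]] := star_ed_pos M ae vg.
- by rewrite mul0s; exact: NF0.
- by right; exists g', M', h, N, w.
- subst w; have [h' [N' [vh' hh']]] := pos_ed N ae vh.
  by right; exists [::], M', h', N', (rng e); rewrite -hh' starM mulgA.
Qed.

Lemma NF_vertex v : NF (vx v).
Proof.
by right; exists [::], [::], [::], [::], v; rewrite /pos /= vx_star vx_idem.
Qed.

Lemma NF_gen (x : generator E) s : NF s ->
  NF (\pi_S (SGen x) * s) /\ NF (star (\pi_S (SGen x) : S) * s).
Proof.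
case: x => [v|e|b i v].
- by move=> sNF; split; [|rewrite vx_star]; exact: NF_vx.
- by move=> sNF; split; [exact: NF_ed|exact: NF_star_ed].
- have tE : tt A true i v = cg v (rank A v + i) by rewrite cg_tt.
  case: b => sNF; rewrite -?[\pi_S _]/(tt A _ i v); last rewrite -tt_star starK.
    by rewrite tE; split; [exact: NF_cg|exact: NF_star_cg].
  by rewrite tE; split; [exact: NF_star_cg|exact: NF_cg].
Qed.

Lemma normal_form s : NF s.
Proof.
elim/quotW: s => u.
suff [] : NF (\pi_S u) /\ forall t, NF t -> NF (\pi_S u * t) /\ NF (star (\pi_S u : S) * t) by [].
elim: u => [|x|u [_ IHu] w [NFw IHw]|u [NFu IHu]].
- split=> [|t _]; first exact: NF0.
  by rewrite pi_zero star_szero mul0s; split; exact: NF0.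
- split; last exact: NF_gen.
  (* A generator has a vertex as right unit, so it arises from the normal form of that vertex by
     left multiplication. *)
  have rv v : \pi_S (SGen x) * vx v = \pi_S (SGen x) :> S -> NF (\pi_S (SGen x)).
    by move=> <-; have [] := NF_gen x (NF_vertex v).
  case: x rv => [v|e|b i v] rv.
  + exact: NF_vertex.
  + exact: rv (ed_vx A e).
  + exact: rv (tt_vx A b i v).
- rewrite piM; split=> [|t NFt]; first by have [] := IHu _ NFw.
  rewrite starM -!mulgA; split.
    by have [tw _] := IHw _ NFt; have [] := IHu _ tw.
  by have [_ tu] := IHu _ NFt; have [] := IHw _ tu.
- rewrite pi_star starK; split; first exact: NF_star.
  by move=> t /IHu [].
Qed.

(** * Action of normal forms, and the inverse semigroup axioms *)

Lemma srho_vx v x y : srho (vx v) x y <-> start x = v /\ y = x.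
Proof. by rewrite srho_pi. Qed.

Lemma srho_ed e x y : srho (ed e) x y <-> start x = rng e /\ y = enter A e x.
Proof. by rewrite srho_pi. Qed.

Lemma srho_cg v m x y : srho (cg v m) x y <-> start x = v /\ y = act A true m x.
Proof.
case: cgP => [p i fp -> ->|i ->]; last by rewrite srho_pi.
by rewrite srho_ed (enter_alpha (aidx_alpha _ fp)); have [_ ->] := free_alpha fp i.
Qed.

Definition pact M x := foldr (act A true) x M.
Definition ppath g x := foldr (fun le => @Step E le.1 le.2) x g.

Lemma start_pact M x : start (pact M x) = start x.
Proof. by elim: M => //= m M; rewrite start_act. Qed.

Lemma start_ppath g x : start (ppath g x) = pstart g (start x).
Proof. by case: g => [|[]]. Qed.

Lemma srho_seg l e s x y : aidx A e = None -> (bidx A e = None -> l = 0) ->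
  srho (seg l e s) x y <->
  exists z, [/\ srho s x z, start z = rng e & y = Step l e z].
Proof.
move=> ae; elim: l y => [|l IH] y lb; rewrite /seg /=.
  rewrite srhoM; split=> -[z].
    by rewrite srho_ed enter_step // => -[xz [ze ->]]; exists z.
  by move=> [xz ze ->]; exists z; rewrite srho_ed enter_step.
rewrite -/(seg l e s) srhoM {1}/loop.
case be: (bidx A e) lb IH => [j|] lb IH; last by have := lb erefl.
split=> -[z].
  rewrite srho_cg => -[]; rewrite IH // => -[t [xt te ->]] [_ ->].
  by exists t; rewrite /= be eqxx.
move=> [xz ze ->]; exists (Step l e z); rewrite srho_cg /= be eqxx; split=> //.
by rewrite IH //; exists z.
Qed.

Lemma srho_pos g M w x y : valid g w ->
  srho (pos g M w) x y <-> start x = w /\ y = ppath g (pact M x).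
Proof.
elim: g y => [|[l e] g IH] y /=.
  move=> _; rewrite /pos /=; elim: M y => [|m M IH] y /=; first by rewrite srho_vx.
  rewrite srhoM; split=> [[z []]|[xw ->]].
    by rewrite IH srho_cg => -[xw ->] [_ ->].
  exists (pact M x); rewrite IH srho_cg; split=> //.
  by rewrite start_pact.
move=> [ae be re vg]; rewrite srho_seg //; split=> [[z []]|[xw ->]].
  by move/IH=> /(_ vg) [xw ->] _ ->.
exists (ppath g (pact M x)); split=> //; first exact/IH.
by rewrite start_ppath start_pact xw.
Qed.

Lemma srho_nf g M h N w z : valid g w -> valid h w -> start z = w ->
  srho (pos g M w * star (pos h N w)) (ppath h (pact N z)) (ppath g (pact M z)).
Proof.
move=> vg vh zw; rewrite srhoM; exists z; split; last exact/srho_pos.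
exact/srho_star/srho_pos.
Qed.

Lemma gcoord_pact m M x : gcoord A m (pact M x) = (gcoord A m x + Posz (count_mem m M))%R.
Proof.
elim: M => [|n M IH] /=; first by rewrite addr0.
by rewrite gcoord_act IH PoszD [(n == m)]eq_sym -addrA [(Posz _ + _)%R in RHS]addrC.
Qed.

Fixpoint depth x := if x is Step _ _ y then (depth y).+1 else 0.

Lemma depth_act b m x : depth (act A b m x) = depth x.
Proof. by elim: x m => //= l e x IH m; case: ifP => //=; rewrite IH. Qed.

Lemma depth_pact M x : depth (pact M x) = depth x.
Proof. by elim: M => //= m M; rewrite depth_act. Qed.

Lemma depth_ppath g x : depth (ppath g x) = (size g + depth x)%N.
Proof. by elim: g => //= -[l e] g ->. Qed.

Lemma ppath_inj g h x y : size g = size h -> ppath g x = ppath h y -> g = h /\ x = y.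
Proof.
elim: g h => [|[l e] g IH] [|[k f] h] //= [gh] [-> -> /(IH _ gh) [-> ->]] //.
Qed.

(* If a point is fixed, comparing depths gives [g = h], and comparing
   coordinates shows that [M] and [N] are equal up to reordering. *)
Lemma fixed_pos s x : srho s x x -> exists g M w,
  [/\ valid g w, s = pos g M w * star (pos g M w) & s * s = s].
Proof.
have [->|[g [M [h [N [w [vg vh ->]]]]]]] := normal_form s; first by move/srho_zero.
rewrite srhoM => -[z []]; rewrite srho_star !srho_pos // => -[zw ->] [_ hg].
have gh : size g = size h.
  by have := congr1 depth hg; rewrite !depth_ppath !depth_pact => /addIn.
have [eq_gh MN] := ppath_inj (esym gh) hg; subst h.
have {}MN : perm_eq M N.
  apply/allP => m _ /=; have := congr1 (gcoord A m) MN.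
  by rewrite !gcoord_pact => /addrI [->].
have -> : pos g N w = pos g M w by rewrite /pos (mon_perm _ _ MN).
exists g, M, w; split=> //.
by rewrite -mulgA [star _ * (_ * _)]mulgA star_pos_pos // mulgA pos_vx.
Qed.

(** A nonzero normal form is defined at a point built over the end point at [w] with all coordinates
    0, so nonvanishing can be tested on points. *)
Lemma srho_nonzero s : s <> szero -> exists x y, srho s x y.
Proof.
have [->|[g [M [h [N [w [vg vh ->]]]]]]] := normal_form s; first by [].
move=> _; exists (ppath h (pact N (Base w (fun=> 0%R)))).
by exists (ppath g (pact M (Base w (fun=> 0%R)))); exact: srho_nf.
Qed.

Lemma idem_pos s : s * s = s -> s <> szero -> exists g M w,
  valid g w /\ s = pos g M w * star (pos g M w).
Proof.
move=> ss /srho_nonzero [x [y /(srho_idem ss) [_ yy]]].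
by have [g [M [w [? ? _]]]] := fixed_pos yy; exists g, M, w.
Qed.

Lemma gs_regular s : s * star s * s = s.
Proof.
have [->|[g [M [h [N [w [vg vh ->]]]]]]] := normal_form s; first by rewrite muls0.
rewrite starM starK -!mulgA; congr (_ * _).
rewrite (mulgA (star (pos h N w))) star_pos_pos // (mulgA (star (pos g M w))).
have wh : vx w * star (pos h N w) = star (pos h N w).
  by rewrite -{1}vx_star -starM pos_vx.
by rewrite star_pos_pos // !wh.
Qed.

Lemma idem_star s : s * s = s -> star s = s.
Proof.
have [->|s0] := pselect (s = szero); first by rewrite star_szero.
by move=> /idem_pos /(_ s0) [g [M [w [vg ->]]]]; rewrite starM starK.
Qed.

(** A nonzero [s * t] is defined at some point, which both idempotents must fix. Then [fixed_pos]
    shows that [s * t] is self-adjoint, and its star is [t * s]. *)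
Lemma gs_idem_comm s t : s * s = s -> t * t = t -> s * t = t * s.
Proof.
move=> ss tt; suff: star (s * t) = s * t by rewrite starM !idem_star.
have [->|st0] := pselect (s * t = szero); first by rewrite star_szero.
have [x [y xy]] := srho_nonzero st0; have := xy.
rewrite srhoM => -[z [/(srho_idem tt) [xz zz] /(srho_idem ss) [zy _]]].
have xx : srho (s * t) x x by rewrite {2}xz zy.
by have [g [M [w [_ -> _]]]] := fixed_pos xx; rewrite starM starK.
Qed.

(** The nonzero idempotent [f] fixes a point, hence so does [s], and [fixed_pos] applies. *)
Lemma gs_unitary s (f : S) : f * f = f -> f <> szero -> s * f = f -> s * s = s.
Proof.
move=> ff /srho_nonzero [x [y /(srho_idem ff) [_ yy]]] sf.
have : srho (s * f) y y by rewrite sf.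
rewrite srhoM => -[z [yz zy]]; have zy' := srho_func yy yz.
by rewrite -zy' in zy; have [g [M [w []]]] := fixed_pos zy.
Qed.

End NormalFormTheory.

(** * Germs of an inverse semigroup *)

Section InverseSemigroup.
Local Open Scope classical_set_scope.
Local Open Scope group_scope.
Variables (S : starSemigroup0Type) (invS : inverse_law S).
Implicit Types (s t e f : S) (x y : tight_spectrum S) (g h : germ S).

Let reg : forall s, s * star s * s = s := invS.1.
Let idC : forall e f, idem e -> idem f -> e * f = f * e := invS.2.

Lemma star_reg s : star s * s * star s = star s.
Proof. by rewrite -[in RHS](reg s) !starM starK mulgA. Qed.

Lemma idem_stars s : idem (star s * s).
Proof. by rewrite /idem /= !mulgA star_reg. Qed.

Lemma idem_sstar s : idem (s * star s).
Proof. by rewrite /idem /= mulgA reg. Qed.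

Lemma idem_star_id e : idem e -> star e = e.
Proof.
move=> ee; have ee' : idem (star e) by rewrite /idem /= -starM ee.
have eE : e = star e * e by rewrite -[LHS]reg (idC ee ee') -mulgA ee.
by rewrite {1}eE starM starK -eE.
Qed.

Lemma idemM e f : idem e -> idem f -> idem (e * f).
Proof.
move=> ee ff; rewrite /idem /= -mulgA (mulgA f) (idC ff ee) -mulgA ff mulgA.
by rewrite ee.
Qed.

Lemma idem_zero : idem (szero : S).
Proof. by rewrite /idem /= mul0s. Qed.

Lemma idem_conj s f : idem f -> idem (star s * f * s).
Proof.
move=> ff; rewrite /idem /= -!mulgA; congr (_ * _).
rewrite (mulgA s) (mulgA (s * _)) (idC (idem_sstar s) ff) -!mulgA.
by rewrite (mulgA s) reg mulgA ff.
Qed.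

Lemma idem_conjV s f : idem f -> idem (s * f * star s).
Proof. by move=> /(idem_conj (star s)); rewrite starK. Qed.

Lemma conjM s e f : idem e -> star s * e * s * (star s * f * s) = star s * (e * f) * s.
Proof.
move=> ee; rewrite -!mulgA (mulgA s) (mulgA _ (s * _)) (idC ee (idem_sstar s)).
by rewrite !mulgA star_reg.
Qed.

Lemma mul_idemL s f : idem f -> f * s = s * (star s * f * s).
Proof.
by move=> ff; rewrite !mulgA (idC (idem_sstar s) ff) -!mulgA (mulgA s) reg.
Qed.

Lemma mul_idemR s f : idem f -> s * f = s * f * star s * s.
Proof.
by move=> ff; rewrite -!mulgA (idC ff (idem_stars s)) !mulgA reg.
Qed.

Lemma spectrumP x : tight_filters (set_val x).
Proof. exact: set_valP. Qed.

Lemma spec_idem x e : set_val x e -> idem e.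
Proof. by have [[+ _ _ _ _] _] := spectrumP x; apply. Qed.

Lemma spec_zero x : ~ set_val x szero.
Proof. by have [[]] := spectrumP x. Qed.

Lemma specM x e f : set_val x e -> set_val x f -> set_val x (e * f).
Proof. by have [[_ _ _ + _] _] := spectrumP x; apply. Qed.

Lemma spec_up x e f : set_val x e -> idem f -> e * f = e -> set_val x f.
Proof. by have [[_ _ _ _ +] _] := spectrumP x; apply. Qed.

Lemma spec_mulP x e f : idem e -> idem f ->
  set_val x (e * f) <-> set_val x e /\ set_val x f.
Proof.
move=> ee ff; split=> [ef|[]]; last exact: specM.
split; apply: (spec_up ef) => //; last by rewrite -mulgA ff.
by rewrite -mulgA (idC ff ee) mulgA ee.
Qed.

Lemma spec_cover x e (Z : set S) : set_val x e -> finite_cover e Z ->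
  exists2 z, Z z & set_val x z.
Proof.
by have [_ +] := spectrumP x => /[apply] /[apply] -[z [? ?]]; exists z.
Qed.

Lemma spec_ext x y : set_val x = set_val y -> x = y.
Proof. by move=> xy; apply: val_inj. Qed.

Definition agree x s t := exists2 f, set_val x f & s * f = t * f.

Lemma agree_sym x s t : agree x s t -> agree x t s.
Proof. by case=> f xf st; exists f. Qed.

Lemma agree_trans x t s u : agree x s t -> agree x t u -> agree x s u.
Proof.
move=> [f xf st] [f' xf' tu]; exists (f * f'); first exact: specM.
rewrite mulgA st -mulgA (idC (spec_idem xf) (spec_idem xf')) !mulgA.
by rewrite tu.
Qed.

(** The element [f * (star s * s) * f] of the filter depends only on the restriction [s * f], which
    equals [t * f]. *)
Lemma agree_dom x s t : agree x s t -> dom_at (star s * s) x -> dom_at (star t * t) x.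
Proof.
move=> [f xf st] xs; have ff := spec_idem xf.
have : set_val x (f * (star s * s) * f) by apply: specM => //; exact: specM.
have -> : f * (star s * s) * f = star (s * f) * (s * f).
  by rewrite starM (idem_star_id ff) !mulgA.
rewrite st starM (idem_star_id ff) => xt.
apply: (spec_up xt); first exact: idem_stars.
rewrite -mulgA; congr (_ * _).
by rewrite -mulgA (idC ff (idem_stars t)) !mulgA reg.
Qed.

Lemma germ_classP s t x y : dom_at (star t * t) y ->
  germ_class s x = germ_class t y <-> x = y /\ agree x s t.
Proof.
move=> yt; split=> [st|[<- st]].
  have : germ_class t y (t, y).
    by split=> //=; exists (star t * t) => //; split=> //; exact: idem_stars.
  by rewrite -st => -[/= _ -> [f [_ xf] sf]]; split=> //; exists f.
apply/seteqP; split=> -[u z] [/= zu xz [f [ff xf] sf]]; split=> //=; subst z.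
  have [f' xf' tf'] := agree_trans (agree_sym st) (ex_intro2 _ _ f xf sf).
  by exists f' => //; split=> //; exact: spec_idem xf'.
have [f' xf' tf'] := agree_trans st (ex_intro2 _ _ f xf sf).
by exists f' => //; split=> //; exact: spec_idem xf'.
Qed.

Lemma is_germ_uniq g s t x y : is_germ g s x -> is_germ g t y -> x = y /\ agree x s t.
Proof. by move=> [_ gs] [yt gt]; apply/(germ_classP _ _ yt); rewrite -gs -gt. Qed.

Lemma is_germ_agree g s t x : is_germ g s x -> agree x s t -> is_germ g t x.
Proof.
move=> [xs gs] st; have xt := agree_dom st xs; split=> //.
by rewrite gs; apply/germ_classP.
Qed.

Lemma germ_ext g h s t x : is_germ g s x -> is_germ h t x -> agree x s t -> g = h.
Proof.
move=> [xs gs] [xt ht] st; apply: val_inj; rewrite -[LHS]/(set_val g) -[RHS]/(set_val h).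
by rewrite gs ht; apply/germ_classP.
Qed.

Lemma germ_exists s x : dom_at (star s * s) x -> exists g, is_germ g s x.
Proof.
move=> xs.
have sx : germ_class s x \in [set c | exists s x, dom_at (star s * s) x /\ c = germ_class s x].
  by apply/mem_set; exists s, x.
by exists (SigSub sx).
Qed.

Lemma germ_ind g : exists s x, is_germ g s x.
Proof. by have [s [x [xs gs]]] := set_valP g; exists s, x. Qed.

Definition bisection s := Theta s (dom_at (star s * s)).

Lemma bisectionP s g : bisection s g <-> exists x, is_germ g s x.
Proof. by split=> [[x _ gs]|[x gs]]; exists x => //; case: gs. Qed.

Lemma bisection_agree g s t x : is_germ g s x -> bisection t g <-> agree x s t.
Proof.
move=> gs; rewrite bisectionP; split=> [[y gt]|st].
  by have [_ ?] := is_germ_uniq gs gt.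
by exists x; exact: is_germ_agree st.
Qed.

Lemma bisection_zero g : ~ bisection szero g.
Proof. by rewrite bisectionP => -[x [+ _]]; rewrite muls0 => /spec_zero. Qed.

(** Tightness is transported because [star s * z * s], for [z] in a cover of [e], form a cover of
    [star s * e * s]: if [f] is nonzero below the latter, then [s * f * star s] is nonzero below
    [e]. *)
Lemma acts_exists s x : dom_at (star s * s) x -> exists y, acts s x y.
Proof.
move=> xs; pose eta := [set f | idem f /\ set_val x (star s * f * s)].
have up e f : set_val x (star s * e * s) -> idem e -> idem f -> e * f = e ->
    set_val x (star s * f * s).
  move=> xe ee ff ef; apply: (spec_up xe); first exact: idem_conj.
  by rewrite conjM // ef.
suff eta_tight : tight_filters eta by exists (SigSub (mem_set eta_tight)).
split=> [|e Z [ee xe] [Zfin Ze Zcov]].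
  split.
  - by move=> f [].
  - by exists (s * star s); split; [exact: idem_sstar|rewrite !mulgA star_reg].
  - by move=> [_]; rewrite muls0 mul0s => /spec_zero.
  - move=> e f [ee xe] [ff xf]; split; first exact: idemM.
    by rewrite -conjM //; exact: specM.
  - by move=> e f [ee xe] ff ef; split=> //; exact: up xe _ _ _.
have [_ [z Zz <-] xz] : exists2 z', [set star s * z * s | z in Z] z' & set_val x z'.
  apply: (spec_cover xe); split; first exact: finite_image.
    move=> _ [z /Ze [zz ze] <-]; split; first exact: idem_conj.
    by rewrite conjM // ze.
  move=> f [ff fe] f0.
  have fs : f * (star s * s) = f.
    rewrite -fe -mulgA; congr (_ * _).
    by rewrite -!mulgA (mulgA s) reg.
  have f'0 : s * f * star s <> szero.
    move=> f'0; apply: f0; rewrite -fs (idC ff (idem_stars s)) -[f]fs.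
    by rewrite -!mulgA (mulgA s) (mulgA (s * f)) f'0 mul0s muls0.
  have [|z Zz fz] := Zcov (s * f * star s) _ f'0.
    split; first exact: idem_conjV.
    rewrite -[in RHS]fe -!mulgA; congr (_ * (_ * _)).
    by rewrite (idC ee (idem_sstar s)) !mulgA star_reg.
  exists (star s * z * s); first by exists z.
  move=> fz0; apply: fz; have [zz _] := Ze _ Zz.
  rewrite -[X in _ * X * z]star_reg.
  rewrite -!mulgA (mulgA s (star s)) -(idC zz (idem_sstar s)).
  have -> : s * (f * (star s * (z * (s * star s)))) = s * (f * (star s * z * s)) * star s.
    by rewrite !mulgA.
  by rewrite fz0 muls0 mul0s.
by exists z; split=> //; split=> //; have [] := Ze _ Zz.
Qed.

Lemma acts_agree x y s t : agree x s t -> acts s x y -> acts t x y.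
Proof.
move=> [h xh st]; rewrite /acts => ->; apply/seteqP; have hh := spec_idem xh.
have conjh u f : h * (star u * f * u) * h = star (u * h) * f * (u * h).
  by rewrite starM (idem_star_id hh) !mulgA.
have xP u f : idem f -> set_val x (star u * f * u) <->
    set_val x (star (u * h) * f * (u * h)).
  move=> ff; have ffu := idem_conj u ff.
  rewrite -conjh; split=> [xf|]; first by apply: specM => //; exact: specM.
  by rewrite -mulgA => /(spec_mulP _ hh (idemM ffu hh)) [_ /(spec_mulP _ ffu hh) []].
by split=> f [ff xf]; split=> //; apply/(xP _ f ff); move/(xP _ f ff): xf; rewrite st.
Qed.

Lemma acts_dom s x y : acts s x y -> dom_at (star s * s) x -> dom_at (s * star s) y.
Proof.
move=> sxy xs; rewrite /dom_at /= sxy; split; first exact: idem_sstar.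
by rewrite !mulgA star_reg.
Qed.

Lemma acts_star s x y : dom_at (star s * s) x -> acts s x y -> acts (star s) y x.
Proof.
move=> xs sxy; apply/seteqP; rewrite starK.
have E f : star s * (s * f * star s) * s = (star s * s) * f * (star s * s).
  by rewrite !mulgA.
split=> f /= => [xf|[ff]].
  have ff := spec_idem xf; split=> //; rewrite sxy; split; first exact: idem_conjV.
  by rewrite E; exact: specM (specM xs xf) xs.
have ss := idem_stars s; rewrite sxy /= E => -[_].
by move=> /(spec_mulP _ (idemM ss ff) ss) [/(spec_mulP _ ss ff) []].
Qed.

Lemma acts_uniq s x y z : acts s x y -> acts s x z -> y = z.
Proof. by rewrite /acts => sy sz; apply: spec_ext; rewrite sy sz. Qed.

Lemma agree_star s t x y : acts s x y -> dom_at (star s * s) x -> agree x s t ->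
  agree y (star s) (star t).
Proof.
move=> sxy xs [f xf st]; have ff := spec_idem xf.
have st' : f * star s = f * star t.
  by rewrite -(idem_star_id ff) -!starM st.
exists (s * f * star s).
  rewrite sxy; split; first exact: idem_conjV.
  have -> : star s * (s * f * star s) * s = (star s * s) * f * (star s * s).
    by rewrite !mulgA.
  exact: specM (specM xs xf) xs.
have L u : star u * (u * f * star u) = f * star u.
  by rewrite !mulgA -(idC ff (idem_stars u)) -mulgA star_reg.
have tf : t * f * star s = t * f * star t by rewrite -mulgA st' mulgA.
by rewrite {2}st tf !L st'.
Qed.

Lemma germ_mul_bisection s t g1 g2 g : germ_mul (g1, g2) g ->
  bisection s g1 -> bisection t g2 -> bisection (s * t) g.
Proof.
move=> [s' [t' [x [y [/= t'xy g1y g2x gx]]]]].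
move=> /(bisection_agree _ g1y) [f yf sf] /(bisection_agree _ g2x) [f' xf' tf'].
apply/(bisection_agree _ gx); have ff := spec_idem yf; have ff' := spec_idem xf'.
move: (yf); rewrite t'xy => -[_ xf]; have ft' := spec_idem xf.
have := mul_idemL t' ff; move: (star t' * f * t') xf ft' => k xk kk tk.
exists (k * f'); first exact: specM.
transitivity (s * (f * t') * f').
  by rewrite -mulgA (mulgA t') -tk !mulgA sf.
by rewrite tk -!mulgA (idC kk ff') (mulgA t') (mulgA t) tf'.
Qed.

Lemma germ_mul_exists s t g : bisection (s * t) g ->
  exists g1 g2, [/\ germ_mul (g1, g2) g, bisection s g1 & bisection t g2].
Proof.
move=> /bisectionP [x gx]; have [xst _] := gx.
have E : star (s * t) * (s * t) = star t * (star s * s) * t by rewrite starM !mulgA.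
have xt : dom_at (star t * t) x.
  apply: (spec_up xst); first exact: idem_stars.
  by rewrite -!mulgA (mulgA t) reg.
have [y txy] := acts_exists xt; rewrite /dom_at /= E in xst.
have ys : dom_at (star s * s) y by rewrite /dom_at /= txy; split=> //; exact: idem_stars.
have [g1 g1y] := germ_exists ys; have [g2 g2x] := germ_exists xt.
exists g1, g2; split; [by exists s, t, x, y|..]; apply/bisectionP.
- by exists y.
- by exists x.
Qed.

(** The source of [g] determines the factor in [bisection t], whose range determines the other one.
    Hence the convolution of two indicators has at most one nonzero term at [g]. *)
Lemma germ_mul_uniq s t g g1 g2 h1 h2 :
  germ_mul (g1, g2) g -> bisection s g1 -> bisection t g2 ->
  germ_mul (h1, h2) g -> bisection s h1 -> bisection t h2 -> (g1, g2) = (h1, h2).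
Proof.
move=> [s' [t' [x [y [/= txy g1y g2x gx]]]]].
move=> /(bisection_agree _ g1y) ss' /(bisection_agree _ g2x) tt'.
move=> [s'' [t'' [x' [y' [/= txy' h1y h2x gx']]]]].
move=> /(bisection_agree _ h1y) ss'' /(bisection_agree _ h2x) tt''.
have [xx' _] := is_germ_uniq gx gx'; subst x'.
have tt : agree x t' t'' := agree_trans tt' (agree_sym tt'').
have yy' := acts_uniq (acts_agree tt txy) txy'; subst y'.
congr pair; first exact: germ_ext g1y h1y (agree_trans ss' (agree_sym ss'')).
exact: germ_ext g2x h2x tt.
Qed.

Lemma bisection_inv s g : bisection s (germ_inv g) <-> bisection (star s) g.
Proof.
(* The value of [germ_inv] is picked by [xget], so the set must first be shown to be inhabited. *)
have : [set g' | exists s x y, [/\ acts s x y, is_germ g s x & is_germ g' (star s) y]]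
    (germ_inv g).
  have [t [x gx]] := germ_ind g; have [xt _] := gx.
  have [y txy] := acts_exists xt; have ys := acts_dom txy xt.
  rewrite -[X in X * star t]starK in ys; have [g' g'y] := germ_exists ys.
  by apply: (xgetPex g); exists g', t, x, y.
move=> [t [x [y [txy gx g'y]]]]; have [xt _] := gx.
rewrite (bisection_agree _ g'y) (bisection_agree _ gx); split=> [ts|ts].
  rewrite -{1}[t]starK; apply: (agree_star (acts_star xt txy)) ts.
  by rewrite starK; exact: acts_dom xt.
by rewrite -[s]starK; apply: agree_star txy xt ts.
Qed.

End InverseSemigroup.

(** * Topology of the tight spectrum and of the groupoid of germs *)

Section Spectrum.
Local Open Scope classical_set_scope.
Local Open Scope group_scope.
Variables (S : starSemigroup0Type) (invS : inverse_law S).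
Implicit Types (s t e f : S) (x y : tight_spectrum S) (g h : germ S).

Local Notation P := (prod_topology (fun _ : @idem S => bool)).

Definition idem_index e (ee : idem e) : @idem S := SigSub (mem_set ee).

Lemma nbhs_coord (i : @idem S) (phi : P) : nbhs phi [set psi | psi i = phi i].
Proof.
apply: (@proj_continuous _ (fun=> bool) i phi [set b | b = phi i]).
by apply/principal_filterP.
Qed.

Lemma nbhs_coords (r : seq (@idem S)) (phi : P) :
  nbhs phi [set psi | forall i, i \in r -> psi i = phi i].
Proof.
elim: r => [|i r IH]; first exact: filterS filterT.
apply: filterS (filterI (nbhs_coord i phi) IH) => psi [/= psi_i psi_r] j.
by rewrite inE => /predU1P [->//|/psi_r].
Qed.

Lemma open_dom_at e : open (dom_at e : set (tight_spectrum S)).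
Proof.
have [ee|ne] := pselect (idem e); last first.
  rewrite (_ : dom_at e = set0); first exact: open0.
  by apply/seteqP; split=> // x /(spec_idem (x := x))/ne.
exists [set phi : P | phi (idem_index ee) = true].
  rewrite openE => phi phi_e; apply: filterS (nbhs_coord (idem_index ee) phi) => psi /= ->.
  exact: phi_e.
apply/seteqP; split=> x /= => [/asboolP|xe] //.
exact/asboolP.
Qed.

(** Each instance of the axioms of a tight filter involves finitely many idempotents, covers being
    finite, and a limit point agrees with some tight filter on any finitely many of them. Membership
    of [e] keeps the limit nonempty. *)
Lemma closed_tight e : closed (@filter_char S @` dom_at e).
Proof.
move=> phi cl_phi.
have agr (r : seq (@idem S)) : exists2 x : tight_spectrum S, set_val x e &
    forall i, i \in r -> filter_char x i = phi i.
  have [_ [[x xe <-] xr]] := cl_phi _ (nbhs_coords r phi).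
  by exists x.
have [x0 x0e _] := agr [::].
have ee := spec_idem x0e.
pose eta := [set f : S | exists ff : idem f, phi (idem_index ff)].
have etaP (i : @idem S) : eta (set_val i) <-> phi i.
  have iE ff : @idem_index (set_val i) ff = i by apply: val_inj.
  split=> [[ff]|phi_i]; first by rewrite iE.
  by exists (set_valP i); rewrite iE.
have etaP' f (ff : idem f) : eta f <-> phi (idem_index ff) by rewrite -etaP.
have transfer (fs : seq S) : (forall f, f \in fs -> idem f) ->
    exists2 x : tight_spectrum S, set_val x e & forall f, f \in fs -> eta f <-> set_val x f.
  (* [idem_index ee] is a mere default, as all members of [fs] are idempotent. *)
  move=> fsP; pose c f := if pselect (idem f) is left ff then idem_index ff else idem_index ee.
  have [x xe xr] := agr (map c fs); exists x => // f ffs.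
  have := xr (c f) (map_f _ ffs); rewrite /c; case: pselect => [ff|nf]; last first.
    by case: nf; exact: fsP.
  rewrite (etaP' f ff) => <-; rewrite /filter_char /=; split=> [/asboolP|xf] //.
  exact/asboolP.
have eta_e : eta e.
  have [|x xe xP] := transfer [:: e]; first by move=> f; rewrite inE => /eqP ->.
  by apply/xP; rewrite ?mem_head.
have eta_idem f : eta f -> idem f by case.
have idem2 f f' : idem f -> idem f' -> forall f'', f'' \in [:: f; f'; f * f'] -> idem f''.
  move=> ff ff' f''; rewrite !inE => /or3P [] /eqP -> //.
  exact: idemM.
have eta_tight : tight_filters eta.
  split=> [|f Z eta_f [Zfin Zf Zcov]].
    split=> //.
    - by exists e.
    - move=> eta0; have [|x _ xP] := transfer [:: szero].
        by move=> f; rewrite inE => /eqP ->; exact: idem_zero.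
      by apply: (@spec_zero _ x); apply/xP; rewrite ?mem_head.
    - move=> f f' ef ef'; have ff := eta_idem _ ef; have ff' := eta_idem _ ef'.
      have [x _ xP] := transfer _ (idem2 f f' ff ff').
      apply/xP; rewrite ?inE ?eqxx ?orbT //.
      by apply: specM; apply/xP; rewrite ?inE ?eqxx ?orbT.
    - move=> f f' ef ff' fle; have ff := eta_idem _ ef.
      have [x _ xP] := transfer _ (idem2 f f' ff ff').
      apply/xP; rewrite ?inE ?eqxx ?orbT //.
      by apply: (spec_up _ ff' fle); apply/xP; rewrite ?inE ?eqxx ?orbT.
  have [r ZE] := (finite_seqP Z).1 Zfin.
  have [|x _ xP] := transfer (f :: r).
    move=> f'; rewrite inE => /predU1P [->|f'r]; first exact: eta_idem.
    by have [] := Zf f'; rewrite ?ZE.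
  have xf : set_val x f by apply/xP; rewrite ?mem_head.
  have [|z Zz xz] := spec_cover xf (Z := Z); first by split.
  exists z; split=> //; apply/xP => //.
  by move: Zz; rewrite ZE inE /= => ->; rewrite orbT.
exists (SigSub (mem_set eta_tight) : tight_spectrum S); first exact: eta_e.
apply/funext => i; rewrite /filter_char; by apply/asboolP/idP => /(etaP i).
Qed.

Lemma compact_dom_at e : compact (dom_at e : set (tight_spectrum S)).
Proof.
have compP : compact (@filter_char S @` dom_at e).
  have cP : compact [set: P].
    have := @tychonoff (@idem S) (fun=> bool) (fun=> setT) (fun=> bool_compact).
    by congr compact; apply/seteqP; split.
  exact: (subclosed_compact (@closed_tight e) cP).
move=> F FF Fe.
have [_ [[x xe <-] clx]] := compP (@filter_char S @ F) _
  (filterS (@preimage_image _ _ (@filter_char S) (dom_at e)) Fe).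
exists x; split=> // U V FU; rewrite nbhsE => -[V' [[W oW <-] V'x] V'V].
have [| |_ [[y Uy <-] Wy]] := clx (@filter_char S @` U) W.
- exact: filterS (@preimage_image _ _ (@filter_char S) U) FU.
- exact: open_nbhs_nbhs.
by exists y; split=> //; exact: V'V.
Qed.

Hypothesis decS : decisive S.

(** The sets [dom_at f] with [f] in [x] generate a filter, which converges to [x]: by decisiveness
    each coordinate is constant on one of them. *)
Lemma nbhs_spectrum x (U : set (tight_spectrum S)) : nbhs x U ->
  exists2 f, set_val x f & dom_at f `<=` U.
Proof.
pose F : set_system (tight_spectrum S) := filter_from [set f | set_val x f] (@dom_at S).
have [e xe] : set_val x !=set0 by have [[_ ? _ _ _] _] := spectrumP x.
have FF : Filter F.
  apply: filter_from_filter; first by exists e.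
  move=> f f' xf xf'; exists (f * f'); first exact: specM.
  by move=> y /(spec_mulP invS y (spec_idem xf) (spec_idem xf')).
have Fcoord i : F [set y | filter_char y i = filter_char x i].
  have [f xf [fi|fi]] := decS x (set_valP i); exists f => // y yf /=.
    have up z : set_val z f -> filter_char z i = true.
      by move=> zf; apply/asboolP; apply: (spec_up zf) => //; exact: set_valP.
    by rewrite !up.
  have dn z : set_val z f -> filter_char z i = false.
    by move=> zf; apply/asboolP => zi; apply: (@spec_zero _ z); rewrite -fi; exact: specM.
  by rewrite !dn.
have cvgF : @filter_char S @ F --> (filter_char x : P).
  apply/cvg_sup => i A; rewrite nbhsE => -[_ [[V oV <-] Vx] VA].
  apply: filterS (Fcoord i) => y yx; apply: VA.
  by move: Vx; rewrite /preimage /= -yx.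
rewrite nbhsE => -[_ [[V oV <-] Vx] VU].
have [|f xf fV] := cvgF V; first exact: open_nbhs_nbhs.
by exists f => // y /fV; exact: VU.
Qed.

Hypothesis unitS : e_unitary S.

Lemma bisection_open s : open (bisection s).
Proof.
exists [set bisection s]; last by rewrite bigcup_set1.
move=> _ ->; exists [fset bisection s]%fset.
  move=> W /fset1P ->; apply/mem_set.
  exists s, (dom_at (star s * s)); split=> //; exact: open_dom_at.
by apply/seteqP; split=> g /= => [gW|gs W /fset1P ->] //; apply: gW; exact/fset1P.
Qed.

Lemma is_germ_mulr g s x f : is_germ g s x -> set_val x f -> is_germ g (s * f) x.
Proof.
move=> gs xf; apply: (is_germ_agree invS gs); exists f => //.
by rewrite -mulgA (spec_idem xf).
Qed.

Lemma dom_mulr s f x : idem f -> dom_at (star (s * f) * (s * f)) x -> set_val x f.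
Proof.
move=> ff; rewrite starM (idem_star_id invS ff) /dom_at /= => xf.
have xf' := spec_idem xf; apply: (spec_up xf) => //.
by rewrite -!mulgA ff.
Qed.

Lemma bisection_mulr s f : idem f -> bisection (s * f) `<=` bisection s.
Proof.
move=> ff g /bisectionP [x gsf]; have [xsf _] := gsf.
apply/(bisection_agree invS _ gsf); exists f; first exact: dom_mulr xsf.
by rewrite -mulgA ff.
Qed.

(** The sets [Theta] form only a subbase, so the induction runs over a finite intersection: two
    representatives of [g] agree on an idempotent at its source, and restricting to it yields one
    bisection inside both sets. *)
Lemma nbhs_germ g (W : set (germ S)) : nbhs g W ->
  exists2 s, bisection s g & bisection s `<=` W.
Proof.
rewrite nbhsE => -[W' [oW' W'g] W'W]; case: oW' => D' D'P W'E.
move: W'g; rewrite -W'E => -[V D'V Vg].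
have [D DP VE] := D'P _ D'V.
suff [s gs sV] : exists2 s, bisection s g & bisection s `<=` V.
  by exists s => // h /sV Vh; apply: W'W; rewrite -W'E; exists V.
have {}Vg : forall B, B \in finmap.enum_fset D -> B g by rewrite -VE in Vg.
rewrite -VE /bigcap /=.
suff [s gs sV] : exists2 s, bisection s g &
    forall B, B \in finmap.enum_fset D -> bisection s `<=` B.
  by exists s => // h sh B /sV; apply.
have {}DP : forall B, B \in finmap.enum_fset D -> Thetas B.
  by move=> B /DP /set_mem.
elim: (finmap.enum_fset D) Vg DP => [_ _|B r IH Vg DP].
  by have [s [x gx]] := germ_ind g; exists s => //; apply/bisectionP; exists x.
have [B' B'r|B' B'r|s gs sV] := IH.
- by apply: Vg; rewrite in_cons B'r orbT.
- by apply: DP; rewrite in_cons B'r orbT.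
have [t [U [oU Ut BE]]] := DP B (mem_head _ _).
have := Vg B (mem_head _ _); rewrite BE => -[x Ux gx].
have [f' xf' f'U] := nbhs_spectrum (open_nbhs_nbhs (conj oU Ux)).
have [f xf tf] := (bisection_agree invS s gx).1 gs.
have ff := spec_idem xf; have ff' := spec_idem xf'; have ff2 := idemM invS ff ff'.
have E : t * (f * f') = s * (f * f') by rewrite !mulgA tf.
exists (t * (f * f')).
  by apply/bisectionP; exists x; apply: is_germ_mulr gx _; exact: specM.
move=> B'; rewrite in_cons => /predU1P [->|/sV sB'].
  move=> h /bisectionP [y hy]; have [yd _] := hy.
  have /(spec_mulP invS _ ff ff') [yf yf'] := dom_mulr ff2 yd.
  exists y; first exact: f'U.
  apply: (is_germ_agree invS hy); exists (f * f'); first exact: specM.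
  by rewrite -mulgA ff2.
by rewrite E => h /(bisection_mulr ff2); exact: sB'.
Qed.

(* If [s] and [t] agree at one point then [s * star t] is idempotent, so that
   they agree on the whole intersection of their domains. *)
Lemma agree_unitary s t x : agree x s t -> dom_at (star s * s) x ->
  s * (star s * s * (star t * t)) = t * (star s * s * (star t * t)).
Proof.
move=> [h xh sth] xs; have hh := spec_idem xh.
have ss := idem_stars invS s; have tt := idem_stars invS t.
pose f := star s * s * h; have xf : set_val x f by exact: specM.
have stf : s * f = t * f by rewrite /f (invS.2 _ _ ss hh) !mulgA sth.
have ssf : star s * s * f = f by rewrite /f mulgA ss.
clearbody f; have ff := spec_idem xf.
have f0 : f <> szero by move=> f0; apply: (@spec_zero _ x); rewrite -f0.
have aa : idem (s * star t).
  apply: (unitS (f := t * f * star t)); first exact: idem_conjV.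
    by move=> tf0; apply: f0; rewrite -ssf -mulgA stf (mul_idemR invS t ff) tf0 mul0s muls0.
  rewrite -[in RHS]stf -!mulgA (mulgA (star t)) (mulgA (star t * t)) -(invS.2 _ _ ff tt).
  by rewrite -!mulgA (mulgA (star t)) star_reg.
have stE : s * star t = t * star s.
  by rewrite -[LHS](idem_star_id invS aa) starM starK.
pose k := star t * (s * star t) * t; have kk : idem k := idem_conj invS t aa.
have rE : s * star t * t = t * k := mul_idemL invS t aa.
have tk : star t * t * k = k by rewrite /k !mulgA star_reg.
clearbody k; have kE : k = star s * s * (star t * t).
  transitivity (star (t * k) * (t * k)).
    by rewrite starM (idem_star_id invS kk) -mulgA (mulgA (star t)) tk kk.
  rewrite -rE -mulgA starM (idem_star_id invS tt) -mulgA (mulgA (star s)).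
  by rewrite mulgA (invS.2 _ _ tt ss) -mulgA tt.
by rewrite -kE -rE kE !mulgA invS.1.
Qed.

End Spectrum.

(** * The Steinberg algebra *)

Section Ultrafilter.
Local Open Scope classical_set_scope.
Local Open Scope ring_scope.
Local Notation "x *g y" := ((x * y)%g)
  (at level 40, left associativity, only parsing).

Variables (S : starSemigroup0Type) (invS : inverse_law S).
Implicit Types (s t e f : S).

(** A maximal filter containing [f] is tight: each idempotent outside it is orthogonal to one of its
    elements, so a cover of [e] missing it would be orthogonal to a nonzero element below [e]. *)
Lemma exists_tight f : idem f -> f <> szero -> exists x : tight_spectrum S, set_val x f.
Proof.
move=> ff f0.
(* The last clause is conditional so that the empty set, the union of the empty chain, is
   admissible; comparison with the principal filter of [f] later excludes it. *)
pose chi (eta : set S) := [/\ eta `<=` @idem S, ~ eta szero,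
  forall e e', eta e -> eta e' -> eta (e *g e'),
  forall e e', eta e -> idem e' -> e *g e' = e -> eta e' &
  forall e, eta e -> eta f].
have chi_up : chi [set e | idem e /\ f *g e = f].
  split=> [e []//|[_]|e e' [ee fe] [ee' fe']|e e' [ee fe] ee' le|e _].
  - by rewrite muls0 => /esym.
  - by split; [exact: idemM|rewrite mulgA fe fe'].
  - by split=> //; rewrite -fe -mulgA le.
  - by split.
have [|eta [[eta_id eta0 etaM eta_up eta_f] eta_max]] := Zorn_bigcup (P := chi).
  move=> F Fchi Ftot; split.
  - by move=> e [X FX Xe]; have [+ _ _ _ _] := Fchi _ FX; apply.
  - by move=> [X FX]; have [_ + _ _ _] := Fchi _ FX.
  - move=> e e' [X FX Xe] [Y FY Ye'].
    have [XY|YX] := Ftot X Y FX FY.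
      by exists Y => //; have [_ _ + _ _] := Fchi _ FY; apply => //; exact: XY.
    by exists X => //; have [_ _ + _ _] := Fchi _ FX; apply => //; exact: YX.
  - move=> e e' [X FX Xe] ee' le; exists X => //.
    by have [_ _ _ + _] := Fchi _ FX => /(_ e e' Xe ee' le).
  - by move=> e [X FX Xe]; exists X => //; have [_ _ _ _ +] := Fchi _ FX; apply; exact: Xe.
have {}eta_f : eta f.
  apply: contrapT => nf; apply: (eta_max _ _ chi_up); split; last first.
    by move=> sub; apply: nf; apply: sub.
  by move=> e /eta_f.
have ultra z : idem z -> ~ eta z -> exists2 g, eta g & g *g z = szero.
  move=> zz nz; apply: contrapT => none.
  (* The filter generated by [eta] and [z]. *)
  pose eta' := [set h | idem h /\ exists2 g, eta g & g *g z *g h = g *g z].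
  have sub : eta `<=` eta'.
    move=> h eh; split; first exact: eta_id.
    exists h => //; rewrite -mulgA (invS.2 _ _ zz (eta_id _ eh)) mulgA.
    by rewrite (eta_id _ eh).
  apply: (eta_max eta').
    split=> // sub'; apply: nz; apply: sub'; split=> //.
    by exists f => //; rewrite -mulgA zz.
  split.
  - by move=> e [].
  - by move=> [_ [g eg]]; rewrite muls0 => gz; apply: none; exists g.
  - move=> e e' [ee [g eg ge]] [ee' [g' eg' ge']]; split; first exact: idemM.
    exists (g *g g'); first exact: etaM.
    have gg := eta_id _ eg; have gg' := eta_id _ eg'.
    rewrite mulgA -[g *g g' *g z]mulgA (invS.2 _ _ gg' zz) mulgA.
    rewrite -[g *g z *g g' *g e]mulgA (invS.2 _ _ gg' ee) mulgA ge.
    by rewrite -[g *g z *g g']mulgA (invS.2 _ _ zz gg') -!mulgA (mulgA g') ge'.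
  - move=> e e' [ee [g eg ge]] ee' le; split=> //; exists g => //.
    by rewrite -ge -mulgA le.
  - by move=> e _; exact: sub.
have eta_tight : tight_filters eta.
  split; first by split=> //; exists f.
  move=> e Z ee [Zfin Ze Zcov]; apply: contrapT => none.
  have [r ZE] := (finite_seqP Z).1 Zfin.
  have [g eg gZ] : exists2 g, eta g & forall z, z \in r -> g *g z = szero.
    have {ZE} : forall z, z \in r -> idem z /\ ~ eta z.
      move=> z zr; have Zz : Z z by rewrite ZE.
      by split; [have [] := Ze _ Zz|move=> ez; apply: none; exists z].
    elim: r => [_|z r IH zr]; first by exists f.
    have [z' z'r|g eg gr] := IH; first by apply: zr; rewrite inE z'r orbT.
    have [zz nz] := zr z (mem_head _ _); have [h eh hz] := ultra z zz nz.
    exists (g *g h); first exact: etaM.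
    move=> z'; rewrite inE => /predU1P [->|/gr z'r]; first by rewrite -mulgA hz muls0.
    by rewrite (invS.2 _ _ (eta_id _ eg) (eta_id _ eh)) -mulgA z'r muls0.
  have ege := etaM _ _ eg ee.
  have [|ge0|z Zz] := Zcov (g *g e).
  - by split; [exact: eta_id|rewrite -mulgA (eta_id _ ee)].
  - by apply: eta0; rewrite -ge0.
  - have [zz _] := Ze _ Zz; apply; rewrite (invS.2 _ _ (eta_id _ eg) (eta_id _ ee)).
    by rewrite -mulgA gZ ?muls0 //; move: Zz; rewrite ZE.
by exists (SigSub (mem_set eta_tight)).
Qed.

End Ultrafilter.

(** * The Steinberg algebra as the span of the indicators of bisections *)

Section SteinbergSpan.
Local Open Scope classical_set_scope.
Local Open Scope ring_scope.
Local Notation "x *g y" := ((x * y)%g)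
  (at level 40, left associativity, only parsing).

Variables (S : starSemigroup0Type) (invS : inverse_law S).
Variables (decS : decisive S) (unitS : e_unitary S).
Variables (K : fieldType) (bar : {rmorphism K -> K}).
Implicit Types (s t e f : S) (x y : tight_spectrum S) (g h : germ S).
Implicit Types (L M : seq (K * S)).

Definition fsum L : germ S -> K := fun g => \sum_(p <- L) p.1 * \1_(bisection p.2) g.

Definition lmul L M := [seq (p.1 * q.1, p.2 *g q.2) | p <- L, q <- M].

Definition lscale (k : K) L := [seq (k * p.1, p.2) | p <- L].

Definition lstar L := [seq (bar p.1, star p.2) | p <- L].

Lemma fsum_cat L M g : fsum (L ++ M) g = fsum L g + fsum M g.
Proof. by rewrite /fsum big_cat. Qed.

Lemma fsum_scale k L g : fsum (lscale k L) g = k * fsum L g.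
Proof.
by rewrite /fsum big_map mulr_sumr; apply: eq_bigr => p _; rewrite mulrA.
Qed.

(** A germ may have infinitely many factorizations, but at most one lies in a given pair of
    bisections ([C1]). The sum is cut down to the finite set [F] of those seen by [L] and [M], and
    then computed pair by pair. *)
Lemma convolution_fsum L M : convolution (fsum L) (fsum M) = fsum (lmul L M).
Proof.
apply/funext => g; rewrite /convolution.
pose P := [set g12 : germ S * germ S | germ_mul g12 g].
pose C p q := P `&` [set g12 | bisection p g12.1 /\ bisection q g12.2].
pose F := \bigcup_(pq in [set` [seq (p.2, q.2) | p <- L, q <- M]]) C pq.1 pq.2.
have C1 p q : C p q = set0 \/ exists a, C p q = [set a].
  have [->|/set0P [[g1 g2] [Pa [pa qa]]]] := eqVneq (C p q) set0; first by left.
  right; exists (g1, g2); apply/seteqP; split=> [[h1 h2] [Pb [pb qb]]|_ ->] //.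
  exact: (germ_mul_uniq invS Pb pb qb Pa pa qa).
have finF : finite_set F.
  apply: bigcup_finite; first exact: finite_seq.
  move=> [p q] _ /=; have [->|[a ->]] := C1 p q; first exact: finite_set0.
  exact: finite_set1.
have FP : F `<=` P by move=> a [? _ []].
rewrite -(fsbig_widen F P) //; last first.
  move=> a [Pa Fa] /=; rewrite /fsum big_distrlr /=.
  rewrite big_seq big1 // => p pL; rewrite big_seq big1 // => q qM.
  rewrite mulrACA !indicE; case: (boolP (_ \in _)) => [/set_mem pa|_]; last by rewrite mul0r mulr0.
  case: (boolP (_ \in _)) => [/set_mem qa|_]; last by rewrite !mulr0.
  case: Fa; exists (p.2, q.2); last by split.
  by apply/allpairsP; exists (p, q).
rewrite fsbig_finite //= /fsum /lmul big_allpairs_dep /=.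
under eq_bigr do rewrite big_distrlr.
rewrite exchange_big [LHS]big_seq [RHS]big_seq; apply: eq_bigr => p pL.
rewrite exchange_big [LHS]big_seq [RHS]big_seq; apply: eq_bigr => q qM /=.
under eq_bigr do rewrite mulrACA.
rewrite -mulr_sumr; congr (_ * _).
have CF : C p.2 q.2 `<=` F.
  by move=> a Ca; exists (p.2, q.2) => //; apply/allpairsP; exists (p, q).
rewrite -(fsbig_finite _ (fun a => \1_(bisection p.2) a.1 * \1_(bisection q.2) a.2)) //.
rewrite -(fsbig_widen (C p.2 q.2)) //; last first.
  move=> a [Fa Ca] /=; rewrite !indicE.
  case: (boolP (_ \in _)) => [/set_mem pa|_]; last by rewrite mul0r.
  case: (boolP (_ \in _)) => [/set_mem qa|_]; last by rewrite mulr0.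
  by case: Ca; split=> //; exact: FP.
rewrite indicE; case: (boolP (_ \in _)) => [/set_mem pqg|/negP npqg].
  have [g1 [g2 [gm pg1 qg2]]] := germ_mul_exists invS pqg.
  have Ca : C p.2 q.2 (g1, g2) by [].
  have [C0|[a CE]] := C1 p.2 q.2; first by rewrite C0 in Ca.
  rewrite CE in Ca *; rewrite -Ca fsbig_set1 !indicE /=.
  by rewrite !mem_set // mulr1.
have [->|[[g1 g2] CE]] := C1 p.2 q.2; first by rewrite fsbig_set0.
have : C p.2 q.2 (g1, g2) by rewrite CE.
by move=> [Pa [pa qa]]; case: npqg; apply/mem_set; exact: (germ_mul_bisection invS Pa pa qa).
Qed.

Lemma fsum_star L : steinberg_star bar (fsum L) = fsum (lstar L).
Proof.
apply/funext => g; rewrite /steinberg_star /fsum rmorph_sum big_map /=.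
apply: eq_bigr => p _; rewrite rmorphM; congr (_ * _).
rewrite !indicE rmorph_nat; congr (nat_of_bool _)%:R.
apply/idP/idP => /set_mem gp; apply/mem_set.
  exact/(bisection_inv invS).
exact/(bisection_inv invS).
Qed.

Lemma bisection_nbhs s g : bisection s g -> nbhs g (bisection s).
Proof. by move=> gs; apply: open_nbhs_nbhs; split=> //; exact: bisection_open. Qed.

(** Let [[t, x]] be a germ outside. Either some [f] in [x] is orthogonal to [star s * s], and
    restricting [t] to [f] avoids [s]; or both elements are defined at [x], and agreement anywhere
    on their common domain would spread to [x] by [agree_unitary]. *)
Lemma bisection_closed s : closed (bisection s).
Proof.
rewrite -[bisection s]setCK; apply: open_closedC; rewrite openE => g gs.
have [t [x gt]] := germ_ind g; have [xt _] := gt.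
have [f xf [fs|fs]] := decS x (idem_stars invS s); last first.
  have ff := spec_idem xf.
  apply: (@filterS _ _ _ (bisection (t *g f))).
    move=> h /bisectionP [y hy] /bisectionP [z hz].
    have [yz _] := is_germ_uniq invS hy hz; subst z; have [yd _] := hy; have [ys _] := hz.
    apply: (@spec_zero _ y); rewrite -fs; apply: specM ys.
    exact: (dom_mulr invS ff yd).
  by apply/bisection_nbhs/bisectionP; exists x; exact: is_germ_mulr.
have xs : dom_at (star s *g s) x.
  by apply: (spec_up xf) => //; exact: idem_stars.
pose e := star t *g t *g (star s *g s).
have ee : idem e by apply: idemM => //; exact: idem_stars.
apply: (@filterS _ _ _ (bisection (t *g e))); last first.
  by apply/bisection_nbhs/bisectionP; exists x; apply: (is_germ_mulr invS gt); exact: specM.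
move=> h hte hs; have := hte; move=> /(bisection_mulr invS ee) /bisectionP [y hy].
have [yd _] := hy; have ts := (bisection_agree invS s hy).1 hs.
have tse := agree_unitary invS unitS ts yd.
apply: gs; apply/(bisection_agree invS _ gt); exists e => //.
exact: specM.
Qed.

(** The source map identifies the bisection with the compact set [dom_at (star s * s)]; a cluster
    point found there is lifted to its germ of [s]. *)
Lemma bisection_compact s : compact (bisection s).
Proof.
have source_ex g : exists x, exists t, is_germ g t x.
  by have [t [x gt]] := germ_ind g; exists x, t.
pose source g : tight_spectrum S := projT1 (cid (source_ex g)).
have sourceP g t x : is_germ g t x -> source g = x.
  move=> gt; rewrite /source; case: cid => y /= [u gu].
  by have [] := is_germ_uniq invS gu gt.
move=> F FF Fs.
have Fd : F (source @^-1` dom_at (star s *g s)).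
  by apply: filterS Fs => g /bisectionP [x gs]; rewrite /= (sourceP _ _ _ gs); case: gs.
have [x [xs clx]] := @compact_dom_at S invS (star s *g s) (source @ F) _ Fd.
have [g gx] := germ_exists xs.
exists g; split; first by apply/bisectionP; exists x.
move=> U V FU /(nbhs_germ invS decS) [t gt tV].
have [f xf sf] := (bisection_agree invS _ gx).1 gt.
have FsU : F (source @^-1` (source @` (bisection s `&` U))).
  by apply: filterS (filterI Fs FU) => h hU; exists h.
have xf' : nbhs x (dom_at f) by apply: open_nbhs_nbhs; split=> //; exact: open_dom_at.
have [_ [[h [hs Uh] <-] hf]] := clx _ _ FsU xf'.
exists h; split=> //; apply: tV; move: hs => /bisectionP [y hy].
apply/(bisection_agree invS _ hy); exists f => //.
by rewrite -(sourceP _ _ _ hy).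
Qed.

Lemma fsum_locally_constant L g : \forall h \near g, fsum L h = fsum L g.
Proof.
rewrite /fsum; elim: L => [|p L IH].
  by apply: filterS filterT => h _; rewrite !big_nil.
have pg : \forall h \near g, \1_(bisection p.2) h = \1_(bisection p.2) g :> K.
  have [gp|gp] := pselect (bisection p.2 g).
    by apply: filterS (bisection_nbhs gp) => h hp; rewrite !indicE !mem_set.
  have : open_nbhs g (~` bisection p.2).
    by split=> //; exact/closed_openC/bisection_closed.
  by move/open_nbhs_nbhs; apply: filterS => h hp; rewrite !indicE !memNset.
apply: filterS (filterI pg IH) => h [/= pE LE].
by rewrite !big_cons pE LE.
Qed.

Lemma steinberg_fsum L : steinberg (fsum L).
Proof.
split; first exact: fsum_locally_constant.
pose U := foldr (fun p W => bisection p.2 `|` W) set0 L.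
apply: (@subclosed_compact _ _ U).
- move=> g clg /= ; apply/eqP => fg0.
  have [h [/= /eqP + hg]] := clg _ (fsum_locally_constant L g).
  by rewrite hg fg0.
- rewrite /U; elim: (L) => [|p M IH] /=; first exact: compact0.
  apply: compactU => //; exact: bisection_compact.
- move=> g /=; rewrite /U /fsum; elim: (L) => [|p M IH] /=; first by rewrite big_nil eqxx.
  have [gp|gp] := pselect (bisection p.2 g); first by left.
  by rewrite big_cons indicE memNset // mulr0 add0r => /IH; right.
Qed.

(** One common germ makes [s] and [t] agree wherever both are defined, and the intersection is the
    restriction of [s] to that common domain. *)
Lemma bisectionI s t : bisection s `&` bisection t = set0 \/
  exists u, bisection s `&` bisection t = bisection u.
Proof.
have [->|/set0P [g [gs gt]]] := eqVneq (bisection s `&` bisection t) set0; first by left.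
right; have := gs => /bisectionP [x gx]; have [xs _] := gx.
have st := agree_unitary invS unitS ((bisection_agree invS _ gx).1 gt) xs.
pose e := star s *g s *g (star t *g t).
have ee : idem e by apply: idemM => //; exact: idem_stars.
exists (s *g e); apply/seteqP; split=> h.
  move=> [hs /bisectionP [y ht]]; have [yt _] := ht.
  move: hs => /bisectionP [z hs]; have [yz _] := is_germ_uniq invS ht hs; subst z.
  have [ys _] := hs; apply/bisectionP; exists y.
  by apply: (is_germ_mulr invS hs); exact: specM.
move=> hse; split; first exact: (bisection_mulr invS ee).
by apply: (bisection_mulr invS ee); rewrite -st.
Qed.

Definition spanned (phi : germ S -> K) := exists L, forall g, phi g = fsum L g.

Lemma spannedZ k phi : spanned phi -> spanned (fun g => k * phi g).
Proof. by move=> [L pL]; exists (lscale k L) => g; rewrite fsum_scale pL. Qed.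

Lemma spanned_indic s : spanned \1_(bisection s).
Proof. by exists [:: (1, s)] => g; rewrite /fsum big_seq1 mul1r. Qed.

Lemma spanned_indicM s phi : spanned phi -> spanned (fun g => \1_(bisection s) g * phi g).
Proof.
move=> [L pL]; elim: L phi pL => [|p L IH] phi pL.
  by exists [::] => g; rewrite pL /fsum big_nil mulr0.
have [M MP] := IH (fsum L) (fun _ => erefl).
have [N NP] : spanned (fun g => \1_(bisection s) g * (p.1 * \1_(bisection p.2) g)).
  have IE g : \1_(bisection s) g * \1_(bisection p.2) g =
      \1_(bisection s `&` bisection p.2) g :> K by rewrite indicI.
  have [E|[u E]] := bisectionI s p.2.
    by exists [::] => g; rewrite mulrCA IE E indic0 mulr0 /fsum big_nil.
  by exists [:: (p.1, u)] => g; rewrite mulrCA IE E /fsum big_seq1.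
exists (N ++ M) => g; rewrite fsum_cat -MP -NP -mulrDr pL /fsum big_cons //.
Qed.

(** The bisections may overlap: [psi] is [phi] with its part on the first bisection removed, so that
    the remaining ones cover its support. *)
Lemma spanned_cover (r : seq S) phi :
  (forall s, s \in r -> spanned (fun g => \1_(bisection s) g * phi g)) ->
  (forall g, phi g != 0 -> exists2 s, s \in r & bisection s g) -> spanned phi.
Proof.
elim: r phi => [|s r IH] phi rP cov.
  exists [::] => g; rewrite /fsum big_nil; apply/eqP; apply: contrapT => /negP.
  by move=> /cov [].
have sP := rP s (mem_head _ _).
pose psi g := phi g + (-1) * (\1_(bisection s) g * phi g).
suff [M MP] : spanned psi.
  have [N NP] := sP; exists (M ++ N) => g.
  by rewrite fsum_cat -MP -NP /psi mulN1r subrK.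
apply: IH => [t tr|g].
  have [N NP] := rP t (mem_behead (s := s :: r) tr).
  have [M MP] := spannedZ (-1) (spanned_indicM s (rP t (mem_behead (s := s :: r) tr))).
  exists (N ++ M) => g; rewrite fsum_cat -NP -MP /psi mulrDr; congr (_ + _).
  by rewrite mulrCA; congr (_ * _); rewrite mulrCA.
move=> psi_g; have gs : ~ bisection s g.
  by move=> gs; move: psi_g; rewrite /psi indicE mem_set // mul1r mulN1r subrr eqxx.
move: psi_g; rewrite /psi indicE memNset // mul0r mulr0 addr0 => /cov [t].
by rewrite inE => /predU1P [->//|tr tg]; exists t.
Qed.

Lemma steinberg_spanned phi : steinberg phi -> spanned phi.
Proof.
move=> [lc cpt].
pose good s := exists c, forall h, bisection s h -> phi h = c.
(* With finite lists ordered by inclusion, the near-covering form of compactness yields one list of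
   bisections that covers the support of [phi], with [phi] constant on each. *)
pose F : set_system (seq S) :=
  filter_from setT (fun r0 : seq S => [set r | {subset r0 <= r}]).
have FF : Filter F.
  apply: filter_from_filter; first by exists [::].
  move=> r1 r2 _ _; exists (r1 ++ r2) => // r rP; split=> s sr.
    by apply: rP; rewrite mem_cat sr.
  by apply: rP; rewrite mem_cat sr orbT.
pose P (r : seq S) g := exists s, [/\ s \in r, good s & bisection s g].
have /compact_near_coveringP /(_ _ F P FF) [g _|r _ /(_ r)] := cpt.
  have [s gs sP] := nbhs_germ invS decS (lc g).
  exists (bisection s, [set r | {subset [:: s] <= r}]).
    split=> /=; last by exists [:: s].
    exact: bisection_nbhs.
  move=> [h r] [/= hs sr]; exists s; split=> //; first by apply: sr; rewrite mem_head.
  by exists (phi g) => h' /sP.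
move=> /(_ (fun _ => id)) cov.
apply: (@spanned_cover [seq s <- r | `[< good s >]]) => [s|g /cov [s [sr sg gs]]].
  rewrite mem_filter => /andP [/asboolP [c cP] _].
  have [L LP] := spannedZ c (spanned_indic s); exists L => g; rewrite -LP.
  rewrite indicE; case: (boolP (_ \in _)) => [/set_mem/cP ->|_]; first by rewrite mulrC.
  by rewrite mul0r mulr0.
by exists s => //; rewrite mem_filter sr andbT; exact/asboolP.
Qed.

End SteinbergSpan.

(** * The kernel *)

Section StarAlgebraTheory.
Local Open Scope classical_set_scope.
Local Open Scope ring_scope.
Local Notation "x *g y" := ((x * y)%g)
  (at level 40, left associativity, only parsing).

Variables (K : fieldType) (bar : {rmorphism K -> K}) (B : starAlgType bar).
Implicit Types (a b c : B).

Lemma amul0l a : amul 0 a = 0.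
Proof. by rewrite -(scale0r (0 : B)) amulZl !scale0r. Qed.

Lemma amul0r a : amul a 0 = 0.
Proof. by rewrite -(scale0r (0 : B)) amulZr !scale0r. Qed.

Lemma amulBl a b c : amul (a - b) c = amul a c - amul b c.
Proof. by rewrite amulDl -[in LHS]scaleN1r amulZl scaleN1r. Qed.

Lemma amul_suml I (r : seq I) (F : I -> B) a :
  amul (\sum_(i <- r) F i) a = \sum_(i <- r) amul (F i) a.
Proof.
by apply: (big_morph (amul^~ a)) => [b c|]; [rewrite amulDl|rewrite amul0l].
Qed.

Lemma amul_sumr I (r : seq I) (F : I -> B) a :
  amul a (\sum_(i <- r) F i) = \sum_(i <- r) amul a (F i).
Proof.
by apply: (big_morph (amul a)) => [b c|]; [rewrite amulDr|rewrite amul0r].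
Qed.

(** Multiplication by the join of the idempotents would fix [b]. Here the induction eliminates them
    one by one: [amul b p.2 = 0] expresses the first summand by the others, and [b] becomes the sum
    of the [(q.1 - q.1 p.2) q.2]. *)
Lemma left_ideal_eq0 (r : seq (B * B)) b :
  (forall p q, p \in r -> q \in r -> amul p.2 q.2 = amul q.2 p.2) ->
  (forall p, p \in r -> amul p.2 p.2 = p.2) ->
  b = \sum_(p <- r) amul p.1 p.2 -> (forall p, p \in r -> amul b p.2 = 0) -> b = 0.
Proof.
move sz: (size r) => n; elim: n => [|n IH] in r sz b *.
  by case: r sz => // _ _ _; rewrite big_nil.
case: r sz => //= p r [sz] rC rI; rewrite big_cons => bE b0.
have inr q : q \in r -> q \in p :: r by rewrite inE orbC => ->.
have bp : amul p.1 p.2 = - \sum_(q <- r) amul (amul q.1 p.2) q.2.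
  apply/eqP; rewrite -addr_eq0; apply/eqP; rewrite -[RHS](b0 p (mem_head _ _)) bE.
  rewrite amulDl -amulA (rI p (mem_head _ _)) amul_suml; congr (_ + _).
  rewrite big_seq [RHS]big_seq; apply: eq_bigr => q qr.
  by rewrite -!amulA (rC p q) // ?mem_head // inr.
apply: (IH [seq (q.1 - amul q.1 p.2, q.2) | q <- r]).
- by rewrite size_map.
- by move=> _ _ /mapP [q qr ->] /mapP [q' qr' ->] /=; apply: rC; exact: inr.
- by move=> _ /mapP [q qr ->] /=; apply: rI; exact: inr.
- rewrite bE bp big_map addrC -sumrB; apply: eq_bigr => q _.
  by rewrite amulBl.
- by move=> _ /mapP [q qr ->] /=; apply: b0; exact: inr.
Qed.
End StarAlgebraTheory.

Section Kernel.
Local Open Scope classical_set_scope.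
Local Open Scope ring_scope.
Local Notation "x *g y" := ((x * y)%g)
  (at level 40, left associativity, only parsing).

Variables (S : starSemigroup0Type) (invS : inverse_law S) (unitS : e_unitary S).
Variables (K : fieldType) (bar : {rmorphism K -> K}) (B : starAlgType bar).
Variable iota : S -> B.
Hypothesis iotaM : forall s t, iota (s *g t) = amul (iota s) (iota t).
Hypothesis iota0 : iota szero = 0.
Hypothesis decB : forall e z : S, idem e -> idem z -> exists2 r : seq S,
  iota e = \sum_(f <- r) iota f &
  forall f, f \in r -> [/\ idem f, f *g e = f & f *g z = f \/ f *g z = szero].
Implicit Types (s t e f z u : S) (L : seq (K * S)) (b : B).

Definition lin L : B := \sum_(p <- L) p.1 *: iota p.2.

Lemma lin_eq0 L :
  (forall u, iota u = 0 \/ \sum_(p <- L | p.2 == u) p.1 = 0) -> lin L = 0.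
Proof.
have [n] := ubnP (size L); elim: n L => // n IH [|[k u] L'] ltn LP.
  by rewrite /lin big_nil.
move: ltn LP; set L := _ :: L' => ltn LP.
rewrite /lin (bigID (fun p => p.2 == u)) /=.
have -> : \sum_(p <- L | p.2 == u) p.1 *: iota p.2 = 0.
  rewrite (eq_bigr (fun p => p.1 *: iota u)) => [|p /eqP -> //].
  by rewrite -scaler_suml; have [->|->] := LP u; rewrite ?scaler0 ?scale0r.
rewrite add0r -big_filter; apply: IH => [|v].
  rewrite /L /= eqxx /=; apply: leq_ltn_trans (_ : (size L' < n)%N) => //.
  by rewrite size_filter count_size.
have [->|vu] := eqVneq v u.
  right; rewrite big_filter_cond big_pred0 // => p.
  by case: eqVneq.
have [v0|v0] := LP v; [by left|right; rewrite -[RHS]v0].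
rewrite big_filter_cond; apply: eq_bigl => p.
by case: (eqVneq p.2 v) => [->|]; rewrite ?andbF ?vu.
Qed.

(** A restriction [s * f] is zero or defined at [x]. Two nonzero ones coincide exactly when [s] and
    [t] have the same germ at [x], by E-unitarity, so the coefficients of equal restrictions add up
    to a value of [fsum L]. *)
Lemma lin_decided L f : idem f -> fsum L = (fun=> 0) ->
  (forall p, p \in L -> let e := star p.2 *g p.2 in f *g e = f \/ f *g e = szero) ->
  amul (lin L) (iota f) = 0.
Proof.
move=> ff L0 dec; have [->|f0] := pselect (f = szero); first by rewrite iota0 amul0r.
have [x xf] := exists_tight invS ff f0.
have -> : amul (lin L) (iota f) = lin [seq (p.1, p.2 *g f) | p <- L].
  rewrite /lin amul_suml big_map; apply: eq_bigr => p _.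
  by rewrite amulZl iotaM.
apply: lin_eq0 => u; have [->|u0] := pselect (u = szero); [by left|right].
rewrite big_map /=; have [/hasP [p0 p0L /eqP p0u]|none] := boolP (has (fun p => p.2 *g f == u) L);
  last first.
  rewrite big_seq_cond big_pred0 // => p; apply/negP => /andP [pL pu].
  by move/hasP: none; apply; exists p.
have on_dom s : s *g f <> szero -> (let e := star s *g s in f *g e = f \/ f *g e = szero) ->
    dom_at (star s *g s) x.
  move=> sf0 [fe|fe]; first by apply: (spec_up xf) => //; exact: idem_stars.
  case: sf0; rewrite -[in LHS](invS.1 s) -mulgA -mulgA (mulgA (star s)).
  by rewrite (invS.2 _ _ (idem_stars invS s) ff) fe muls0.
have xs : dom_at (star p0.2 *g p0.2) x by apply: on_dom (dec _ p0L); rewrite p0u.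
have [g gx] := germ_exists xs.
transitivity (fsum L g); last by rewrite L0.
rewrite /fsum [LHS]big_mkcond [LHS]big_seq [RHS]big_seq /=; apply: eq_bigr => p pL.
rewrite indicE; case: eqVneq => [pu|npu].
  rewrite mem_set ?mulr1 //; apply/(bisection_agree invS _ gx); exists f => //.
  by rewrite pu p0u.
rewrite memNset ?mulr0 // => /(bisection_agree invS _ gx) agr.
have E := agree_unitary invS unitS agr xs; have xp := agree_dom invS agr xs.
have fle s : dom_at (star s *g s) x -> f *g (star s *g s) = f \/ f *g (star s *g s) = szero ->
    f *g (star s *g s) = f.
  move=> xs' [//|fs0]; case: (@spec_zero _ x); rewrite -fs0; exact: specM.
have fE : star p0.2 *g p0.2 *g (star p.2 *g p.2) *g f = f.
  rewrite (invS.2 _ _ _ ff); last by apply: idemM => //; exact: idem_stars.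
  by rewrite mulgA (fle _ xs (dec _ p0L)) (fle _ xp (dec _ pL)).
by move/eqP: npu; apply; rewrite -p0u -fE mulgA -E -mulgA.
Qed.

(** The members of [r] are decided one after the other; whatever an idempotent decides, smaller ones
    decide too. *)
Lemma kill_decided (r : seq S) e b : (forall z, z \in r -> idem z) -> idem e ->
  (forall f, idem f -> f *g e = f ->
    (forall z, z \in r -> f *g z = f \/ f *g z = szero) -> amul b (iota f) = 0) ->
  amul b (iota e) = 0.
Proof.
elim: r => [|z r IH] in e * => rP ee bP; first by apply: bP => //.
have zz := rP z (mem_head _ _).
have [F -> FP] := decB ee zz; rewrite amul_sumr big_seq big1 // => f /FP [ff fe fz].
apply: IH => // [z' z'r|f' ff' ff'f f'r]; first by apply: rP; rewrite inE z'r orbT.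
apply: bP => // [|z']; first by rewrite -ff'f -mulgA fe.
rewrite inE => /predU1P [->|/f'r //].
rewrite -ff'f -mulgA; case: fz => ->; first by left.
by right; rewrite muls0.
Qed.

Lemma lin_kernel L : fsum L = (fun=> 0) -> lin L = 0.
Proof.
move=> L0.
(* Since [s = s * (star s * s)], the element lies in the sum of the left ideals generated by the
   commuting idempotents [iota (star s * s)]. *)
apply: (left_ideal_eq0 (r := [seq (p.1 *: iota p.2, iota (star p.2 *g p.2)) | p <- L])).
- move=> _ _ /mapP [p _ ->] /mapP [q _ ->] /=; rewrite -!iotaM; congr iota.
  by apply: invS.2; exact: idem_stars.
- move=> _ /mapP [p _ ->] /=; rewrite -iotaM; congr iota; exact: idem_stars.
- rewrite big_map /lin; apply: eq_bigr => p _.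
  by rewrite /= amulZl -iotaM mulgA invS.1.
- move=> _ /mapP [p pL ->] /=.
  apply: (@kill_decided [seq star q.2 *g q.2 | q <- L]); last first.
  + move=> f ff _ fP; apply: lin_decided => // q qL /=; apply: fP.
    exact: (map_f (fun q => star q.2 *g q.2) qL).
  + exact: idem_stars.
  + by move=> _ /mapP [q _ ->]; exact: idem_stars.
Qed.

End Kernel.

(** * Tight filters on S(E,C) *)

Section Covers.
Local Open Scope classical_set_scope.
Local Open Scope ring_scope.
Local Open Scope quotient_scope.
Local Notation "x *g y" := ((x * y)%g)
  (at level 40, left associativity, only parsing).

Variables (E : sep_graph) (A : adaptable E).
Local Notation S := (graph_semigroup A).
Implicit Types (v w : vertex E) (e f : edge E) (x y z : gpoint E) (s t : S).
Local Notation vx := (vx A).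
Local Notation ed := (ed A).
Local Notation cg := (cg A).

Lemma graph_inverse : inverse_law S.
Proof. by split; [exact: gs_regular|exact: gs_idem_comm]. Qed.

Lemma graph_e_unitary : e_unitary S.
Proof. by move=> s f ff f0 sf; exact: gs_unitary ff f0 sf. Qed.

Lemma idem_vx v : idem (vx v).
Proof. exact: vx_idem. Qed.

(** [gpoint] does not require consecutive edges to be composable; membership in the range of an edge
    can be expected only of points where they are. *)
Fixpoint wf x : Prop := if x is Step l e y then
  [/\ aidx A e = None, bidx A e = None -> l = 0%N, rng e = start y & wf y] else True.

Lemma wf_act b m x : wf x -> wf (act A b m x).
Proof.
elim: x m => //= l e y IH m [ae be ey wy].
case: eqP => [em|_] /=; first by split=> //; rewrite em.
by split=> //; [rewrite start_act|exact: IH].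
Qed.

Lemma wf_pact (M : seq nat) x : wf x -> wf (pact A M x).
Proof. by move=> wx; elim: M => //= m M; exact: wf_act. Qed.

Lemma wf_ppath g w x : valid A g w -> start x = w -> wf x -> wf (ppath g x).
Proof.
move=> + xw wx; elim: g => //= -[l e] g IH /= [ae be re vg]; split=> //.
  by rewrite re start_ppath xw.
exact: IH.
Qed.

Definition is_step x := if x is Step _ _ _ then true else false.

Lemma is_step_pact (M : seq nat) x : is_step (pact A M x) = is_step x.
Proof. by elim: M => //= m M <-; case: (pact A M x) => //= l e y; case: ifP. Qed.

(** At a free vertex, if coordinate [n] can be lowered then [y] comes from the alpha; otherwise [y]
    begins with a beta of block [n] and exponent 0. At a regular vertex the first step of [y] gives
    the edge, which is why [is_step] is assumed there. *)
Lemma block_point v X y : blocks v X -> wf y -> start y = v ->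
  (rank A v = 0%N -> is_step y) ->
  exists2 e, X e & exists2 z, start z = rng e & enter A e z = y.
Proof.
move=> bX wy yv step; have [rv|rv] := posnP (rank A v).
  have [-> _] := blocks_rank0 rv bX; case: y yv wy {step}(step rv) => //= l e z ev [ae be re _] _.
  exists e => //; exists z => //; rewrite enter_step // be //.
  by case bE: (bidx A e) => [n|//]; have := bidx_rank bE; rewrite ev rv.
have [n ltn ->] := blocks_rank rv bX.
have [cy|ncy] := boolP (can A n y).
  have [a [av aa]] := exists_alpha ltn; exists a; first by split=> //; left.
  exists (act A false n y); last exact: enter_can.
  by rewrite start_act yv; have [_ ->] := aidx_rank aa.
case: y yv wy ncy {step} => //= l e z ev [ae _ re _].
case: eqP => [be|_]; last by rewrite can_ge ?leq_pass.
rewrite -eqn0Ngt => /eqP ->; exists e; first by split=> //; right.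
by exists z => //; rewrite enter_step.
Qed.

Lemma srho_edge e z : start z = rng e ->
  srho (ed e *g star (ed e)) (enter A e z) (enter A e z).
Proof.
by move=> ze; rewrite srhoM; exists z; rewrite srho_star srho_ed.
Qed.

(** A nonzero idempotent [f] fixes a point for every choice of [z] over [w]. A suitable [z] puts
    this point into the range of an edge of [X], and then the product of [f] with the projection of
    that edge is nonzero. *)
Lemma cover_block v X : blocks v X ->
  finite_cover (vx v) [set ed e *g star (ed e) | e in X].
Proof.
move=> bX; split; first exact/finite_image/(adaptable_fsep A bX).
  move=> _ [e Xe <-]; split; first exact: (idem_sstar graph_inverse).
  by rewrite -(block_src bX Xe) -mulgA star_ed_vx.
move=> f [ff fv] f0; have [g [M [w [vg fE]]]] := idem_pos ff f0.
have fix_start y : srho f y y -> start y = v.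
  by rewrite -fv srhoM => -[z []]; rewrite srho_vx => -[].
have f_fix z : start z = w -> srho f (ppath g (pact A M z)) (ppath g (pact A M z)).
  by move=> zw; rewrite fE; exact: srho_nf.
have start_v z : start z = w -> start (ppath g (pact A M z)) = v.
  by move=> /f_fix /fix_start.
have [z [zw wz step]] : exists z, [/\ start z = w, wf z &
    rank A v = 0%N -> is_step (ppath g (pact A M z))].
  pose base u := @Base E u (fun=> 0).
  case: g {vg fE f_fix} start_v => [start_v|[l e] g _]; last by exists (base w).
  have vw : w = v by rewrite -(start_v (base w)) // start_ppath start_pact.
  have [rv|rv] := posnP (rank A v).
    (* The path would have length 0 at a regular vertex, so it is prolonged by an edge of [X]. *)
    have [e Xe] := block_nonempty bX; have se := block_src bX Xe.
    exists (Step 0 e (base (rng e))); rewrite /= is_step_pact se vw; split=> //.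
    by split=> //; case ae: (aidx A e) => [n|//]; have [] := aidx_rank ae; rewrite se rv.
  by exists (base w); split=> // rv0; rewrite rv0 in rv.
have [e Xe [z' z'e z'E]] := block_point bX
  (wf_ppath vg (etrans (start_pact A M z) zw) (wf_pact M wz)) (start_v z zw) step.
exists (ed e *g star (ed e)); first by exists e.
move=> fe0; apply: (@srho_zero E A (enter A e z') (enter A e z')); rewrite -fe0 srhoM.
exists (enter A e z'); split; first exact: srho_edge.
by rewrite z'E; exact: f_fix.
Qed.

End Covers.

(** * Deciding idempotents by tight filters and by R10, and expansion of algebra terms *)

Section Decision.
Local Open Scope classical_set_scope.
Local Open Scope ring_scope.
Local Open Scope quotient_scope.
Local Notation "x *g y" := ((x * y)%g)
  (at level 40, left associativity, only parsing).

Variables (K : fieldType) (bar : {rmorphism K -> K}).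
Variables (E : sep_graph) (A : adaptable E).
Local Notation S := (graph_semigroup A).
Local Notation B := (graph_alg bar A).
Local Notation iota := (@graph_iota K bar E A).
Implicit Types (v w u : vertex E) (e : edge E) (s t f z : S) (x : tight_spectrum S).
Local Notation vx := (vx A).
Local Notation ed := (ed A).
Local Notation cg := (cg A).

Lemma iotaM s t : iota (s *g t) = amul (iota s) (iota t).
Proof.
elim/quotW: s => a; elim/quotW: t => b; rewrite -piM !graph_iotaE.
exact: esym (ga_mulE _ _ _ _).
Qed.

Lemma iota0 : iota szero = 0.
Proof. by rewrite -pi_zero graph_iotaE. Qed.

Lemma big_AAdd (r : seq (edge E)) (F : edge E -> aterm K E) :
  \pi_B (\big[@AAdd K E/AZero]_(e <- r) F e) = \sum_(e <- r) \pi_B (F e).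
Proof.
elim: r => [|e r IH]; first by rewrite !big_nil.
by rewrite !big_cons -IH; exact: esym (ga_addE _ _ _ _).
Qed.

Lemma iota_block v X (r : seq (edge E)) : blocks v X -> uniq r -> [set` r] = X ->
  iota (vx v) = \sum_(e <- r) iota (ed e *g star (ed e)).
Proof.
move=> bX ur rX; rewrite graph_iotaE /=.
have /graph_algP -> := R10 bar A bX ur rX; rewrite big_AAdd; apply: eq_bigr => e _.
by rewrite -pi_star -piM graph_iotaE.
Qed.

Lemma tight_vertex x : exists u, set_val x (vx u).
Proof.
have [f xf] : set_val x !=set0 by have [[_ ? _ _ _] _] := spectrumP x.
have ff := spec_idem xf; have f0 : f <> szero by move=> f0; apply: (@spec_zero _ x); rewrite -f0.
have [g [M [w [vg fE]]]] := idem_pos ff f0; exists (pstart g w).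
apply: (spec_up xf); first exact: idem_vx.
by rewrite fE -mulgA -{1}[vx _]vx_star -starM vx_pos.
Qed.

Definition decided f z := f *g z = f \/ f *g z = szero.

(* Both the tight filters and the relations R10 decide [z]. *)
Definition decides z := (forall x, exists2 f, set_val x f & decided f z) /\
  forall v, exists2 r : seq S, iota (vx v) = \sum_(f <- r) iota f &
    forall f, f \in r -> idem f /\ decided f z.

Lemma decided_vx u v : decided (vx u) (vx v).
Proof.
have [->|uv] := pselect (u = v); first by left; exact: vx_idem.
by right; exact: vx_orth.
Qed.

Lemma decides_vx v : decides (vx v).
Proof.
split=> [x|u].
  by have [u xu] := tight_vertex x; exists (vx u) => //; exact: decided_vx.
exists [:: vx u]; first by rewrite big_seq1.
by move=> f; rewrite inE => /eqP ->; split; [exact: idem_vx|exact: decided_vx].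
Qed.

(** The vertex [v] splits, in the algebra as for tight filters, into [s * star s] and pieces
    orthogonal to it. The pieces and all other vertices are orthogonal to [s * z * star s]; on
    [s * star s] the decision of [z] is conjugated by [s]. *)
Lemma decides_conj (s : S) (r : seq S) v w z : idem z ->
  star s *g s = vx w -> vx v *g s = s ->
  iota (vx v) = iota (s *g star s) + \sum_(t <- r) iota (t *g star t) ->
  (forall x, set_val x (vx v) -> set_val x (s *g star s) \/
     exists2 t, t \in r & set_val x (t *g star t)) ->
  (forall t, t \in r -> star t *g s = szero) ->
  decides z -> decides (s *g z *g star s).
Proof.
move=> zz ss vs vE vcov orth [zx zv].
have inv := graph_inverse A.
have sw : s *g vx w = s by rewrite -ss mulgA inv.1.
have ws : vx w *g star s = star s by rewrite -{1}vx_star -starM sw.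
have other u : u <> v -> decided (vx u) (s *g z *g star s).
  move=> uv; right; have us : vx u *g s = szero.
    by rewrite -vs mulgA vx_orth // mul0s.
  by rewrite !mulgA us !mul0s.
have orth' t : t \in r -> decided (t *g star t) (s *g z *g star s).
  by move=> /orth ts; right; rewrite -!mulgA (mulgA (star t)) ts mul0s muls0.
have conj f : idem f -> decided f z -> decided (s *g f *g star s) (s *g z *g star s).
  move=> ff; rewrite /decided.
  have -> : s *g f *g star s *g (s *g z *g star s) = s *g (f *g z) *g star s.
    rewrite -!mulgA (mulgA (star s)) ss (mulgA (vx w)) (inv.2 _ _ (idem_vx A w) zz).
    by rewrite -(mulgA z) ws.
  by case=> ->; [left|right; rewrite muls0 mul0s].
split=> [x|u].
  have [u xu] := tight_vertex x; have [uv|/other dec] := pselect (u = v); last by exists (vx u).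
  rewrite uv in xu; case: (vcov _ xu) => [xs|[t tr xt]]; last first.
    by exists (t *g star t) => //; exact: orth'.
  have [|y sxy] := @acts_exists S inv (star s) x; first by rewrite /dom_at /= starK.
  have [f yf fz] := zx y; exists (s *g f *g star s).
    by move: yf; rewrite sxy starK => -[].
  by apply: conj => //; exact: spec_idem yf.
have [->|/other dec] := pselect (u = v); last first.
  exists [:: vx u]; first by rewrite big_seq1.
  by move=> f; rewrite inE => /eqP ->; split=> //; exact: idem_vx.
have [rz zE rzP] := zv w.
exists ([seq s *g f *g star s | f <- rz] ++ [seq t *g star t | t <- r]).
  rewrite big_cat !big_map /= vE; congr (_ + _).
  rewrite -{1}sw !iotaM zE amul_sumr amul_suml; apply: eq_bigr => f _.
  by rewrite !iotaM.
move=> f; rewrite mem_cat => /orP [] /mapP [f' f'r ->].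
  have [ff' f'z] := rzP _ f'r; split; last exact: conj.
  exact: (idem_conjV inv).
by split; [exact: (idem_sstar inv)|exact: orth'].
Qed.

(** The orthogonal pieces come from the other edges in the block of [e]: R10 splits the vertex in
    the algebra, and [cover_block] does so for tight filters. *)
Lemma decides_edge e z : idem z -> decides z -> decides (ed e *g z *g star (ed e)).
Proof.
move=> zz; have [X bX Xe] := exists_block e.
have [r' XE] := (finite_seqP X).1 (adaptable_fsep A bX).
pose r := undup r'; have rX : [set` r] = X.
  by rewrite XE; apply/seteqP; split=> f /=; rewrite mem_undup.
have er : e \in r by move: Xe; rewrite -rX.
have rem_neq (f : edge E) : f \in rem e r -> X f /\ f <> e.
  rewrite mem_rem_uniq ?undup_uniq // inE => /andP [/eqP fe fr].
  by split=> //; rewrite -rX.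
apply: (@decides_conj _ [seq ed f | f : edge E <- rem e r] (src e) (rng e)) => //.
- exact: ed_star_ed.
- exact: vx_ed.
- rewrite (iota_block bX (undup_uniq r') rX) (big_rem e er) /= big_map //.
- move=> x xv; have [_ [f Xf <-] xf] := spec_cover xv (cover_block A bX).
  have [<-|fe] := pselect (f = e); [by left|right].
  exists (ed f) => //; apply: map_f; rewrite mem_rem_uniq ?undup_uniq // inE.
  by move: Xf; rewrite -rX /= => ->; rewrite andbT; apply/eqP.
- move=> _ /mapP [f /rem_neq [Xf fe] ->].
  exact: (ed_orth A bX Xf Xe fe).
Qed.

Lemma decides_cg v m z : idem z -> decides z -> decides (cg v m *g z *g star (cg v m)).
Proof.
move=> zz; case: cgP => [p i _ _ _|i _]; first exact: decides_edge.
(* A [t] is unitary at [v], so no orthogonal piece remains. *)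
apply: (@decides_conj _ [::] v v) => //.
- by rewrite tt_star Vtt.
- exact: vx_tt.
- by rewrite big_nil addr0 tt_star ttV.
- by move=> x xv; left; rewrite tt_star ttV.
Qed.

(** [U * star U] arises from a vertex by successive conjugation with edges and coordinates. *)
Lemma decides_pos g (M : seq nat) w : valid A g w ->
  decides (pos A g M w *g star (pos A g M w)).
Proof.
have inv := graph_inverse A.
have step s t : (forall z, idem z -> decides z -> decides (s *g z *g star s)) ->
    decides (t *g star t) -> decides (s *g t *g star (s *g t)).
  move=> sP tP; rewrite starM -mulgA (mulgA t) mulgA.
  by apply: sP => //; exact: (idem_sstar inv).
elim: g => [_|[l e] g IH /= [ae be re vg]].
  elim: M => [|m M IH]; first by rewrite /pos /= vx_star vx_idem; exact: decides_vx.
  by apply: step => // z; exact: decides_cg.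
rewrite /seg; elim: l be => [|l IHl] be.
  by apply: step => [z|]; [exact: decides_edge|exact: IH].
have be' : bidx A e = None -> l = 0%N by move/be.
rewrite iterS; apply: step => [z|]; last exact: IHl.
rewrite /loop; case bE: (bidx A e) be => [j|] be; last by have := be erefl.
exact: decides_cg.
Qed.

Lemma decides_idem z : idem z -> decides z.
Proof.
move=> zz; have [->|z0] := pselect (z = szero); last first.
  by have [g [M [w [vg ->]]]] := idem_pos zz z0; exact: decides_pos.
split=> [x|v].
  by have [u xu] := tight_vertex x; exists (vx u) => //; right; rewrite muls0.
exists [:: vx v]; first by rewrite big_seq1.
by move=> f; rewrite inE => /eqP ->; split; [exact: idem_vx|right; rewrite muls0].
Qed.

Lemma graph_decisive : decisive S.
Proof. by move=> x z /decides_idem [+ _]. Qed.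

Lemma graph_decision f z : idem f -> idem z -> exists2 r : seq S,
  iota f = \sum_(h <- r) iota h &
  forall h, h \in r -> [/\ idem h, h *g f = h & h *g z = h \/ h *g z = szero].
Proof.
have inv := graph_inverse A.
move=> ff zz; have [f0|f0] := pselect (f = szero).
  by exists [::]; rewrite ?big_nil // f0 iota0.
have [g [M [w [vg fE]]]] := idem_pos ff f0.
have [_ /(_ (pstart g w)) [r vE rP]] := decides_idem zz.
exists [seq h *g f | h <- r].
  have vf : vx (pstart g w) *g f = f by rewrite fE mulgA vx_pos.
  rewrite -[in LHS]vf iotaM vE amul_suml big_map; apply: eq_bigr => h _.
  by rewrite iotaM.
move=> _ /mapP [h /rP [hh hz] ->]; split; first exact: (idemM inv).
  by rewrite -mulgA ff.
rewrite -mulgA (inv.2 _ _ ff zz) mulgA.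
by case: hz => ->; [left|right; rewrite mul0s].
Qed.

(** Expanding terms syntactically defines the map to functions on terms first; its invariance is
    then checked relation by relation in [formal_acong]. *)
Fixpoint formal (a : aterm K E) : seq (K * S) := match a with
  | AZero => [::]
  | AGen g => [:: (1, \pi_S (SGen g))]
  | AAdd a1 a2 => formal a1 ++ formal a2
  | AOpp a1 => lscale (-1) (formal a1)
  | AScale k a1 => lscale k (formal a1)
  | AMul a1 a2 => lmul (formal a1) (formal a2)
  | AStar a1 => lstar bar (formal a1)
  end.

Lemma pi_AAdd a b : \pi_B (AAdd a b) = \pi_B a + \pi_B b :> B.
Proof. exact: esym (ga_addE bar A a b). Qed.

Lemma pi_AOpp a : \pi_B (AOpp a) = - \pi_B a :> B.
Proof. exact: esym (ga_oppE bar A a). Qed.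

Lemma pi_AScale k a : \pi_B (AScale k a) = k *: (\pi_B a : B).
Proof. exact: esym (ga_scaleE bar A k a). Qed.

Lemma pi_AMul a b : \pi_B (AMul a b) = amul (\pi_B a : B) (\pi_B b).
Proof. exact: esym (ga_mulE bar A a b). Qed.

Lemma pi_AStar a : \pi_B (AStar a) = astar (\pi_B a : B).
Proof. exact: esym (ga_starE bar A a). Qed.

(** In particular the image of [S] spans the algebra, which is what brings an arbitrary kernel
    element under [lin_kernel]. *)
Lemma lin_formal a : lin iota (formal a) = \pi_B a.
Proof.
elim: a => [|g|a IHa b IHb|a IHa|k a IHa|a IHa b IHb|a IHa] /=.
- by rewrite /lin big_nil.
- by rewrite /lin big_seq1 scale1r graph_iotaE.
- by rewrite pi_AAdd -IHa -IHb /lin big_cat.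
- rewrite pi_AOpp -IHa /lin big_map -sumrN.
  by apply: eq_bigr => p _; rewrite mulN1r scaleNr.
- rewrite pi_AScale -IHa /lin big_map scaler_sumr.
  by apply: eq_bigr => p _; rewrite scalerA.
- rewrite pi_AMul -IHa -IHb /lin amul_suml big_allpairs_dep.
  apply: eq_bigr => p _; rewrite amul_sumr; apply: eq_bigr => q _.
  by rewrite amulZl amulZr scalerA iotaM.
- rewrite pi_AStar -IHa /lin big_map.
  rewrite (big_morph _ (@astarD _ _ _) (_ : astar 0 = 0)).
    apply: eq_bigr => p _; rewrite astarZ; congr (_ *: _).
    case: p => c s /=; elim/quotW: s => t; rewrite -pi_star !graph_iotaE.
    exact: pi_AStar.
  by rewrite -(scale0r (0 : B)) astarZ rmorph0 !scale0r.
Qed.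

End Decision.

(** * The isomorphism *)

Section Main.
Local Open Scope classical_set_scope.
Local Open Scope ring_scope.
Local Open Scope quotient_scope.
Local Notation "x *g y" := ((x * y)%g)
  (at level 40, left associativity, only parsing).

Variables (K : fieldType) (bar : {rmorphism K -> K}) (barK : involutive bar).
Variables (E : sep_graph) (A : adaptable E).
Local Notation S := (graph_semigroup A).
Local Notation B := (graph_alg bar A).
Local Notation formal := (@formal K bar E A).
Implicit Types (a b : aterm K E) (L M : seq (K * S)).

Let inv := graph_inverse A.

Lemma fsum_lmul L M (g : germ S) : fsum (lmul L M) g =
  \sum_(p <- L) \sum_(q <- M) p.1 * q.1 * \1_(bisection (p.2 *g q.2)) g.
Proof. by rewrite /fsum big_allpairs_dep. Qed.

Lemma fsum_one (s : S) : fsum [:: (1, s)] = \1_(bisection s) :> (germ S -> K).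
Proof. by apply/funext => g; rewrite /fsum big_seq1 mul1r. Qed.

Lemma formal_sterm (u : sterm E) :
  fsum (formal (of_sterm K u)) = \1_(bisection (\pi_S u)).
Proof.
elim: u => [|g|u IHu w IHw|u IHu] /=.
- apply/funext => g; rewrite /fsum big_nil indicE memNset //.
  by rewrite pi_zero; exact: bisection_zero.
- exact: fsum_one.
- rewrite -(convolution_fsum inv) IHu IHw -!fsum_one (convolution_fsum inv).
  by rewrite /= /lmul /= mulr1 -piM.
- rewrite -(fsum_star inv bar) IHu -!fsum_one (fsum_star inv bar) /lstar /=.
  by rewrite rmorph1 -pi_star.
Qed.

(** This is R10 for functions: the source of a germ in [bisection (vx A v)] is a tight filter, so it
    contains one projection of the cover given by [X], and only one since they are orthogonal. *)
Lemma bisection_block v X (r : seq (edge E)) (g : germ S) :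
  blocks v X -> uniq r -> [set` r] = X ->
  \1_(bisection (vx A v)) g =
  \sum_(e <- r) \1_(bisection (ed A e *g star (ed A e))) g :> K.
Proof.
move=> bX ur rX.
have Xr e : e \in r -> X e by rewrite -rX.
have sub e : e \in r -> bisection (ed A e *g star (ed A e)) `<=` bisection (vx A v).
  move=> /Xr Xe; have -> : ed A e *g star (ed A e) = vx A v *g (ed A e *g star (ed A e)).
    by rewrite -(block_src bX Xe) mulgA vx_ed.
  exact: (bisection_mulr inv (idem_sstar inv _)).
rewrite indicE; case: (boolP (_ \in _)) => [/set_mem|/negP] gv; last first.
  rewrite big_seq big1 // => e er; rewrite indicE memNset // => /(sub e er) gv'.
  by apply: gv; exact/mem_set.
have := gv => /bisectionP [x gx]; have [xv _] := gx.
rewrite /dom_at /= vx_star vx_idem in xv.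
have [_ [e Xe <-] xe] := spec_cover xv (cover_block A bX).
have er : e \in r by move: Xe; rewrite -rX.
have ge : bisection (ed A e *g star (ed A e)) g.
  apply/(bisection_agree inv _ gx); exists (ed A e *g star (ed A e)) => //.
  by rewrite (idem_sstar inv) mulgA -(block_src bX Xe) vx_ed.
rewrite (big_rem e er) /= indicE mem_set // big_seq big1 ?addr0 // => f fr.
have [fe /Xr Xf] : f <> e /\ f \in r.
  by move: fr; rewrite mem_rem_uniq // inE => /andP [/eqP ? ?].
rewrite indicE memNset // => /bisectionP [y gy].
have [xy _] := is_germ_uniq inv gx gy; subst y; have [xf _] := gy.
apply: (@spec_zero _ x); have := specM xe xf.
rewrite starM starK -!mulgA (mulgA (star (ed A e))).
by rewrite (ed_orth A bX Xe Xf) ?mul0s ?muls0 //; exact/nesym.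
Qed.

Lemma formal_acong a b : acong bar A a b -> fsum (formal a) = fsum (formal b).
Proof.
elim=> {a b} //=.
- by move=> b a c _ -> _ ->.
- move=> a a' b b' _ aE _ bE; apply/funext => g.
  by rewrite !fsum_cat aE bE.
- by move=> a a' _ aE; apply/funext => g; rewrite !fsum_scale aE.
- by move=> k a a' _ aE; apply/funext => g; rewrite !fsum_scale aE.
- by move=> a a' b b' _ aE _ bE; rewrite -!(convolution_fsum inv) aE bE.
- by move=> a a' _ aE; rewrite -!(fsum_star inv) aE.
- by move=> a b c; rewrite catA.
- by move=> a b; apply/funext => g; rewrite !fsum_cat addrC.
- by move=> a; apply/funext => g; rewrite fsum_cat fsum_scale mulN1r addNr /fsum big_nil.
- by move=> k l a; apply/funext => g; rewrite !fsum_scale mulrA.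
- by move=> a; apply/funext => g; rewrite fsum_scale mul1r.
- by move=> k a b; apply/funext => g; rewrite fsum_cat !fsum_scale fsum_cat mulrDr.
- by move=> k l a; apply/funext => g; rewrite fsum_cat !fsum_scale mulrDl.
- move=> a b c; apply/funext => g; rewrite !fsum_lmul big_allpairs_dep /=.
  apply: eq_bigr => p _; rewrite big_allpairs_dep; apply: eq_bigr => q _.
  by apply: eq_bigr => r _ /=; rewrite mulrA mulgA.
- by move=> a b c; apply/funext => g; rewrite fsum_cat !fsum_lmul big_cat.
- move=> a b c; apply/funext => g; rewrite fsum_cat !fsum_lmul -big_split.
  by apply: eq_bigr => p _; rewrite big_cat.
- move=> k a b; apply/funext => g; rewrite fsum_scale !fsum_lmul big_map mulr_sumr.
  apply: eq_bigr => p _; rewrite mulr_sumr; apply: eq_bigr => q _ /=.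
  by rewrite !mulrA.
- move=> k a b; apply/funext => g; rewrite fsum_scale !fsum_lmul mulr_sumr.
  apply: eq_bigr => p _; rewrite big_map mulr_sumr; apply: eq_bigr => q _ /=.
  by rewrite !mulrA [p.1 * k]mulrC.
- move=> a; congr fsum; rewrite /lstar -map_comp -[RHS]map_id; apply: eq_map => -[c s] /=.
  by rewrite barK starK.
- move=> a b; apply/funext => g; rewrite fsum_lmul /fsum big_map big_allpairs_dep.
  rewrite big_map exchange_big; apply: eq_bigr => q _; rewrite big_map; apply: eq_bigr => p _ /=.
  by rewrite rmorphM starM [bar _ * _]mulrC.
- by move=> a b; congr fsum; rewrite /lstar map_cat.
- move=> k a; congr fsum; rewrite /lstar /lscale -!map_comp; apply: eq_map => -[c s] /=.
  by rewrite rmorphM.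
- by move=> u w uw; rewrite !formal_sterm (pi_rel uw).
- move=> v X r bX ur rX; rewrite fsum_one; apply/funext => g.
  rewrite (bisection_block g bX ur rX).
  elim: r {bX ur rX} => [|e r IH]; first by rewrite !big_nil /= /fsum big_nil.
  rewrite !big_cons IH /= -cat1s fsum_cat; congr (_ + _).
  by rewrite /lmul /lstar /= rmorph1 mulr1 /fsum big_seq1 mul1r.
Qed.

Definition germ_rep (b : B) : germ S -> K := fsum (formal (repr b)).

Lemma germ_rep_pi a : germ_rep (\pi_B a) = fsum (formal a).
Proof. exact/formal_acong/acong_repr. Qed.

Lemma germ_rep_eq0 (b : B) : germ_rep b = (fun=> 0) -> b = 0.
Proof.
elim/quotW: b => a; rewrite germ_rep_pi => a0; rewrite -lin_formal.
apply: (lin_kernel inv (@graph_e_unitary _ A)) a0.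
- exact: iotaM.
- exact: iota0.
- exact: graph_decision.
Qed.

Lemma germ_rep_linear k (a b : B) g : germ_rep (k *: a + b) g = k * germ_rep a g + germ_rep b g.
Proof.
elim/quotW: a => a; elim/quotW: b => b.
by rewrite -pi_AScale -pi_AAdd !germ_rep_pi /= fsum_cat fsum_scale.
Qed.

Lemma germ_rep_iota (s : S) : germ_rep (graph_iota bar s) = \1_(bisection s).
Proof. by elim/quotW: s => u; rewrite graph_iotaE germ_rep_pi formal_sterm. Qed.

Lemma germ_rep_lin L : germ_rep (lin (@graph_iota K bar E A) L) = fsum L.
Proof.
apply/funext => g; rewrite /lin /fsum; elim: L => [|p L IH].
  (* Zero is written as [-1 *: 0 + 0] to evaluate [germ_rep] there by its linearity law. *)
  rewrite !big_nil -[0 : B](addNr 0) -scaleN1r germ_rep_linear mulN1r.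
  exact: addNr.
by rewrite !big_cons germ_rep_linear IH germ_rep_iota.
Qed.

Lemma germ_rep_isomorphism : star_isomorphism germ_rep.
Proof.
split.
- exact: germ_rep_linear.
- elim/quotW=> a; elim/quotW=> b; rewrite -pi_AMul !germ_rep_pi.
  by rewrite (convolution_fsum inv).
- by elim/quotW=> a; rewrite -pi_AStar !germ_rep_pi (fsum_star inv).
- split.
  + by move=> b _; exact: (steinberg_fsum inv (@graph_decisive K bar E A) (@graph_e_unitary _ A)).
  + move=> b c _ _ bc; apply/eqP; rewrite -subr_eq0; apply/eqP/germ_rep_eq0.
    apply/funext => g; rewrite addrC -scaleN1r germ_rep_linear bc mulN1r.
    exact: addNr.
  + move=> phi /(steinberg_spanned inv (@graph_decisive K bar E A) (@graph_e_unitary _ A)).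
    move=> [L LP]; exists (lin (@graph_iota K bar E A) L) => //.
    by rewrite germ_rep_lin; apply/funext => g; rewrite LP.
Qed.

End Main.

Theorem theorem4p14 (K : fieldType) (bar : {rmorphism K -> K})
    (barK : involutive bar) (E : sep_graph) (A : adaptable E) :
  exists phi : graph_alg bar A -> germ (graph_semigroup A) -> K,
    star_isomorphism phi /\
    forall s : graph_semigroup A,
      phi (graph_iota bar s) = (\1_(Theta s (dom_at (star s * s)%g)))%R.
Proof.
exists (@germ_rep K bar E A); split; first exact: germ_rep_isomorphism.
exact: germ_rep_iota.
Qed.
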